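(* Let $\mathfrak{n}$ be a six-dimensional, non-abelian, nilpotent real Lie algebra admitting a coupled ${\rm SU}(3)$-structure. Then $\mathfrak{n}$ is isomorphic to one of the following two Lie algebras: $$\mathfrak{n}_9=(0,0,0,e^{12},e^{14}-e^{23},e^{15}+e^{34}),\qquad \mathfrak{n}_{28}=(0,0,0,0,e^{13}-e^{24},e^{14}+e^{23}).$$ Moreover, up to isomorphism, the only (six-dimensional) nilpotent Lie algebra admitting a coupled ${\rm SU}(3)$-structure whose associated inner product is a nilsoliton is $\mathfrak{n}_{28}$.
   Context: Notation for Lie algebras: $(\alpha_1,\dots,\alpha_6)$ denotes the Lie algebra whose dual has a basis $(e^1,\dots,e^6)$ with $de^j=\alpha_j$, where $d$ is the Chevalley–Eilenberg differential and $e^{ij}=e^i\wedge e^j$. E.g. $\mathfrak{n}_9$ has $de^1=de^2=de^3=0$, $de^4=e^{12}$, $de^5=e^{14}-e^{23}$, $de^6=e^{15}+e^{34}$. ${\rm SU}(3)$-structures: Let $V$ be a six-dimensional oriented real vector space. Let $A:\Lambda^5(V^* )\to V\otimes\Lambda^6(V^* )$ be the canonical isomorphism $A(\gamma)=w\otimes\Omega$, where $i_w\Omega=\gamma$. For $\sigma\in\Lambda^3(V^* )$ set $K_\sigma:V\to V\otimes\Lambda^6(V^* )$, $K_\sigma(w)=A((i_w\sigma)\wedge\sigma)$, and $\lambda(\sigma)=\frac16{\rm tr}K_\sigma^2\in(\Lambda^6(V^* ))^{\otimes 2}$. A 3-form $\sigma$ is stable (its ${\rm GL}(V)$-orbit is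 open) iff $\lambda(\sigma)\neq0$; then $\sqrt{|\lambda(\sigma)|}\in\Lambda^6(V^* )$ denotes the positively oriented root and $J_\sigma=\frac{1}{\sqrt{|\lambda(\sigma)|}}K_\sigma$, which is a complex structure on $V$ when $\lambda(\sigma)<0$. A 2-form $\omega$ is stable iff $\omega^3\neq0$. A pair of stable forms $(\omega,\sigma)\in\Lambda^2(V^* )\times\Lambda^3(V^* )$ is compatible if $\omega\wedge\sigma=0$ and normalized if $J_\sigma^*\sigma\wedge\sigma=\frac23\omega^3$, where $(J_\sigma^*\sigma)(x,y,z)=\sigma(J_\sigma x,J_\sigma y,J_\sigma z)$. An ${\rm SU}(3)$-structure on a six-dimensional Lie algebra $\mathfrak{n}$ (equivalently, a left-invariant one on the corresponding simply connected Lie group) is, for an orientation on $V=\mathfrak{n}$, a pair of stable forms $(\omega,\sigma)\in\Lambda^2(\mathfrak{n}^* )\times\Lambda^3(\mathfrak{n}^* )$ that is compatible, normalized, has $\lambda(\sigma)<0$, and such that $h(\cdot,\cdot)=\omega(J_\sigma\cdot,\cdot)$ is positive definite; $h$ is called the associated inner product (the inner product induced by the structure). Here $\sigma={\rm Re}(\Psi)$ for the $(3,0)$-form $\Psi=\sigma+{\rm i}J_\sigma^*\sigma$. The ${\rm SU}(3)$-structure $(\omega,\sigma)$ is coupled if $d\omega=c\,\sigma$ for some nonzero real number $c$. An inner product $h$ on a nilpotent Lie algebra $\mathfrak{n}$ is a nilsoliton if the Ricci operator of the corresponding left-invariant metric on the simply connected Lie group satisfies ${\rm Ric}(h)=\mu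 I+D$ for some $\mu\in\mathbb{R}$ and some derivation $D$ of $\mathfrak{n}$. *)

(* Defs.v *)
From HB Require Import structures.
From mathcomp Require Import all_boot all_order perm all_algebra.
From mathcomp Require Import all_classical all_reals all_analysis.
From mathcomp Require Import ring.

Set Implicit Arguments.
Unset Strict Implicit.
Unset Printing Implicit Defensive.

Import Order.TTheory GRing.Theory Num.Theory.
Import numFieldNormedType.Exports.

Local Open Scope classical_set_scope.
Local Open Scope ring_scope.

Record lie_algebra (R : realType) (V : vectType R) := LieAlgebra {
  lie_br :> V -> V -> V;
  lie_linearl : forall y, linear (lie_br^~ y);
  lie_linearr : forall x, linear (lie_br x);
  lie_alternating : forall x, lie_br x x = 0;
  lie_jacobi : forall x y z,
    lie_br x (lie_br y z) + lie_br y (lie_br z x) + lie_br z (lie_br x y) = 0 }.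

Section LieAlgebras.
Variables (R : realType) (V : vectType R) (L : lie_algebra V).

Definition lie_abelian : Prop := forall x y, L x y = 0.

(* By bilinearity, brackets of basis vectors span [V, lie_lcs m]. *)
Fixpoint lie_lcs (n : nat) : {vspace V} :=
  if n is m.+1
  then <<[seq L x y | x <- vbasis {:V}, y <- vbasis (lie_lcs m)]>>%VS
  else {:V}%VS.

Definition lie_nilpotent : Prop := exists n, lie_lcs n = 0%VS.

Definition lie_derivation (D : 'End(V)) : Prop :=
  forall x y, D (L x y) = L (D x) y + L x (D y).

End LieAlgebras.

Definition lie_iso (R : realType) (V W : vectType R)
    (L : lie_algebra V) (M : lie_algebra W) : Prop :=
  exists2 f : 'Hom(V, W), bijective f & forall x y, f (L x y) = M (f x) (f y).

Definition trace (R : realType) (V : vectType R) (f : 'End(V)) : R :=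
  \tr (passmx.mxof (vbasis {:V}) (vbasis {:V}) f).

Section Forms.
Variables (R : realType) (V : vectType R).

(* [cochain k] is the type of all functions of k vectors; the elements of
   Lambda^k(V^* ) are those satisfying [is_form]. *)
Definition cochain (k : nat) := k.-tuple V -> R.

Definition subst_tuple (k : nat) (v : k.-tuple V) (i : 'I_k) (x : V) :=
  [tuple if j == i then x else tnth v j | j < k].

Definition is_form (k : nat) (a : cochain k) : Prop :=
  (forall v i c x y, a (subst_tuple v i (c *: x + y)) =
     c * a (subst_tuple v i x) + a (subst_tuple v i y)) /\
  (forall v i j, i != j -> tnth v i = tnth v j -> a v = 0).

(* Determinant convention: (e /\ f)(x, y) = e(x) f(y) - e(y) f(x). *)
Definition wedge (k l : nat) (a : cochain k) (b : cochain l) : cochain (k + l) :=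
  fun v => ((k`! * l`!)%:R)^-1 * \sum_(s : 'S_(k + l)) (-1) ^+ s *
    (a [tuple tnth v (s (lshift l i)) | i < k] *
     b [tuple tnth v (s (rshift k j)) | j < l]).

Definition contract (k : nat) (w : V) (a : cochain k.+1) : cochain k :=
  fun v => a [tuple of w :: v].

Definition pullback (k : nat) (g : 'End(V)) (a : cochain k) : cochain k :=
  fun v => a [tuple of map g v].

(* Chevalley-Eilenberg differential:
     (d a)(v_0, ..., v_(m+1)) =
       \sum_(i < j) (-1)^(i+j) a([v_i, v_j], v_0, .. ^v_i .. ^v_j .., v_(m+1)).
   For i < j, [lift j i] is i, and [lift j (lift i l)] enumerates the indices
   other than i and j in increasing order. *)
Definition ext_d (L : lie_algebra V) (m : nat) (a : cochain m.+1) : cochain m.+2 :=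
  fun v => \sum_(j < m.+2) \sum_(i < m.+1 | (i < j)%N) (-1) ^+ (i + j) *
    a [tuple of L (tnth v (lift j i)) (tnth v j) ::
                [tuple tnth v (lift j (lift i l)) | l < m]].

Definition GL_orbit (k : nat) (a : cochain k) : set (cochain k) :=
  [set b | exists2 g : 'End(V), lker g == 0%VS & b = pullback g a].

(* As Lambda^k(V^* ) is finite-dimensional, pointwise convergence induces its
   usual topology. *)
Definition stable (k : nat) (a : cochain k) : Prop :=
  exists U : set {ptws k.-tuple V -> R},
    open U /\ forall b : cochain k, is_form b -> (U b <-> GL_orbit a b).

End Forms.

Section SU3.
Variables (R : realType) (V : vectType R).

(* An orientation of the six-dimensional space V is represented by a positive
   volume form nu. Powers of the line Lambda^6(V^* ) are trivialized by nu:
   with [A_iso], [K_end] and [lambda] as below, one has A(gamma) = A_iso (x) nu,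
   K_sigma = K_end (x) nu and lambda(sigma) = lambda (x) nu^2, and the
   positively oriented root of |lambda(sigma)| is sqrt |lambda| (x) nu.
   The sign of [lambda] does not depend on nu, and [J_end] depends only on the
   orientation defined by nu. *)
Definition volume_form (nu : cochain V 6) : Prop :=
  is_form nu /\ exists v, nu v != 0.

Definition A_iso (nu : cochain V 6) (gamma : cochain V 5) : V :=
  xget 0 [set w | contract w nu = gamma].

Definition K_end (nu : cochain V 6) (sigma : cochain V 3) : 'End(V) :=
  linfun (fun w => A_iso nu (wedge (contract w sigma) sigma)).

Definition lambda (nu : cochain V 6) (sigma : cochain V 3) : R :=
  6^-1 * trace (K_end nu sigma \o K_end nu sigma)%VF.

Definition J_end (nu : cochain V 6) (sigma : cochain V 3) : 'End(V) :=
  (Num.sqrt `|lambda nu sigma|)^-1 *: K_end nu sigma.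

Definition assoc_metric (nu : cochain V 6) (omega : cochain V 2)
    (sigma : cochain V 3) (x y : V) : R :=
  omega [tuple J_end nu sigma x; y].

Record SU3_structure (nu : cochain V 6) (omega : cochain V 2)
    (sigma : cochain V 3) : Prop := {
  SU3_volume : volume_form nu;
  SU3_form2 : is_form omega;
  SU3_form3 : is_form sigma;
  SU3_stable2 : stable omega;
  SU3_stable3 : stable sigma;
  SU3_compatible : forall v, wedge omega sigma v = 0;
  SU3_normalized : forall v,
    wedge (pullback (J_end nu sigma) sigma) sigma v =
    2 / 3 * wedge omega (wedge omega omega) v;
  SU3_lambda : lambda nu sigma < 0;
  SU3_positive : forall x, x != 0 -> 0 < assoc_metric nu omega sigma x x }.

Variable L : lie_algebra V.

Definition coupled (omega : cochain V 2) (sigma : cochain V 3) : Prop :=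
  exists2 c : R, c != 0 & forall v, ext_d L omega v = c * sigma v.

Definition admits_coupled : Prop :=
  exists nu omega sigma, SU3_structure nu omega sigma /\ coupled omega sigma.

(* Left-invariant Riemannian geometry is expressed on left-invariant vector
   fields, i.e. on the Lie algebra; [nabla x y] is the derivative of y along x. *)
Definition levi_civita (h : V -> V -> R) (nabla : 'Hom(V, 'End(V))) : Prop :=
  (forall x y, nabla x y - nabla y x = L x y) /\
  (forall x y z, h (nabla x y) z + h y (nabla x z) = 0).

Definition curvature (nabla : 'Hom(V, 'End(V))) (x y : V) : 'End(V) :=
  ((nabla x \o nabla y) - (nabla y \o nabla x) - nabla (L x y))%VF.

Definition ricci (nabla : 'Hom(V, 'End(V))) (x y : V) : R :=
  trace (linfun (fun z => curvature nabla z x y)).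

Definition ricci_operator (h : V -> V -> R) (Ric : 'End(V)) : Prop :=
  exists2 nabla, levi_civita h nabla &
    forall x y, h (Ric x) y = ricci nabla x y.

(* To be used for an inner product h, for which the Levi-Civita connection and
   the Ricci operator exist and are unique. *)
Definition nilsoliton (h : V -> V -> R) : Prop :=
  exists Ric : 'End(V), ricci_operator h Ric /\
    exists (mu : R) (D : 'End(V)), lie_derivation L D /\ Ric = mu *: \1%VF + D.

Definition admits_coupled_nilsoliton : Prop :=
  exists nu omega sigma, [/\ SU3_structure nu omega sigma,
    coupled omega sigma & nilsoliton (assoc_metric nu omega sigma)].

End SU3.

Section Examples.
Variable R : realType.
Implicit Types x y z : 'rV[R]_6.

(* e^i and e^{ij} = e^i /\ e^j on R^6, for indices 1 <= i, j <= 6. *)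
Definition cov (i : nat) x : R := x ord0 (inord i.-1).
Definition cov2 (i j : nat) x y : R := cov i x * cov j y - cov i y * cov j x.

(* Bracket of (alpha_1, ..., alpha_6): since (d e^j)(x, y) = - e^j([x, y]),
   the j-th coordinate of [x, y] is - alpha_j(x, y). *)
Definition br_of (alpha : 6.-tuple ('rV[R]_6 -> 'rV[R]_6 -> R)) x y : 'rV[R]_6 :=
  \row_j - tnth alpha j x y.

Definition br_n9 := br_of
  [tuple (fun _ _ => 0); (fun _ _ => 0); (fun _ _ => 0);
         (fun x y => cov2 1 2 x y);
         (fun x y => cov2 1 4 x y - cov2 2 3 x y);
         (fun x y => cov2 1 5 x y + cov2 3 4 x y)].

Definition br_n28 := br_of
  [tuple (fun _ _ => 0); (fun _ _ => 0); (fun _ _ => 0); (fun _ _ => 0);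
         (fun x y => cov2 1 3 x y - cov2 2 4 x y);
         (fun x y => cov2 1 4 x y + cov2 2 3 x y)].

Lemma cov_br alpha (i : nat) x y :
  cov i (br_of alpha x y) = - tnth alpha (inord i.-1) x y.
Proof. by rewrite /cov mxE. Qed.

Lemma covP x y : (forall i : 'I_6, cov i.+1 x = cov i.+1 y) -> x = y.
Proof. by move=> h; apply/rowP => i; have := h i; rewrite /cov /= inord_val. Qed.

Lemma covD i x y : cov i (x + y) = cov i x + cov i y.
Proof. by rewrite /cov mxE. Qed.

Lemma covZ i c x : cov i (c *: x) = c * cov i x.
Proof. by rewrite /cov mxE. Qed.

Lemma cov0 i : cov i 0 = 0.
Proof. by rewrite /cov mxE. Qed.

Let covE := (covD, covZ, cov0, cov_br).

Ltac solve_br := apply: covP; case; do 6?[case]; move=> //= ?;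
  do 3!rewrite /br_n9 /br_n28 /cov2 ?covE ?(tnth_nth (fun _ _ => 0)) ?inordK //=;
  ring.

Lemma br_n9_linearl : forall y, linear (br_n9^~ y).
Proof. move=> y c u v /=; solve_br. Qed.
Lemma br_n9_linearr : forall x, linear (br_n9 x).
Proof. move=> y c u v /=; solve_br. Qed.
Lemma br_n9_alternating : forall x, br_n9 x x = 0.
Proof. move=> x; solve_br. Qed.
Lemma br_n9_jacobi : forall x y z,
  br_n9 x (br_n9 y z) + br_n9 y (br_n9 z x) + br_n9 z (br_n9 x y) = 0.
Proof. move=> x y z; solve_br. Qed.

Definition n9 : lie_algebra 'rV[R]_6 :=
  LieAlgebra br_n9_linearl br_n9_linearr br_n9_alternating br_n9_jacobi.

Lemma br_n28_linearl : forall y, linear (br_n28^~ y).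
Proof. move=> y c u v /=; solve_br. Qed.
Lemma br_n28_linearr : forall x, linear (br_n28 x).
Proof. move=> y c u v /=; solve_br. Qed.
Lemma br_n28_alternating : forall x, br_n28 x x = 0.
Proof. move=> x; solve_br. Qed.
Lemma br_n28_jacobi : forall x y z,
  br_n28 x (br_n28 y z) + br_n28 y (br_n28 z x) + br_n28 z (br_n28 x y) = 0.
Proof. move=> x y z; solve_br. Qed.

Definition n28 : lie_algebra 'rV[R]_6 :=
  LieAlgebra br_n28_linearl br_n28_linearr br_n28_alternating br_n28_jacobi.

End Examples.

(* Main.v *)
From Pilot Require Import Defs.
From HB Require Import structures.
From mathcomp Require Import all_boot all_order perm all_algebra.
From mathcomp Require Import all_classical all_reals all_analysis.
From mathcomp Require Import zify ring lra.
(* MathComp-Analysis also defines a [contract]. *)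
Import Pilot.Defs.

Set Implicit Arguments.
Unset Strict Implicit.
Unset Printing Implicit Defensive.

Import Order.TTheory GRing.Theory Num.Theory.
Import numFieldNormedType.Exports.

(** If d omega = c sigma and z is central, then
    omega([x, y], z) = - c sigma(z, x, y). As sigma(z, ., .) has kernel
    <z, Jz>, every element which is central modulo z lies in <z, Jz>; hence
    [Jz, .] takes its values in <z>. Choosing further a unit vector u orthogonal
    to z and Jz and central modulo <z, Jz>, and completing to a unitary frame
    (z, u, v), the equations d omega = c sigma and the Jacobi identity leave
    only two free parameters s and t (see [coupled_brackets]): the algebra is
    n28 if s = t = 0 and n9 otherwise. For the metric, Ric z has components
    - k t / 2 and - k s / 2 along u and Jv (k <> 0), whereas a derivation maps
    the center into <z, Jz>; so a nilsoliton metric forces s = t = 0.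

    The linear algebra of a 3-form sigma with lambda(sigma) < 0 (Hitchin) rests
    on two polynomial identities in its 20 coefficients: K^2 is scalar, and
    sigma(Kx, y, z) = sigma(x, Ky, z). They provide a complex frame, hence a
    normal form, hence also the openness of the orbit. *)

(** * Wedge products as sums over permutations *)

(** The compatibility [omega /\ sigma = 0] says that omega is of type (1,1) for J. This makes h
    symmetric and J-invariant, so that unitary frames are available. In such a frame, omega(y, e_i)
    is a coordinate of y up to sign, and d omega = c sigma becomes a list of linear equations on the
    structure constants. After these, one Jacobi identity reads a^2 + b^2 = 0 for two constants;
    both vanish because the field is real, and this is the step that brings the parameters down to s
    and t. The constant k is c times sigma(z, u, v), where the phase of v is chosen so that
    sigma(Jz, u, v) = 0.

    For the Ricci tensor only central arguments matter. If z is central, torsion-freeness and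
    metricity already determine the derivatives along z, which gives Ric(z, y) = 1/4 sum
    h([e_i, e_j], y) h([e_i, e_j], z).

    The obstacle on the side of the example is stability, a topological statement: an invariant
    polynomial condition, continuous for pointwise convergence, must cut out exactly one orbit. For
    n28 itself, which is the complex Heisenberg algebra viewed over the reals, the remaining axioms
    are finite computations on a basis. *)

Section PermutationSums.
Local Open Scope ring_scope.
Variable R : pzRingType.

(** A permutation is determined by its value at 0 and by what it induces on the remaining indices.
    Injectivity suffices, since both sides have (n+1)! elements. *)
Lemma lift_perm_pair_bij n :
  bijective (fun p : 'I_n.+1 * 'S_n => lift_perm ord0 p.1 p.2).
Proof.
apply: inj_card_bij => [[i s] [j t] /= e|]; last first.
  by rewrite card_prod card_ord !card_Sn factS.
have eij : i = j by rewrite -(lift_perm_id ord0 i s) e lift_perm_id.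
rewrite {}eij in e *; congr pair; apply/permP => k.
by apply: (@lift_inj _ j); rewrite -!(lift_perm_lift ord0) e.
Qed.

(** Laplace expansion along the first index. Iterated, it turns the sum over permutations in [wedge]
    into a sum over the choices of the arguments of the first factor. *)
Lemma sum_perm_lift n (F : 'S_n.+1 -> R) :
  \sum_(s : 'S_n.+1) (-1) ^+ s * F s =
  \sum_(i < n.+1) (-1) ^+ i * \sum_(t : 'S_n) (-1) ^+ t * F (lift_perm ord0 i t).
Proof.
rewrite (reindex _ (onW_bij _ (lift_perm_pair_bij n))) /=.
rewrite -(pair_bigA _ (fun i t => (-1) ^+ lift_perm ord0 i t * F (lift_perm ord0 i t))) /=.
apply: eq_bigr => i _; rewrite big_distrr /=; apply: eq_bigr => t _.
by rewrite odd_lift_perm /= signr_addb signr_odd mulrA.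
Qed.

End PermutationSums.

Section MultilinearForms.
Local Open Scope ring_scope.
Variables (R : realType) (V : vectType R).

Lemma tnth_subst k (v : k.-tuple V) i x j :
  tnth (subst_tuple v i x) j = if j == i then x else tnth v j.
Proof. by rewrite tnth_mktuple. Qed.

Lemma subst_tuple_id k (v : k.-tuple V) i : subst_tuple v i (tnth v i) = v.
Proof. by apply: eq_from_tnth => j; rewrite tnth_subst; case: eqP => // ->. Qed.

(** Polarization: expand the form with the sum of the two arguments in both slots. *)
Lemma form_swap k (a : cochain V k) (v : k.-tuple V) (i j : 'I_k) :
  is_form a -> i != j -> a [tuple tnth v (tperm i j l) | l < k] = - a v.
Proof.
move=> [lin alt] nij.
pose s x y := subst_tuple (subst_tuple v i x) j y.
have sC x y : s x y = subst_tuple (subst_tuple v j y) i x.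
  apply: eq_from_tnth => l; rewrite !tnth_subst.
  by case: (eqVneq l j) => // ->; rewrite eq_sym (negbTE nij).
have alt0 x : a (s x x) = 0.
  by apply: (alt _ i j nij); rewrite !tnth_subst eqxx (negbTE nij) eqxx.
have lin1 x y z : a (s (x + y) z) = a (s x z) + a (s y z).
  by rewrite !sC -[x]scale1r lin mul1r !scale1r.
have lin2 x y z : a (s z (x + y)) = a (s z x) + a (s z y).
  by rewrite /s -[x]scale1r lin mul1r !scale1r.
have := alt0 (tnth v i + tnth v j); rewrite lin1 !lin2 !alt0 add0r addr0.
have -> : s (tnth v i) (tnth v j) = v.
  apply: eq_from_tnth => l; rewrite !tnth_subst.
  by case: eqP => [->|] //; case: eqP => [->|].
have -> : s (tnth v j) (tnth v i) = [tuple tnth v (tperm i j l) | l < k].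
  apply: eq_from_tnth => l; rewrite !tnth_subst tnth_mktuple.
  by case: tpermP => [->|->|/eqP/negbTE -> /eqP/negbTE ->]; rewrite ?eqxx // (negbTE nij).
by move=> e; apply/eqP; rewrite -addr_eq0 addrC e.
Qed.

Lemma form_perm k (a : cochain V k) (v : k.-tuple V) (s : 'S_k) :
  is_form a -> a [tuple tnth v (s l) | l < k] = (-1) ^+ s * a v.
Proof.
move=> fa; have [ts -> _] := prod_tpermP s.
elim: ts v => [|t ts IH] v.
  rewrite big_nil odd_perm1 mul1r; congr a.
  by apply: eq_from_tnth => l; rewrite tnth_mktuple perm1.
rewrite big_cons; case: (eqVneq t.1 t.2) => [->|nt].
  by rewrite tperm1 mul1g IH.
rewrite odd_permM odd_tperm nt signr_addb expr1 -mulrA -IH mulN1r -(form_swap _ fa nt).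
congr a; apply: eq_from_tnth => l; rewrite !tnth_mktuple.
by rewrite permM.
Qed.

Lemma form_altsum k (a : cochain V k) (v : k.-tuple V) : is_form a ->
  \sum_(s : 'S_k) (-1) ^+ s * a [tuple tnth v (s l) | l < k] = (k`!)%:R * a v.
Proof.
move=> fa; rewrite (eq_bigr (fun=> a v)) => [|s _]; last first.
  by rewrite form_perm // mulrA -expr2 sqrr_sign mul1r.
by rewrite sumr_const card_Sn mulr_natl.
Qed.

Lemma tuple_mk1 (f : 'I_1 -> V) : [tuple f i | i < 1] = [tuple f ord0].
Proof. by apply: eq_from_tnth => i; rewrite ord1 tnth_mktuple. Qed.

(** Two Laplace expansions choose the arguments of [a]; the inner sum over the permutations of the
    other l arguments equals l! times one value of [b] and cancels the normalizing factor. *)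
Lemma wedge2E l (a : cochain V 2) (b : cochain V l) (v : (2 + l).-tuple V) :
  is_form b -> wedge a b v = 2^-1 *
   \sum_(i < l.+2) \sum_(j < l.+1) (-1) ^+ (i + j) *
     (a [tuple tnth v i; tnth v (lift i j)] *
      b [tuple tnth v (lift i (lift j m)) | m < l]).
Proof.
move=> fb; rewrite /wedge natrM invfM -mulrA.
congr (_ * _).
rewrite (@sum_perm_lift _ l.+1) big_distrr /=; apply: eq_bigr => i _.
rewrite (@sum_perm_lift _ l) mulrCA big_distrr [LHS]big_distrr /=; apply: eq_bigr => j _.
rewrite exprD -mulrA; congr (_ * _); rewrite mulrCA; congr (_ * _).
set w : l.-tuple V := [tuple tnth v (lift i (lift j m)) | m < l].
rewrite -[b w](mulKf (_ : (l`!)%:R != 0)) ?pnatr_eq0 -?lt0n ?fact_gt0 //.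
rewrite -form_altsum // mulrCA; congr (_ * _); rewrite big_distrr /=.
apply: eq_bigr => t _; rewrite mulrCA; congr (_ * (_ * _)).
  congr a; apply: eq_from_tnth; case; case=> [|[|//]] hm; rewrite tnth_mktuple.
    rewrite (_ : @lshift 2 l _ = @ord0 l.+1); last exact: val_inj.
    by rewrite lift_perm_id.
  rewrite (_ : @lshift 2 l _ = @lift l.+2 ord0 (@ord0 l)); last exact: val_inj.
  by rewrite lift_perm_lift lift_perm_id.
congr b; apply: eq_from_tnth => m; rewrite !tnth_mktuple.
rewrite (_ : @rshift 2 l _ = @lift l.+2 ord0 (lift ord0 m)); last exact: val_inj.
by rewrite !lift_perm_lift.
Qed.

Lemma wedge3E l (a : cochain V 3) (b : cochain V l) (v : (3 + l).-tuple V) :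
  is_form b -> wedge a b v = 6^-1 *
   \sum_(i < l.+3) \sum_(j < l.+2) \sum_(k < l.+1) (-1) ^+ (i + j + k) *
     (a [tuple tnth v i; tnth v (lift i j); tnth v (lift i (lift j k))] *
      b [tuple tnth v (lift i (lift j (lift k m))) | m < l]).
Proof.
move=> fb; rewrite /wedge natrM invfM -mulrA.
congr (_ * _).
rewrite (@sum_perm_lift _ l.+2) big_distrr /=; apply: eq_bigr => i _.
pose G j k := a [tuple tnth v i; tnth v (lift i j); tnth v (lift i (lift j k))] *
  b [tuple tnth v (lift i (lift j (lift k m))) | m < l].
transitivity ((-1) ^+ i * \sum_(j < l.+2) (-1) ^+ j *
    \sum_(k < l.+1) (-1) ^+ k * G j k); last first.
  rewrite big_distrr; apply: eq_bigr => j _; rewrite !big_distrr /=.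
  by apply: eq_bigr => k _; rewrite !exprD -!mulrA.
rewrite mulrCA; congr (_ * _).
rewrite (@sum_perm_lift _ l.+1) big_distrr /=; apply: eq_bigr => j _.
rewrite mulrCA; congr (_ * _).
rewrite (@sum_perm_lift _ l) big_distrr /=; apply: eq_bigr => k _.
rewrite mulrCA; congr (_ * _); rewrite {}/G.
set w : l.-tuple V := [tuple tnth v (lift i (lift j (lift k m))) | m < l].
rewrite -[b w](mulKf (_ : (l`!)%:R != 0)) ?pnatr_eq0 -?lt0n ?fact_gt0 //.
rewrite -form_altsum // mulrCA; congr (_ * _); rewrite big_distrr /=.
apply: eq_bigr => t _; rewrite mulrCA; congr (_ * (_ * _)).
  congr a; apply: eq_from_tnth; case; case=> [|[|[|//]]] hm; rewrite tnth_mktuple.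
  - rewrite (_ : @lshift 3 l _ = @ord0 l.+2); last exact: val_inj.
    by rewrite lift_perm_id.
  - rewrite (_ : @lshift 3 l _ = @lift l.+3 ord0 (@ord0 l.+1)); last exact: val_inj.
    by rewrite lift_perm_lift lift_perm_id.
  - rewrite (_ : @lshift 3 l _ = @lift l.+3 ord0 (lift ord0 (@ord0 l))); last exact: val_inj.
    by rewrite !lift_perm_lift lift_perm_id.
congr b; apply: eq_from_tnth => m; rewrite !tnth_mktuple.
rewrite (_ : @rshift 3 l _ = @lift l.+3 ord0 (lift ord0 (lift ord0 m))); last exact: val_inj.
by rewrite !lift_perm_lift.
Qed.

Lemma wedge_form k l (a : cochain V k) (b : cochain V l) :
  is_form a -> is_form b -> is_form (wedge a b).
Proof.
move=> fa fb; split=> [v i c x y|v i j nij eij]; rewrite /wedge; last first.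
  (* Composing s with the transposition of i and j keeps the arguments and reverses the sign, so the
     sum is its own opposite. *)
  set S := \sum_s _; suff /eqP : S = - S.
    by rewrite -addr_eq0 -mulr2n mulrn_eq0 /= => /eqP ->; rewrite mulr0.
  rewrite {1}/S (reindex_inj (mulIg (tperm i j))) /= -sumrN.
  apply: eq_bigr => s _; rewrite odd_permM odd_tperm nij signr_addb expr1 mulrN1 mulNr.
  have e x : tnth v ((s * tperm i j)%g x) = tnth v (s x).
    by rewrite permM; case: tpermP => [->|->|].
  by congr (- (_ * (a _ * b _))); apply: eq_from_tnth => m; rewrite !tnth_mktuple e.
rewrite mulrCA -mulrDr; congr (_ * _); rewrite big_distrr -big_split /=.
apply: eq_bigr => s _.
rewrite [X in _ = X + _]mulrCA -mulrDr; congr (_ * _).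
have [fa1 _] := fa; have [fb1 _] := fb.
(* Argument number i goes to [a] or to [b], according to the position that s sends to i. *)
case: (splitP (s^-1%g i)) => m em.
- have si : s (lshift l m) = i.
    by rewrite (_ : lshift l m = s^-1%g i) ?permKV //; apply: val_inj.
  have ea z : [tuple tnth (subst_tuple v i z) (s (lshift l m')) | m' < k] =
      subst_tuple [tuple tnth v (s (lshift l m')) | m' < k] m z.
    apply: eq_from_tnth => m'; rewrite tnth_mktuple !tnth_subst tnth_mktuple -si.
    by rewrite (inj_eq perm_inj) (inj_eq (@lshift_inj _ _)).
  have eb z : [tuple tnth (subst_tuple v i z) (s (rshift k m')) | m' < l] =
      [tuple tnth v (s (rshift k m')) | m' < l].
    apply: eq_from_tnth => m'; rewrite !tnth_mktuple -si.
    by rewrite (inj_eq perm_inj) eq_rlshift.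
  by rewrite !ea !eb fa1 mulrDl mulrA.
- have si : s (rshift k m) = i.
    by rewrite (_ : rshift k m = s^-1%g i) ?permKV //; apply: val_inj.
  have ea z : [tuple tnth (subst_tuple v i z) (s (rshift k m')) | m' < l] =
      subst_tuple [tuple tnth v (s (rshift k m')) | m' < l] m z.
    apply: eq_from_tnth => m'; rewrite tnth_mktuple !tnth_subst tnth_mktuple -si.
    by rewrite (inj_eq perm_inj) (inj_eq (@rshift_inj _ _)).
  have eb z : [tuple tnth (subst_tuple v i z) (s (lshift l m')) | m' < k] =
      [tuple tnth v (s (lshift l m')) | m' < k].
    apply: eq_from_tnth => m'; rewrite !tnth_mktuple -si.
    by rewrite (inj_eq perm_inj) eq_lrshift.
  by rewrite !ea !eb fb1 mulrDr mulrCA.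
Qed.

End MultilinearForms.

(** * Forms on a basis *)

Section FormsOnBases.
Local Open Scope ring_scope.
Variables (R : realType) (V : vectType R).

(** Cochains are plain functions, so linearity in one argument enters as an equation rather than as
    a bundled linear map. *)
Lemma scalar_sum (f : V -> R) (I : finType) (c : I -> R) (w : I -> V) :
  (forall c x y, f (c *: x + y) = c * f x + f y) ->
  f (\sum_i c i *: w i) = \sum_i c i * f (w i).
Proof.
move=> lf; have f0 : f 0 = 0.
  have /eqP := lf 1 0 0; rewrite scale1r addr0 mul1r -subr_eq0.
  by rewrite opprD addrA subrr sub0r oppr_eq0 => /eqP.
elim/big_rec2: _ => // i y1 y2 _ <-; exact: lf.
Qed.

Section Basis.
Variables (n : nat) (e : n.-tuple V).
Hypothesis be : basis_of {:V} e.

Lemma coordE x : x = \sum_i coord e i x *: e`_i.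
Proof. by apply: coord_basis be _; rewrite memvf. Qed.

Lemma coord_e (i j : 'I_n) : coord e i e`_j = (i == j)%:R.
Proof. by rewrite coord_free ?(basis_free be) // eq_sym. Qed.

Definition etuple k (f : 'I_k -> 'I_n) := [tuple e`_(f i) | i < k].

(** Induction on the number m of slots that may still hold arbitrary vectors: the last of these is
    expanded in the basis. *)
Lemma form_ext k (a b : cochain V k) : is_form a -> is_form b ->
  (forall f : 'I_k -> 'I_n, a (etuple f) = b (etuple f)) -> a =1 b.
Proof.
move=> [fa _] [fb _] eab v.
suff H m (w : k.-tuple V) :
    (forall i : 'I_k, (m <= i)%N -> exists j, tnth w i = e`_(nat_of_ord (j : 'I_n))) ->
    a w = b w.
  by apply: (H k) => i; rewrite leqNgt ltn_ord.
elim: m w => [|m IH] w hw.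
  pose f i := projT1 (cid (hw i isT)).
  have -> : w = etuple f.
    apply: eq_from_tnth => i; rewrite tnth_mktuple.
    by rewrite /f; case: cid.
  exact: eab.
case: (ltnP m k) => hm; last first.
  by apply: IH => i him; have := leq_ltn_trans (leq_trans hm him) (ltn_ord i); rewrite ltnn.
pose i := Ordinal hm.
rewrite -(subst_tuple_id w i) (coordE (tnth w i)).
rewrite (scalar_sum _ _ (fun c x y => fa w i c x y)).
rewrite (scalar_sum _ _ (fun c x y => fb w i c x y)).
apply: eq_bigr => j _; congr (_ * _); apply: IH => l hl; rewrite tnth_subst.
case: eqP => [_|/eqP nl]; first by exists j.
apply: hw; rewrite ltn_neqAle hl andbT; apply: contra nl => /eqP el.
by apply/eqP; apply: val_inj.
Qed.

Lemma etuple_perm k (a : cochain V k) (f : 'I_k -> 'I_n) (s : 'S_k) :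
  is_form a -> a (etuple (f \o s)) = (-1) ^+ s * a (etuple f).
Proof.
move=> fa; rewrite -(form_perm _ s fa); congr a.
by apply: eq_from_tnth => i; rewrite !tnth_mktuple.
Qed.

Lemma etuple_noninj k (a : cochain V k) (f : 'I_k -> 'I_n) :
  is_form a -> ~~ injectiveb f -> a (etuple f) = 0.
Proof.
move=> [_ alt] /injectivePn[i [j nij fij]].
by apply: (alt _ i j nij); rewrite !tnth_mktuple fij.
Qed.

(** A non-injective choice of indices gives 0 on both sides; an injective one becomes increasing by
    sorting, with the same sign on both sides. *)
Lemma form_ext_incr k (a b : cochain V k) : is_form a -> is_form b ->
  (forall f : 'I_k -> 'I_n, (forall i j : 'I_k, (i < j)%N -> (f i < f j)%N) ->
     a (etuple f) = b (etuple f)) -> a =1 b.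
Proof.
move=> fa fb eab; apply: form_ext => // f.
case: (boolP (injectiveb f)) => [/injectiveP injf|nf]; last first.
  by rewrite !etuple_noninj.
pose r (x y : 'I_n) := (x <= y)%N.
have /tuple_permP[p ep] : perm_eq (sort r [tuple f i | i < k]) [tuple f i | i < k].
  by rewrite perm_sort.
have ef i : f (p i) = tnth [tuple tnth [tuple f i | i < k] (p i) | i < k] i.
  by rewrite !tnth_mktuple.
have so : sorted (fun x y : 'I_n => (x < y)%N) [tuple tnth [tuple f i | i < k] (p i) | i < k].
  rewrite (eq_sorted (e' := fun x y => (x != y) && r x y)); last first.
    by move=> x y; rewrite ltn_neqAle.
  rewrite sorted_pairwise; last first.
    move=> x y z /andP[n1 h1] /andP[n2 h2]; rewrite /r (leq_trans h1 h2) andbT.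
    apply: contra n1 => /eqP xz; rewrite -xz in h2.
    by rewrite -val_eqE eqn_leq /=; apply/andP.
  rewrite -ep pairwise_relI -uniq_pairwise sort_uniq -sorted_pairwise; last first.
    by move=> x y z; exact: leq_trans.
  rewrite sort_sorted ?andbT; last by move=> x y; exact: leq_total.
  by rewrite map_inj_uniq // enum_uniq.
have incr (i j : 'I_k) : (i < j)%N -> (f (p i) < f (p j))%N.
  move=> ij; rewrite !ef !(tnth_nth (f i)).
  apply: (sorted_ltn_nth _ _ so); rewrite ?inE ?size_tuple //.
  by move=> x y z; exact: ltn_trans.
have := eab (f \o p) incr; rewrite !etuple_perm //.
by move=> /(mulrI (unitrX _ (unitrN1 _))).
Qed.
End Basis.

Lemma form_ext_top k (e : k.-tuple V) (a b : cochain V k) :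
  basis_of {:V} e -> is_form a -> is_form b -> a e = b e -> a =1 b.
Proof.
move=> be fa fb eab; apply: (form_ext be) => // f.
case: (boolP (injectiveb f)) => [/injectiveP injf|nf]; last by rewrite !etuple_noninj.
have -> : etuple e f = etuple e (id \o perm injf).
  by apply: eq_from_tnth => i; rewrite !tnth_mktuple /= permE.
rewrite !etuple_perm // (_ : etuple e id = e) ?eab //.
by apply: eq_from_tnth => i; rewrite tnth_mktuple (tnth_nth 0).
Qed.

(** An injective choice of k among k+1 indices omits exactly one index i, hence is [lift i] up to a
    permutation. It serves for the 5-forms in dimension six. *)
Lemma form_ext_succ k (e : k.+1.-tuple V) (a b : cochain V k) :
  basis_of {:V} e -> is_form a -> is_form b ->
  (forall i, a (etuple e (lift i)) = b (etuple e (lift i))) -> a =1 b.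
Proof.
move=> be fa fb eab; apply: (form_ext be) => // f.
case: (boolP (injectiveb f)) => [/injectiveP injf|nf]; last by rewrite !etuple_noninj.
have [i hi] : exists i, i \notin codom f.
  apply/existsP; rewrite -negb_forall; apply/negP => /forallP h.
  have : (#|'I_k.+1| <= #|codom f|)%N by apply: subset_leq_card; apply/fintype.subsetP => x _; exact: h.
  by rewrite card_codom // !card_ord ltnn.
have fl j : {l | f j = lift i l}.
  have nij : i != f j by apply: contra hi => /eqP ->; apply: codom_f.
  by case: (unlift_some nij) => l el _; exists l.
pose g j := projT1 (fl j).
have gE j : f j = lift i (g j) by rewrite /g; case: (fl j).
have injg : injective g by move=> x y gxy; apply: injf; rewrite !gE gxy.
have -> : etuple e f = etuple e (lift i \o perm injg).
  by apply: eq_from_tnth => j; rewrite !tnth_mktuple /= permE gE.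
by rewrite !etuple_perm // eab.
Qed.

Lemma contract_form k (w : V) (a : cochain V k.+1) : is_form a -> is_form (contract w a).
Proof.
move=> [lin alt]; split=> [v i c x y|v i j nij eij].
  have es z : [tuple of w :: subst_tuple v i z] = subst_tuple [tuple of w :: v] (lift ord0 i) z.
    apply: eq_from_tnth => j; rewrite tnth_subst.
    case: (unliftP ord0 j) => [l|] -> //.
    by rewrite (inj_eq lift_inj) !tnthS tnth_subst.
  by rewrite /contract !es lin.
apply: (alt _ (lift ord0 i) (lift ord0 j)); rewrite ?(inj_eq lift_inj) //.
by rewrite !tnthS.
Qed.

Lemma contract_lin k (a : cochain V k.+1) c x y v :
  is_form a -> contract (c *: x + y) a v = c * contract x a v + contract y a v.
Proof.
move=> [lin _].
have es z : [tuple of z :: v] = subst_tuple [tuple of 0 :: v] ord0 z.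
  apply: eq_from_tnth => j; rewrite tnth_subst.
  by case: (unliftP ord0 j) => [l|] -> //; rewrite !tnthS.
by rewrite /contract (es (_ + _)) (es x) (es y) lin.
Qed.

Lemma pullback_form k (g : 'End(V)) (a : cochain V k) : is_form a -> is_form (pullback g a).
Proof.
move=> [lin alt]; split=> [v i c x y|v i j nij eij]; last first.
  by apply: (alt _ i j nij); rewrite !tnth_map eij.
have es z : [tuple of map g (subst_tuple v i z)] = subst_tuple [tuple of map g v] i (g z).
  by apply: eq_from_tnth => j; rewrite [RHS]tnth_subst [LHS]tnth_map tnth_subst tnth_map; case: eqP.
by rewrite /pullback !es linearP lin.
Qed.

Lemma zero_form k : is_form (fun _ : k.-tuple V => 0 : R).
Proof. by split=> // *; rewrite mulr0 addr0. Qed.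

(** [trace] is defined through the chosen basis [vbasis]; independence of the basis allows
    computation in an adapted one. *)
Lemma trace_basis n (e : n.-tuple V) (f : 'End(V)) :
  basis_of {:V} e -> trace f = \sum_i coord e i (f e`_i).
Proof.
move=> be; set b := vbasis {:V}; have bb : basis_of {:V} b by exact: vbasisP.
have -> : trace f = \sum_i coord b i (f b`_i).
  rewrite /trace /mxtrace; apply: eq_bigr => i _; rewrite /passmx.mxof mxE /=.
  by rewrite passmx.vecof_delta mxE.
have E i : coord b i (f b`_i) =
    \sum_j coord e j b`_i * coord b i (f e`_j).
  rewrite {1}(coordE be b`_i) !linear_sum; apply: eq_bigr => j _.
  by rewrite !linearZ.
rewrite (eq_bigr _ (fun i _ => E i)) exchange_big /=; apply: eq_bigr => j _.
rewrite [in RHS](coordE bb (f e`_j)) linear_sum; apply: eq_bigr => i _.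
by rewrite linearZ mulrC.
Qed.

End FormsOnBases.

(** Expanding a sum over ordinals produces nested [lift]s; replacing them by numerals lets the
    tables of coefficients compute. *)
Ltac ord_norm := repeat match goal with |- context [nat_of_ord ?x] =>
  let n := eval vm_compute in (nat_of_ord x) in
  progress change (nat_of_ord x) with n end.

(** * Forms of degree two and three, and the matrix of K *)

Section LowDegree.
Local Open Scope ring_scope.
Variables (R : realType) (V : vectType R).

Section LinearLaw.
Variable f : V -> R.
Hypothesis lf : forall c x y, f (c *: x + y) = c * f x + f y.

Lemma law0 : f 0 = 0.
Proof. by have := lf (-1) 0 0; rewrite scaler0 addr0 mulN1r addNr. Qed.

Lemma lawD x y : f (x + y) = f x + f y.
Proof. by rewrite -{1}[x]scale1r lf mul1r. Qed.

Lemma lawZ c x : f (c *: x) = c * f x.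
Proof. by rewrite -[c *: x]addr0 lf law0 addr0. Qed.

Lemma lawN x : f (- x) = - f x.
Proof. by rewrite -scaleN1r lawZ mulN1r. Qed.

End LinearLaw.

Lemma form2_linl (a : cochain V 2) c x y z : is_form a ->
  a [tuple c *: x + y; z] = c * a [tuple x; z] + a [tuple y; z].
Proof.
case=> lin _; have es t : [tuple t; z] = subst_tuple [tuple z; z] ord0 t.
  by apply: eq_from_tnth => -[[|[|//]] h]; rewrite tnth_subst.
by rewrite (es (_ + _)) lin -!es.
Qed.

Lemma form2_linr (a : cochain V 2) c x y z : is_form a ->
  a [tuple z; c *: x + y] = c * a [tuple z; x] + a [tuple z; y].
Proof.
case=> lin _; have es t : [tuple z; t] = subst_tuple [tuple z; z] ord_max t.
  by apply: eq_from_tnth => -[[|[|//]] h]; rewrite tnth_subst.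
by rewrite (es (_ + _)) lin -!es.
Qed.

Lemma form2_alt (a : cochain V 2) x : is_form a -> a [tuple x; x] = 0.
Proof. by case=> _ alt; apply: (alt _ ord0 ord_max). Qed.

Lemma form2_anti (a : cochain V 2) x y : is_form a -> a [tuple y; x] = - a [tuple x; y].
Proof.
move=> fa; rewrite -(form_swap [tuple x; y] fa (isT : @ord0 1 != ord_max)).
by congr a; apply: eq_from_tnth => -[[|[|//]] h]; rewrite tnth_mktuple;
  case: tpermP => [/(congr1 val)|/(congr1 val)|/eqP + /eqP] //=.
Qed.

Lemma form3_lin1 (a : cochain V 3) c x y z t : is_form a ->
  a [tuple c *: x + y; z; t] = c * a [tuple x; z; t] + a [tuple y; z; t].
Proof.
case=> lin _; have es u : [tuple u; z; t] = subst_tuple [tuple z; z; t] ord0 u.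
  by apply: eq_from_tnth => -[[|[|[|//]]] h]; rewrite tnth_subst.
by rewrite (es (_ + _)) lin -!es.
Qed.

Lemma form3_anti12 (a : cochain V 3) x y z : is_form a ->
  a [tuple y; x; z] = - a [tuple x; y; z].
Proof.
move=> fa; rewrite -(form_swap [tuple x; y; z] fa (isT : @ord0 2 != lift ord0 ord0)).
by congr a; apply: eq_from_tnth => -[[|[|[|//]]] h]; rewrite tnth_mktuple;
  case: tpermP => [/(congr1 val)|/(congr1 val)|/eqP + /eqP] //=.
Qed.

Lemma form3_anti23 (a : cochain V 3) x y z : is_form a ->
  a [tuple x; z; y] = - a [tuple x; y; z].
Proof.
move=> fa; rewrite -(form_swap [tuple x; y; z] fa (isT : @lift 3 ord0 ord0 != ord_max)).
by congr a; apply: eq_from_tnth => -[[|[|[|//]]] h]; rewrite tnth_mktuple;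
  case: tpermP => [/(congr1 val)|/(congr1 val)|/eqP + /eqP] //=.
Qed.

Lemma form3_lin2 (a : cochain V 3) c x y z t : is_form a ->
  a [tuple z; c *: x + y; t] = c * a [tuple z; x; t] + a [tuple z; y; t].
Proof.
move=> fa; rewrite -[LHS]opprK -form3_anti12 // form3_lin1 // opprD -mulrN.
by rewrite -!form3_anti12.
Qed.

Lemma form3_lin3 (a : cochain V 3) c x y z t : is_form a ->
  a [tuple z; t; c *: x + y] = c * a [tuple z; t; x] + a [tuple z; t; y].
Proof.
move=> fa; rewrite -[LHS]opprK -form3_anti23 // form3_lin2 // opprD -mulrN.
by rewrite -!form3_anti23.
Qed.

Lemma form3_alt12 (a : cochain V 3) x y : is_form a -> a [tuple x; x; y] = 0.
Proof. by case=> _ alt; apply: (alt _ ord0 (lift ord0 ord0)). Qed.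

Lemma form3_alt23 (a : cochain V 3) x y : is_form a -> a [tuple y; x; x] = 0.
Proof. by case=> _ alt; apply: (alt _ ord_max (lift ord0 ord0)). Qed.

Lemma form3_alt13 (a : cochain V 3) x y : is_form a -> a [tuple x; y; x] = 0.
Proof. by case=> _ alt; apply: (alt _ ord0 ord_max). Qed.

Lemma form3_cyc (a : cochain V 3) x y z : is_form a ->
  a [tuple y; z; x] = a [tuple x; y; z].
Proof. by move=> fa; rewrite form3_anti23 // form3_anti12 // opprK. Qed.

Lemma form2_0l (a : cochain V 2) z : is_form a ->
  a [tuple 0; z] = 0.
Proof. by move=> fa; apply: (law0 (f := fun t => a [tuple t; z])) => *; exact: form2_linl. Qed.

Lemma form2_Zl (a : cochain V 2) c x z : is_form a ->
  a [tuple c *: x; z] = c * a [tuple x; z].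
Proof. by move=> fa; apply: (lawZ (f := fun t => a [tuple t; z])) => *; exact: form2_linl. Qed.

Lemma form2_Nl (a : cochain V 2) x z : is_form a ->
  a [tuple - x; z] = - a [tuple x; z].
Proof. by move=> fa; apply: (lawN (f := fun t => a [tuple t; z])) => *; exact: form2_linl. Qed.

Lemma form2_0r (a : cochain V 2) z : is_form a ->
  a [tuple z; 0] = 0.
Proof. by move=> fa; apply: (law0 (f := fun t => a [tuple z; t])) => *; exact: form2_linr. Qed.

Lemma form2_Dr (a : cochain V 2) x y z : is_form a ->
  a [tuple z; x + y] = a [tuple z; x] + a [tuple z; y].
Proof. by move=> fa; apply: (lawD (f := fun t => a [tuple z; t])) => *; exact: form2_linr. Qed.

Lemma form2_Zr (a : cochain V 2) c x z : is_form a ->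
  a [tuple z; c *: x] = c * a [tuple z; x].
Proof. by move=> fa; apply: (lawZ (f := fun t => a [tuple z; t])) => *; exact: form2_linr. Qed.

Lemma form2_Nr (a : cochain V 2) x z : is_form a ->
  a [tuple z; - x] = - a [tuple z; x].
Proof. by move=> fa; apply: (lawN (f := fun t => a [tuple z; t])) => *; exact: form2_linr. Qed.

Lemma form3_D1 (a : cochain V 3) x y z w : is_form a ->
  a [tuple x + y; z; w] = a [tuple x; z; w] + a [tuple y; z; w].
Proof. by move=> fa; apply: (lawD (f := fun t => a [tuple t; z; w])) => *; exact: form3_lin1. Qed.

Lemma form3_Z1 (a : cochain V 3) c x z w : is_form a ->
  a [tuple c *: x; z; w] = c * a [tuple x; z; w].
Proof. by move=> fa; apply: (lawZ (f := fun t => a [tuple t; z; w])) => *; exact: form3_lin1. Qed.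

Lemma form3_N1 (a : cochain V 3) x z w : is_form a ->
  a [tuple - x; z; w] = - a [tuple x; z; w].
Proof. by move=> fa; apply: (lawN (f := fun t => a [tuple t; z; w])) => *; exact: form3_lin1. Qed.

Lemma form3_D2 (a : cochain V 3) x y z w : is_form a ->
  a [tuple z; x + y; w] = a [tuple z; x; w] + a [tuple z; y; w].
Proof. by move=> fa; apply: (lawD (f := fun t => a [tuple z; t; w])) => *; exact: form3_lin2. Qed.

Lemma form3_Z2 (a : cochain V 3) c x z w : is_form a ->
  a [tuple z; c *: x; w] = c * a [tuple z; x; w].
Proof. by move=> fa; apply: (lawZ (f := fun t => a [tuple z; t; w])) => *; exact: form3_lin2. Qed.

Lemma form3_D3 (a : cochain V 3) x y z w : is_form a ->
  a [tuple z; w; x + y] = a [tuple z; w; x] + a [tuple z; w; y].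
Proof. by move=> fa; apply: (lawD (f := fun t => a [tuple z; w; t])) => *; exact: form3_lin3. Qed.

Lemma form3_Z3 (a : cochain V 3) c x z w : is_form a ->
  a [tuple z; w; c *: x] = c * a [tuple z; w; x].
Proof. by move=> fa; apply: (lawZ (f := fun t => a [tuple z; w; t])) => *; exact: form3_lin3. Qed.

Lemma wedge23E (a : cochain V 2) (b : cochain V 3) v0 v1 v2 v3 v4 :
  is_form a -> is_form b -> wedge a b [tuple v0; v1; v2; v3; v4] =
    a [tuple v0; v1] * b [tuple v2; v3; v4] - a [tuple v0; v2] * b [tuple v1; v3; v4]
  + a [tuple v0; v3] * b [tuple v1; v2; v4] - a [tuple v0; v4] * b [tuple v1; v2; v3]
  + a [tuple v1; v2] * b [tuple v0; v3; v4] - a [tuple v1; v3] * b [tuple v0; v2; v4]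
  + a [tuple v1; v4] * b [tuple v0; v2; v3] + a [tuple v2; v3] * b [tuple v0; v1; v4]
  - a [tuple v2; v4] * b [tuple v0; v1; v3] + a [tuple v3; v4] * b [tuple v0; v1; v2].
Proof.
move=> fa fb; rewrite wedge2E //.
pose v := nth 0 [:: v0; v1; v2; v3; v4].
pose f i j := a [tuple v i; v (bump i j)] *
  b [tuple v (bump i (bump j 0)); v (bump i (bump j 1)); v (bump i (bump j 2))].
transitivity (2^-1 * \sum_(i < 5) \sum_(j < 4) (-1) ^+ (i + j) * f i j).
  congr (_ * _); apply: eq_bigr => i _; apply: eq_bigr => j _; congr (_ * (a _ * b _)).
    by apply: eq_from_tnth => -[[|[|//]] h]; rewrite !(tnth_nth 0).
  by apply: eq_from_tnth => -[[|[|[|//]]] h]; rewrite tnth_mktuple !(tnth_nth 0).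
rewrite !big_ord_recl !big_ord0; ord_norm.
cbv [f v bump leq subn Nat.sub addn Nat.add nat_of_bool nth eqn eq_op Equality.sort].
rewrite /= !(form2_anti v0) // !(form2_anti v1) // !(form2_anti v2) // !(form2_anti v3) //.
by field.
Qed.

(* The 3-form with value [x i j k] on the basis vectors numbered
   [i < j < k]. *)
Definition alt_ext (x : nat -> nat -> nat -> R) (i j k : nat) : R :=
  if Nat.ltb i j && Nat.ltb j k then x i j k else
  if Nat.ltb i k && Nat.ltb k j then - x i k j else
  if Nat.ltb j i && Nat.ltb i k then - x j i k else
  if Nat.ltb j k && Nat.ltb k i then x j k i else
  if Nat.ltb k i && Nat.ltb i j then x k i j else
  if Nat.ltb k j && Nat.ltb j i then - x k j i else 0.

(** [alt_ext] uses [Nat.ltb], which [cbv] evaluates; proofs by cases use the order of [ssrnat]. *)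
Lemma ltbE m n : Nat.ltb m n = (m < n)%N.
Proof.
by apply/idP/idP => [/PeanoNat.Nat.ltb_lt/ssrnat.ltP|/ssrnat.ltP/PeanoNat.Nat.ltb_lt].
Qed.

Lemma form3_alt_ext (a : cochain V 3) (e : nat -> V) i j k : is_form a ->
  a [tuple e i; e j; e k] = alt_ext (fun i j k => a [tuple e i; e j; e k]) i j k.
Proof.
move=> fa; rewrite /alt_ext !ltbE.
case: (ltngtP i j) => ij; case: (ltngtP j k) => jk; case: (ltngtP i k) => ik /=;
  try lia; subst; rewrite ?form3_alt12 ?form3_alt13 ?form3_alt23 //.
- by rewrite form3_anti23.
- by rewrite form3_cyc // form3_cyc.
- by rewrite form3_anti12.
- by rewrite -form3_cyc.
- by rewrite form3_anti12 // form3_cyc.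
Qed.

Definition others (j : nat) : nat * nat * nat * nat * nat :=
  match j with
  | 0 => (1, 2, 3, 4, 5)%N | 1 => (0, 2, 3, 4, 5)%N | 2 => (0, 1, 3, 4, 5)%N
  | 3 => (0, 1, 2, 4, 5)%N | 4 => (0, 1, 2, 3, 5)%N | _ => (0, 1, 2, 3, 4)%N
  end.

(* Entry (i, j) of the matrix of [K_end], when the volume form takes the value
   1 on the basis. *)
Definition kap (x : nat -> nat -> nat -> R) (i j : nat) : R :=
  let: (p0, p1, p2, p3, p4) := others j in
  let a := alt_ext x i in let b := alt_ext x in
  (-1) ^+ (Nat.odd j) *
  (a p0 p1 * b p2 p3 p4 - a p0 p2 * b p1 p3 p4 + a p0 p3 * b p1 p2 p4
   - a p0 p4 * b p1 p2 p3 + a p1 p2 * b p0 p3 p4 - a p1 p3 * b p0 p2 p4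
   + a p1 p4 * b p0 p2 p3 + a p2 p3 * b p0 p1 p4 - a p2 p4 * b p0 p1 p3
   + a p3 p4 * b p0 p1 p2).

(** Hitchin's quartic invariant: the square of the matrix [kap] is scalar, so its entry (0, 0)
    carries all of it. *)
Definition kap_sq (x : nat -> nat -> nat -> R) : R :=
  \sum_(j < 6) kap x 0%N j * kap x j 0%N.

Ltac kap_solve := rewrite /kap_sq !big_ord_recl !big_ord0; ord_norm;
  cbv [kap others alt_ext Nat.ltb Nat.leb andb Nat.odd Nat.even negb];
  rewrite /= ?expr0 ?expr1.

(** The square of K is scalar. Each of the 36 entries is a polynomial identity in the 20
    coefficients of the 3-form. *)
Lemma kap_mul x (i l : 'I_6) :
  \sum_(j < 6) kap x i j * kap x j l = (i == l)%:R * kap_sq x.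
Proof.
case: i l => [i hi] [l hl].
do 6?[case: i hi => [|i] hi //]; do 6?[case: l hl => [|l] hl //].
all: kap_solve.
all: ring.
Qed.

(** In coordinates, sigma(K e_0, e_0, e_1) = 0. *)
Lemma kap_alt x : \sum_(l < 6) kap x 0%N l * alt_ext x l 0%N 1%N = 0.
Proof. by kap_solve; ring. Qed.

End LowDegree.

(** * The endomorphism K of a 3-form *)

Section HitchinMap.
Local Open Scope ring_scope.
Variables (R : realType) (V : vectType R).

(** On the basis vectors other than e_j, the contraction sees only the component of w along e_j; the
    sign is that of the cycle moving e_j to the front. This makes [A_iso] computable. *)
Lemma contract_coord k (e : k.+1.-tuple V) (nu : cochain V k.+1) w (j : 'I_k.+1) :
  basis_of {:V} e -> is_form nu ->
  contract w nu (etuple e (lift j)) = (-1) ^+ j * coord e j w * nu e.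
Proof.
move=> be fn; rewrite {1}(coordE be w).
rewrite (scalar_sum (f := fun z => contract z nu (etuple e (lift j)))) => [|c x y]; last first.
  by rewrite contract_lin.
rewrite (bigD1 j) //= big1 ?addr0 => [|l nlj]; last first.
  rewrite eq_sym in nlj; have [m em _] := unlift_some nlj.
  rewrite /contract; have [_ alt] := fn; rewrite (alt _ ord0 (lift ord0 m)) ?mulr0 //.
  by rewrite tnthS tnth_mktuple -em.
rewrite mulrAC mulrC; congr (_ * _); rewrite /contract.
have -> : [tuple of e`_j :: etuple e (lift j)] = etuple e (id \o lift_perm ord0 j 1).
  apply: eq_from_tnth => l; rewrite tnth_mktuple /=.
  case: (unliftP ord0 l) => [m|] ->; last by rewrite lift_perm_id.
  by rewrite tnthS tnth_mktuple lift_perm_lift perm1.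
rewrite etuple_perm // odd_lift_perm odd_perm1 addbF /= signr_odd; congr (_ * nu _).
by apply: eq_from_tnth => i; rewrite tnth_mktuple (tnth_nth 0).
Qed.

Lemma form_top_neq0 k (e : k.-tuple V) (nu : cochain V k) v :
  basis_of {:V} e -> is_form nu -> nu v != 0 -> nu e != 0.
Proof.
move=> be fn; apply: contra => /eqP ne0.
by rewrite (form_ext_top be fn (@zero_form R V k) ne0).
Qed.

Lemma linfunE (W : vectType R) (f : V -> W) : linear f -> linfun f =1 f.
Proof.
move=> lf; pose g : {linear V -> W} := HB.pack f (GRing.isLinear.Build _ _ _ _ _ lf).
exact: (lfunE g).
Qed.

Section WithVolume.
Variables (e : 6.-tuple V) (nu : cochain V 6).
Hypotheses (be : basis_of {:V} e) (fn : is_form nu) (nu0 : nu e != 0).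

Lemma contract_inj w w' : contract w nu = contract w' nu -> w = w'.
Proof.
move=> eww; rewrite (coordE be w) (coordE be w'); apply: eq_bigr => j _.
have := contract_coord w j be fn; rewrite eww contract_coord // => /(mulIf nu0).
by move=> /(mulrI (unitrX _ (unitrN1 _))) ->.
Qed.

(** [A_iso] is defined by choice, so a solution must be exhibited; [contract_coord] dictates its
    coordinates. *)
Lemma A_isoP (g : cochain V 5) : is_form g -> contract (A_iso nu g) nu = g.
Proof.
move=> fg.
suff h : exists w, contract w nu = g by rewrite /A_iso; have := @xgetPex _ 0 _ h.
exists (\sum_(j < 6) ((-1) ^+ j * g (etuple e (lift j)) / nu e) *: e`_j).
apply: funext; apply: (form_ext_succ be (contract_form _ fn) fg) => i.
rewrite contract_coord // linear_sum (bigD1 i) //= big1 ?addr0 => [|j nji]; last first.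
  by rewrite linearZ /= coord_e // eq_sym (negbTE nji) mulr0.
rewrite linearZ /= coord_e // eqxx mulr1 !mulrA mulfVK //.
by rewrite -expr2 sqrr_sign mul1r.
Qed.

Variable sigma : cochain V 3.
Hypothesis fs : is_form sigma.

Lemma wedge_contract_form x : is_form (wedge (contract x sigma) sigma).
Proof. by apply: (@wedge_form _ _ 2 3); first exact: contract_form. Qed.

(** [linfun] agrees with a function only once linearity is known. Here it follows from the
    injectivity of contraction with [nu]. *)
Lemma K_end_linear : linear (fun w => A_iso nu (wedge (contract w sigma) sigma)).
Proof.
move=> c x y; have W := wedge_contract_form; apply: contract_inj; rewrite (A_isoP (W _)).
apply: funext => v; rewrite contract_lin // (A_isoP (W x)) (A_isoP (W y)).
rewrite /wedge mulrCA -mulrDr; congr (_ * _).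
rewrite big_distrr -big_split /=; apply: eq_bigr => s _.
by rewrite contract_lin // mulrDl mulrDr -mulrA [X in _ = X + _]mulrCA.
Qed.

Lemma K_endE w : K_end nu sigma w = A_iso nu (wedge (contract w sigma) sigma).
Proof. exact: (linfunE K_end_linear). Qed.

Definition coefs3 (i j k : nat) : R := sigma [tuple e`_i; e`_j; e`_k].

Lemma coefs3E i j k : sigma [tuple e`_i; e`_j; e`_k] = alt_ext coefs3 i j k.
Proof. exact: (form3_alt_ext (fun i => e`_i)). Qed.

(** The sign (-1)^j of [contract_coord] is the one built into [kap], and the ten products there are
    the ten terms of the wedge of a 2-form with a 3-form. *)
Lemma K_coord (i j : 'I_6) : coord e j (K_end nu sigma e`_i) = kap coefs3 i j / nu e.
Proof.
apply: (mulIf nu0); rewrite mulfVK //; apply: (mulrI (unitrX j (unitrN1 R))).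
rewrite mulrA -contract_coord // K_endE (A_isoP (wedge_contract_form _)).
have E (p : nat * nat * nat * nat * nat) : p = others j ->
    etuple e (lift j) = let: (p0, p1, p2, p3, p4) := p in
      [tuple e`_p0; e`_p1; e`_p2; e`_p3; e`_p4].
  by move=> ->; case: j => j hj; do 6?[case: j hj => [|j] hj //];
    apply: eq_from_tnth => -[[|[|[|[|[|//]]]]] h]; rewrite tnth_mktuple !(tnth_nth 0).
rewrite /kap; have := E _ erefl; case: (others j) => [[[[p0 p1] p2] p3] p4] ->.
rewrite wedge23E //; last exact: contract_form.
have ec p q : contract e`_i sigma [tuple e`_p; e`_q] = alt_ext coefs3 i p q.
  by rewrite -coefs3E; congr sigma; apply: val_inj.
have sg : (-1) ^+ j * (-1) ^+ (Nat.odd j) = 1 :> R.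
  rewrite -exprD -signr_odd.
  by case: j {E} => j hj; do 6?[case: j hj => [|j] hj //].
by rewrite !ec !coefs3E mulrA sg mul1r.
Qed.

Lemma K_sq x : K_end nu sigma (K_end nu sigma x) = (kap_sq coefs3 / nu e ^+ 2) *: x.
Proof.
suff H (i : 'I_6) : K_end nu sigma (K_end nu sigma e`_i) = (kap_sq coefs3 / nu e ^+ 2) *: e`_i.
  rewrite (coordE be x) !linear_sum; apply: eq_bigr => i _.
  by rewrite !linearZ /= H [in RHS]scalerA mulrC -scalerA.
rewrite [LHS](coordE be) [RHS](coordE be); apply: eq_bigr => l _; congr (_ *: _).
rewrite [K_end nu sigma e`_i](coordE be) !linear_sum linearZ /= coord_e //.
under eq_bigr => j _ do rewrite !linearZ /= !K_coord mulrACA.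
rewrite -big_distrl /= kap_mul -invfM -expr2.
by rewrite -mulrA mulrC eq_sym.
Qed.

(** The square of K is scalar and the dimension is 6, so one sixth of the trace is that scalar. *)
Lemma lambdaE : lambda nu sigma = kap_sq coefs3 / nu e ^+ 2.
Proof.
rewrite /lambda (trace_basis _ be).
under eq_bigr => i _ do rewrite comp_lfunE K_sq linearZ /= coord_e // eqxx mulr1.
by rewrite sumr_const card_ord -[(_ / _) *+ 6]mulr_natl mulKf // pnatr_eq0.
Qed.

End WithVolume.

Lemma basis_extend n (x y : V) : \dim {:V}%VS = n.+2 -> free [:: x; y] ->
  exists e : n.+2.-tuple V, [/\ basis_of {:V} e, e`_0 = x & e`_1 = y].
Proof.
move=> dn fxy; pose U := <<[:: x; y]>>%VS.
have dU : \dim U = 2%N by rewrite /U (eqP fxy).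
have sz : size (x :: y :: vbasis U^C) == n.+2.
  by rewrite /= size_tuple dimv_compl dn dU !subSS subn0.
exists (Tuple sz); split=> //=.
rewrite basisEdim dn (eqP sz) leqnn andbT -[x :: _]/([:: x; y] ++ vbasis U^C).
by rewrite span_cat (span_basis (vbasisP _)) addv_complf.
Qed.

Section Symmetry.
Variables (e : 6.-tuple V) (nu : cochain V 6) (sigma : cochain V 3).
Hypotheses (be : basis_of {:V} e) (fn : is_form nu) (nu0 : nu e != 0) (fs : is_form sigma).

(* K does not depend on the basis, so that a single coefficient is to be
   checked, in a basis that starts with x and z. *)
Lemma K_alt x z : sigma [tuple K_end nu sigma x; x; z] = 0.
Proof.
have [fxz|] := boolP (free [:: x; z]); last first.
  rewrite free_cons (free_cons z) nil_free andbT negb_and !negbK span_seq1 span_nil memv0.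
  by case/orP => [/vlineP[a ->]|/eqP ->];
    rewrite ?linearZ /= ?form3_Z2 ?form3_alt23 ?mulr0 ?(law0 (f := fun t => sigma [tuple _; x;
      t])) // => *;
    rewrite form3_lin3.
have d6 : \dim {:V}%VS = 6%N := size_basis be.
have [e' [be' <- <-]] := basis_extend d6 fxz.
have nu' : nu e' != 0 := form_top_neq0 be' fn nu0.
rewrite [K_end nu sigma _](coordE be').
rewrite (scalar_sum (f := fun t => sigma [tuple t; e'`_0; e'`_1])) => [|c u v]; last first.
  by rewrite form3_lin1.
under eq_bigr => l _ do rewrite (K_coord be' fn nu' fs ord0 l) (coefs3E e' fs) mulrAC.
by rewrite -big_distrl /= kap_alt mul0r.
Qed.

(** Polarization of [K_alt] in x and y. *)
Lemma K_symm x y z : sigma [tuple K_end nu sigma x; y; z] = sigma [tuple x; K_end nu sigma y; z].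
Proof.
have := K_alt (x + y) z; rewrite linearD form3_D1 // !form3_D2 // !K_alt add0r addr0.
by move=> /eqP; rewrite addr_eq0 => /eqP ->; rewrite -form3_anti12.
Qed.

Hypothesis l0 : lambda nu sigma < 0.

Lemma J_endJ x : J_end nu sigma (J_end nu sigma x) = - x.
Proof.
rewrite /J_end !scale_lfunE linearZ /= (K_sq be fn nu0 fs) -(lambdaE be fn nu0 fs)
  !scalerA -invfM -expr2.
rewrite sqr_sqrtr ?normr_ge0 // ltr0_norm // invrN mulNr mulVf ?lt_eqF //.
by rewrite scaleN1r.
Qed.

Lemma J_end_symm x y z : sigma [tuple J_end nu sigma x; y; z] = sigma [tuple x; J_end nu sigma y; z].
Proof.
by rewrite /J_end !scale_lfunE form3_Z1 // form3_Z2 // K_symm.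
Qed.

End Symmetry.
End HitchinMap.

(** * Complex frames *)

Section ComplexFrames.
Local Open Scope ring_scope.
Variables (R : realType) (V : vectType R).

(** For an alternating form and J^2 = -1, this says that [a] is the real part of a complex trilinear
    form, that is, of type (3,0) + (0,3). *)
Definition Jsym (J : 'End(V)) (a : cochain V 3) : Prop :=
  forall x y z, a [tuple J x; y; z] = a [tuple x; J y; z].

Section Fixed.
Variable J : 'End(V).
Hypothesis JJ : forall x, J (J x) = - x.

Lemma Jsym13 a x y z : is_form a -> Jsym J a ->
  a [tuple x; y; J z] = a [tuple J x; y; z].
Proof. by move=> fa Ja; rewrite [LHS]form3_cyc // (Ja z x y) [RHS]form3_cyc. Qed.

Lemma Jsym_pair a x z : is_form a -> Jsym J a -> a [tuple J x; x; z] = 0.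
Proof.
move=> fa Ja; have := Ja x x z; rewrite [RHS]form3_anti12 // => /eqP.
by rewrite -subr_eq0 opprK -mulr2n mulrn_eq0 /= => /eqP.
Qed.

Definition frame (x y z : V) : 6.-tuple V := [tuple x; J x; y; J y; z; J z].

(** All occurrences of J move to the first slot and cancel in pairs. Components with two arguments
    in one complex line vanish by [Jsym_pair], and the others reduce to the two given values. *)
Lemma frame_zero (a : cochain V 3) x y z :
  basis_of {:V} (frame x y z) -> is_form a -> Jsym J a ->
  a [tuple x; y; z] = 0 -> a [tuple J x; y; z] = 0 -> a =1 fun=> 0.
Proof.
move=> be fa Ja a1 a2.
apply: (form_ext_incr be fa (@zero_form R V 3)) => f incr.
have h01 := incr ord0 (lift ord0 ord0) isT.
have h12 := incr (lift ord0 ord0) ord_max isT.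
have -> : etuple (frame x y z) f = [tuple (frame x y z)`_(f ord0);
    (frame x y z)`_(f (lift ord0 ord0)); (frame x y z)`_(f ord_max)].
  apply: eq_from_tnth => -[[|[|[|//]]] h]; rewrite tnth_mktuple !(tnth_nth 0) /=;
    by congr nth; congr (nat_of_ord (f _)); apply: val_inj.
move: h01 h12; case: (f ord0) => i hi; case: (f _) => j hj; case: (f _) => k hk /=.
have S2 u v w : a [tuple u; J v; w] = a [tuple J u; v; w] by rewrite Ja.
have S3 u v w : a [tuple u; v; J w] = a [tuple J u; v; w] by rewrite Jsym13.
do 6?[case: i hi => [|i] hi //]; do 6?[case: j hj => [|j] hj //] => ij;
do 6?[case: k hk => [|k] hk //] => jk; clear ij jk; rewrite /=;
  by rewrite ?S3 ?S2 ?JJ ?form3_N1 ?Jsym_pair ?form3_alt12 ?form3_alt23 ?a1 ?a2 ?oppr0.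
Qed.

Lemma frame_ext (a b : cochain V 3) x y z :
  basis_of {:V} (frame x y z) -> is_form a -> is_form b -> Jsym J a -> Jsym J b ->
  a [tuple x; y; z] = b [tuple x; y; z] -> a [tuple J x; y; z] = b [tuple J x; y; z] ->
  a =1 b.
Proof.
move=> be fa fb Ja Jb e1 e2 v; apply/eqP; rewrite -subr_eq0; apply/eqP.
apply: (frame_zero (a := fun v => a v - b v) be); rewrite ?e1 ?e2 ?subrr //.
  have [[fa1 fa2] [fb1 fb2]] := (fa, fb); split=> [w i c u t|w i j nij eij].
    by rewrite fa1 fb1; ring.
  by rewrite (fa2 _ _ _ nij eij) (fb2 _ _ _ nij eij) subrr.
by move=> u t w; rewrite Ja Jb.
Qed.

(** Otherwise J would have a real eigenvalue a on the quotient by U, with a^2 = -1. *)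
Lemma J_notin (U : {vspace V}) z :
  (forall u, u \in U -> J u \in U) -> z \notin U -> J z \notin (<[z]> + U)%VS.
Proof.
move=> JU; apply: contra => /memv_addP[_ /vlineP[a ->] [u uU e]].
have h : (-1 - a * a) *: z = a *: u + J u.
  rewrite scalerBl scaleN1r -[- z]JJ e linearD linearZ /= e scalerDr scalerA.
  by rewrite addrAC [X in X + J u]addrAC subrr add0r.
have a1 : -1 - a * a != 0.
  by rewrite -opprD oppr_eq0 gt_eqF // ltr_pwDl // -expr2 sqr_ge0.
have /(memvZ (-1 - a * a)^-1) : (-1 - a * a) *: z \in U.
  by rewrite h memvD ?memvZ ?JU.
by rewrite scalerA mulVf // scale1r.
Qed.

Lemma J_stable (U : {vspace V}) z : (forall u, u \in U -> J u \in U) ->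
  forall u, u \in (<[J z]> + (<[z]> + U))%VS -> J u \in (<[J z]> + (<[z]> + U))%VS.
Proof.
move=> JU u /memv_addP[_ /vlineP[a ->] [_ /memv_addP[_ /vlineP[b ->] [t tU ->]] ->]].
rewrite !linearD !linearZ /= JJ addrCA; apply: memv_add.
  by rewrite memvZ ?memv_line.
apply: memv_add; last exact: JU.
by rewrite memvZ ?memvN ?memv_line.
Qed.

Hypothesis dim6 : \dim {:V}%VS = 6%N.

Lemma notin_small (U : {vspace V}) : (\dim U < 6)%N -> exists z, z \notin U.
Proof.
move=> dU; have : ~~ (fullv <= U)%VS.
  by apply: contraL dU => /dimvS; rewrite dim6 -leqNgt.
by case/subvPn => z _ zU; exists z.
Qed.

Lemma frame_free x y z : x != 0 -> y \notin <<[:: J x; x]>>%VS ->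
  z \notin <<[:: J y; y; J x; x]>>%VS -> basis_of {:V} (frame x y z).
Proof.
move=> x0 yx zyx.
have U0 : forall u, u \in <<[::] : seq V>>%VS -> J u \in <<[::] : seq V>>%VS.
  by move=> u; rewrite span_nil memv0 => /eqP ->; rewrite linear0 mem0v.
have U1 : forall u, u \in <<[:: J x; x]>>%VS -> J u \in <<[:: J x; x]>>%VS.
  by move=> u; rewrite !span_cons; exact: J_stable.
have U2 : forall u, u \in <<[:: J y; y; J x; x]>>%VS -> J u \in <<[:: J y; y; J x; x]>>%VS.
  by move=> u; rewrite (span_cons (J y)) (span_cons y); exact: J_stable.
have fr : free [:: J z; z; J y; y; J x; x].
  rewrite !free_cons nil_free andbT zyx yx !span_cons !J_notin -?span_cons //=;
  by rewrite span_nil memv0.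
have fr' : free (frame x y z).
  have pe : perm_eq (rev [:: J z; z; J y; y; J x; x]) [:: J z; z; J y; y; J x; x].
    by rewrite perm_rev.
  by move: fr; rewrite -(perm_free pe).
by rewrite basisEfree fr' subvf dim6.
Qed.

Lemma frame_exists (a : cochain V 3) x : is_form a -> Jsym J a ->
  (exists v, a v != 0) -> x != 0 ->
  exists y z, [/\ basis_of {:V} (frame x y z), a [tuple x; y; z] = 1 & a [tuple J x; y; z] = 0].
Proof.
move=> fa Ja [v av] x0.
have [y yx] : exists y, y \notin <<[:: J x; x]>>%VS.
  by apply: notin_small; apply: leq_ltn_trans (dim_span _) _.
have [z zyx] : exists z, z \notin <<[:: J y; y; J x; x]>>%VS.
  by apply: notin_small; apply: leq_ltn_trans (dim_span _) _.
have be := frame_free x0 yx zyx.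
set p := a [tuple x; y; z]; set q := a [tuple J x; y; z].
have pq : p * p + q * q != 0.
  apply: contraNneq av => /eqP; rewrite -!expr2 paddr_eq0 ?sqr_ge0 // !sqrf_eq0.
  by case/andP => /eqP p0 /eqP q0; rewrite (frame_zero be).
(* If [a] is the real part of the complex trilinear form f, then f(x, y, z) = p - iq; the factor c +
   id is its inverse, and z is rescaled by it. *)
pose c := p / (p * p + q * q); pose d := q / (p * p + q * q).
exists y, (c *: z + d *: J z).
have e1 : a [tuple J (J x); y; z] = - p by rewrite JJ form3_N1.
split; last 2 first.
- rewrite form3_D3 // !form3_Z3 // Jsym13 // -/p -/q /c /d.
  by field.
- rewrite form3_D3 // !form3_Z3 // Jsym13 // e1 -/q /c /d.
  by field.
apply: (frame_free x0 yx); apply: contra zyx => h.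
have U2 : forall u, u \in <<[:: J y; y; J x; x]>>%VS -> J u \in <<[:: J y; y; J x; x]>>%VS.
  have U0 : forall u, u \in <<[::] : seq V>>%VS -> J u \in <<[::] : seq V>>%VS.
    by move=> u; rewrite span_nil memv0 => /eqP ->; rewrite linear0 mem0v.
  move=> u; rewrite (span_cons (J y)) (span_cons y) (span_cons (J x)) (span_cons x).
  by do 2!apply: J_stable.
(* Multiplication by p - qJ undoes the rescaling, so the new vector cannot lie in the J-stable span
   of x and y. *)
have -> : z = p *: (c *: z + d *: J z) - q *: J (c *: z + d *: J z).
  have -> : J (c *: z + d *: J z) = c *: J z - d *: z.
    by rewrite linearD !linearZ /= JJ scalerN.
  rewrite scalerDr scalerBr !scalerA opprB addrACA -scalerDl -scalerBl.
  have -> : p * c + q * d = 1 by rewrite /c /d; field.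
  have -> : p * d - q * c = 0 by rewrite /c /d; field.
  by rewrite scale0r addr0 scale1r.
by rewrite memvB // memvZ // U2.
Qed.

End Fixed.
End ComplexFrames.

(** * Open orbits *)

Section Stability.
Local Open Scope ring_scope.
Local Open Scope classical_set_scope.
Variables (R : realType) (V : vectType R).

(** Dual functionals force the vectors to be independent, and the dimension does the rest. They are
    then the coordinates, which identifies coordinates with scalar products in orthonormal
    frames. *)
Lemma dual_basis n (e : n.-tuple V) (phi : 'I_n -> V -> R) :
  \dim {:V}%VS = n -> (forall i c x y, phi i (c *: x + y) = c * phi i x + phi i y) ->
  (forall i j : 'I_n, phi i e`_j = (i == j)%:R) ->
  basis_of {:V} e /\ forall i x, coord e i x = phi i x.
Proof.
move=> dn lphi de.
have be : basis_of {:V} e.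
  rewrite basisEfree subvf dn size_tuple leqnn !andbT; apply/freeP => k k0 i.
  have := scalar_sum k (fun j => e`_j) (lphi i).
  rewrite k0 (law0 (lphi i)) (bigD1 i) //= big1 => [|j nj].
    by rewrite de eqxx mulr1 addr0.
  by rewrite de eq_sym (negbTE nj) mulr0.
split=> // i x; rewrite {2}(coordE be x) (scalar_sum _ _ (lphi i)).
rewrite (bigD1 i) //= big1 => [|j nj]; first by rewrite de eqxx mulr1 addr0.
by rewrite de eq_sym (negbTE nj) mulr0.
Qed.

Lemma common_kernel k (phi : 'I_k -> V -> R) :
  (k < \dim {:V}%VS)%N -> (forall i c x y, phi i (c *: x + y) = c * phi i x + phi i y) ->
  exists2 x, x != 0 & forall i, phi i x = 0.
Proof.
move=> kd lphi; pose f x : 'rV[R]_k := \row_i phi i x.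
have lf : linear f by move=> c x y; apply/rowP => i; rewrite !mxE lphi.
have : lker (linfun f) != 0%VS.
  apply/eqP => k0; have := limg_ker_dim (linfun f) fullv.
  rewrite k0 capv0 dimv0 add0n => dk.
  have : (\dim (limg (linfun f)) <= k)%N.
    by apply: leq_trans (dimvS (subvf _)) _; rewrite dimvf /dim /= mul1n.
  by rewrite dk leqNgt kd.
rewrite -vpick0 => x0; exists (vpick (lker (linfun f))) => // i.
have := memv_pick (lker (linfun f)); rewrite memv_ker linfunE // => /eqP/rowP/(_ i).
by rewrite !mxE.
Qed.

Lemma basis_map n (e e' : n.-tuple V) : basis_of {:V} e -> basis_of {:V} e' ->
  exists2 g : 'End(V), lker g == 0%VS & forall i : 'I_n, g e`_i = e'`_i.
Proof.
move=> be be'; pose f x := \sum_i coord e i x *: e'`_i.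
have lf : linear f.
  move=> c x y; rewrite /f scaler_sumr -big_split /=; apply: eq_bigr => i _.
  by rewrite linearP scalerDl scalerA.
exists (linfun f) => [|i]; last first.
  rewrite linfunE // /f (bigD1 i) //= coord_e // eqxx scale1r big1 ?addr0 // => j nj.
  by rewrite coord_e // (negbTE nj) scale0r.
apply/lker0P => x y; rewrite !linfunE // => exy.
rewrite (coordE be x) (coordE be y); apply: eq_bigr => i _; congr (_ *: _).
have E z : coord e' i (f z) = coord e i z.
  rewrite /f linear_sum (bigD1 i) //= linearZ /= coord_e // eqxx mulr1 big1 ?addr0 // => j nj.
  by rewrite linearZ /= coord_e // eq_sym (negbTE nj) mulr0.
by rewrite -!E exy.
Qed.

Lemma basis_image n (e : n.-tuple V) (g : 'End(V)) :
  basis_of {:V} e -> lker g == 0%VS -> basis_of {:V} [tuple of map g e].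
Proof.
move=> be /eqP kg; rewrite basisEfree subvf /= size_map size_tuple.
have [de fe] : \dim {:V}%VS = n /\ free e.
  by rewrite (basis_free be) -(size_basis be).
rewrite de leqnn !andbT /free size_map -limg_span limg_dim_eq //.
by rewrite kg capv0.
Qed.

Lemma pullback3 (g : 'End(V)) (a : cochain V 3) x y z :
  pullback g a [tuple x; y; z] = a [tuple g x; g y; g z].
Proof. by congr a; apply: val_inj. Qed.

Lemma pullback2 (g : 'End(V)) (a : cochain V 2) x y :
  pullback g a [tuple x; y] = a [tuple g x; g y].
Proof. by congr a; apply: val_inj. Qed.

(** Each form has a complex frame on which its two determining values are 1 and 0. The map carrying
    one frame to the other intertwines the complex structures, hence carries the forms into each
    other. *)
Lemma orbit3 (J J' : 'End(V)) (a b : cochain V 3) : \dim {:V}%VS = 6%N ->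
  (forall x, J (J x) = - x) -> (forall x, J' (J' x) = - x) ->
  is_form a -> is_form b -> Jsym J a -> Jsym J' b ->
  (exists v, a v != 0) -> (exists v, b v != 0) -> GL_orbit a b.
Proof.
move=> d6 JJ JJ' fa fb Ja Jb a0 b0.
have [x x0] : exists x : V, x != 0.
  have : {:V}%VS != 0%VS by rewrite -dimv_eq0 d6.
  by rewrite -vpick0; exists (vpick {:V}%VS).
have [y [z [be a1 a2]]] := frame_exists JJ d6 fa Ja a0 x0.
have [y' [z' [be' b1 b2]]] := frame_exists JJ' d6 fb Jb b0 x0.
have [g kg ge] := basis_map be' be; exists g => //; apply: funext.
have g0 : g x = x := ge ord0.
have g1 : g (J' x) = J x := ge (lift ord0 ord0).
have g2 : g y' = y := ge (@Ordinal 6 2 isT).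
have g3 : g (J' y') = J y := ge (@Ordinal 6 3 isT).
have g4 : g z' = z := ge (@Ordinal 6 4 isT).
have g5 : g (J' z') = J z := ge (@Ordinal 6 5 isT).
have gJ u : g (J' u) = J (g u).
  rewrite (coordE be' u) !linear_sum; apply: eq_bigr => i _; rewrite !linearZ; congr (_ *: _).
  by case: i => i hi; do 6?[case: i hi => [|i] hi //];
    rewrite /= ?JJ' ?linearN /= ?g0 ?g1 ?g2 ?g3 ?g4 ?g5 ?JJ.
apply: (frame_ext JJ' be' fb (pullback_form _ fa)) => //.
- by move=> u v w; rewrite !pullback3 !gJ Ja.
- by rewrite pullback3 g0 g2 g4 a1.
- by rewrite pullback3 g1 g2 g4 a2.
Qed.

Lemma eval_continuous k (v : k.-tuple V) :
  continuous (fun b : {ptws k.-tuple V -> R} => b v : R).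
Proof. exact: (@proj_continuous _ (fun=> R : topologicalType) v). Qed.

Section RealValued.
Variable T : topologicalType.
Implicit Types f g : T -> R.

Lemma continuous_oppr f : continuous f -> continuous (fun t => - f t).
Proof. by move=> cf t; exact: continuousN (cf t). Qed.

Lemma continuous_addr f g : continuous f -> continuous g -> continuous (fun t => f t + g t).
Proof. by move=> cf cg t; exact: continuousD (cf t) (cg t). Qed.

Lemma continuous_mulr f g : continuous f -> continuous g -> continuous (fun t => f t * g t).
Proof. by move=> cf cg t; exact: continuousM (cf t) (cg t). Qed.

End RealValued.

Lemma continuous_sumr (T : topologicalType) (I : Type) (r : seq I) (P : pred I) (f : I -> T -> R) :
  (forall i, continuous (f i)) -> continuous (fun t => \sum_(i <- r | P i) f i t).
Proof.
move=> cf; elim: r => [|i r IH].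
  by under eq_fun do rewrite big_nil; exact: cst_continuous.
under eq_fun do rewrite big_cons; case: (P i) => // t.
by apply: cvgD; [exact: cf|exact: IH].
Qed.

Lemma continuous_prodr (T : topologicalType) (I : Type) (r : seq I) (f : I -> T -> R) :
  (forall i, continuous (f i)) -> continuous (fun t => \prod_(i <- r) f i t).
Proof.
move=> cf; elim: r => [|i r IH].
  by under eq_fun do rewrite big_nil; exact: cst_continuous.
under eq_fun do rewrite big_cons; move=> t.
by apply: cvgM; [exact: cf|exact: IH].
Qed.

Lemma kap_sq_continuous (e : 6.-tuple V) :
  continuous (fun b : {ptws 3.-tuple V -> R} => kap_sq (coefs3 e b) : R).
Proof.
have ca i j k : continuous (fun b : {ptws 3.-tuple V -> R} => alt_ext (coefs3 e b) i j k : R).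
  have ce p q r : continuous (fun b : {ptws 3.-tuple V -> R} => coefs3 e b p q r : R).
    exact: eval_continuous.
  have cn p q r := continuous_oppr (ce p q r).
  rewrite /alt_ext; do 6?[case: (_ && _) => //]; exact: cst_continuous.
have ck i j : continuous (fun b : {ptws 3.-tuple V -> R} => kap (coefs3 e b) i j : R).
  rewrite /kap; case: (others j) => [[[[p0 p1] p2] p3] p4].
  have cm p q r p' q' r' := continuous_mulr (ca p q r) (ca p' q' r').
  apply: continuous_mulr; first exact: cst_continuous.
  do 9?[apply: continuous_addr; last by first [exact: cm | exact: continuous_oppr (cm _ _ _ _ _ _)]].
  exact: cm.
by apply: continuous_sumr => j; apply: continuous_mulr; exact: ck.
Qed.

(* Evaluating the condition [lambda < 0] in all bases makes the open set
   invariant under the general linear group. *)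
Lemma stable_lambda_lt0 (nu : cochain V 6) (sigma : cochain V 3) :
  \dim {:V}%VS = 6%N -> volume_form nu -> is_form sigma -> lambda nu sigma < 0 ->
  stable sigma.
Proof.
move=> d6 [fn [v nv]] fs ls.
have e6 : {e : 6.-tuple V | basis_of {:V} e}.
  by rewrite -d6; exists (vbasis {:V}); exact: vbasisP.
have nue (e : 6.-tuple V) : basis_of {:V} e -> nu e != 0 by move=> be; exact: form_top_neq0 nv.
have neg (e : 6.-tuple V) a : basis_of {:V} e -> is_form a ->
    (lambda nu a < 0) = (kap_sq (coefs3 e a) < 0).
  move=> be fa; rewrite (lambdaE be fn (nue _ be) fa) pmulr_llt0 //.
  by rewrite invr_gt0 exprn_even_gt0 // nue.
exists [set b | exists2 e : 6.-tuple V, basis_of {:V} e & kap_sq (coefs3 e b) < 0].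
split=> [|b fb].
  rewrite (_ : [set b | _] = \bigcup_(e in [set e : 6.-tuple V | basis_of {:V} e])
      ((fun b : {ptws 3.-tuple V -> R} => kap_sq (coefs3 e b) : R) @^-1` [set x | x < 0])).
    apply: bigcup_open => e _; apply: open_comp; last exact: open_lt.
    by move=> b _; exact: kap_sq_continuous.
  by apply/seteqP; split=> b /= [e]; exists e.
have nz a : is_form a -> lambda nu a < 0 -> exists w, a w != 0.
  move=> fa la; apply: contrapT => /forallNP h; case: e6 => e be.
  move: la; rewrite (lambdaE be fn (nue _ be) fa) /kap_sq big1 ?mul0r ?ltxx // => j _.
  have a0 i k l : alt_ext (coefs3 e a) i k l = 0.
    rewrite -coefs3E //; apply/eqP; apply: contrapT => /negP; exact: h.
  by rewrite /kap; case: (others j) => [[[[p0 p1] p2] p3] p4]; rewrite !a0 !(mul0r, subr0, addr0, mulr0).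
split=> [[e be kb]|[g kg ->]].
  have lb : lambda nu b < 0 by rewrite (neg e).
  case: e6 => e' be'.
  apply: (orbit3 (J := J_end nu sigma) (J' := J_end nu b)) => //.
  - exact: (J_endJ be' fn (nue _ be')).
  - exact: (J_endJ be' fn (nue _ be')).
  - exact: (J_end_symm be' fn (nue _ be')).
  - exact: (J_end_symm be' fn (nue _ be')).
  - exact: nz.
  - exact: nz.
case: e6 => e be; have kg' : lker (g^-1)%VF == 0%VS.
  apply/lker0P => x y exy.
  by rewrite -(lker0_lfunVK kg x) exy lker0_lfunVK.
(* In the basis g^-1 e, the pullback of sigma by g has the coefficients that sigma has in e. *)
exists [tuple of map (g^-1)%VF e]; first exact: basis_image.
rewrite (_ : coefs3 _ _ = coefs3 e sigma) -?neg //.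
apply: funext => i; apply: funext => j; apply: funext => k.
have gK l : g ([tuple of map (g^-1)%VF e])`_l = e`_l.
  case: (ltnP l 6) => hl; last by rewrite !nth_default ?linear0 ?size_tuple.
  by rewrite /= (nth_map 0) ?size_tuple // lker0_lfunVK.
by rewrite /coefs3 pullback3 !gK.
Qed.

(** * Symplectic bases and the orbit of nondegenerate 2-forms *)

Section Symplectic.
Variable a : cochain V 2.
Hypothesis fa : is_form a.
Hypothesis nd : forall x, x != 0 -> exists y, a [tuple x; y] != 0.

(* The zero pair is allowed so that the same step serves at all stages of the
   construction of a symplectic basis. *)
Definition hyperbolic_or_zero (x y : V) : Prop := a [tuple x; y] = 1 \/ (x = 0 /\ y = 0).

(** Symplectic Gram-Schmidt: four linear conditions leave a nonzero x in dimension above 4, and a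
    partner of x is projected away from the given pairs. *)
Lemma symplectic_step x1 y1 x2 y2 : (4 < \dim {:V}%VS)%N ->
  hyperbolic_or_zero x1 y1 -> hyperbolic_or_zero x2 y2 ->
  a [tuple x1; x2] = 0 -> a [tuple x1; y2] = 0 ->
  a [tuple y1; x2] = 0 -> a [tuple y1; y2] = 0 ->
  exists x y, [/\ a [tuple x; y] = 1,
    [/\ a [tuple x1; x] = 0, a [tuple y1; x] = 0, a [tuple x2; x] = 0 & a [tuple y2; x] = 0] &
    [/\ a [tuple x1; y] = 0, a [tuple y1; y] = 0, a [tuple x2; y] = 0 & a [tuple y2; y] = 0]].
Proof.
move=> d h1 h2 xx xy yx yy.
pose t := [tuple x1; y1; x2; y2].
have [x x0 hx] := @common_kernel 4 (fun i z => a [tuple tnth t i; z]) d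
  (fun i c u v => form2_linr c u v (tnth t i) fa).
have {hx} [e1 e2 e3 e4] : [/\ a [tuple x1; x] = 0, a [tuple y1; x] = 0,
    a [tuple x2; x] = 0 & a [tuple y2; x] = 0].
  by split; [exact: (hx ord0)|exact: (hx (@Ordinal 4 1 isT))|
    exact: (hx (@Ordinal 4 2 isT))|exact: (hx (@Ordinal 4 3 isT))].
have [w xw] := nd x0; pose c := a [tuple x; w].
have N u v : a [tuple v; u] = - a [tuple u; v] by exact: form2_anti.
(* The projection of w off the given hyperbolic pairs. As x is orthogonal to them, the pairing of x
   with w is unchanged. *)
pose w' := w + (a [tuple y1; w] *: x1 - a [tuple x1; w] *: y1)
             + (a [tuple y2; w] *: x2 - a [tuple x2; w] *: y2).
have E u : a [tuple u; w'] = a [tuple u; w] +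
   (a [tuple y1; w] * a [tuple u; x1] - a [tuple x1; w] * a [tuple u; y1]) +
   (a [tuple y2; w] * a [tuple u; x2] - a [tuple x2; w] * a [tuple u; y2]).
  by rewrite /w' !(form2_Dr, form2_Nr, form2_Zr).
have A0 u : a [tuple u; u] = 0 by exact: form2_alt.
exists x, (c^-1 *: w'); rewrite !form2_Zr // !E.
rewrite (N x1 x) (N y1 x) (N x2 x) (N y2 x) e1 e2 e3 e4 !(N x1 x2, N x1 y2, N y1 x2, N y1 y2).
rewrite xx xy yx yy !A0.
rewrite !oppr0 !mulr0 !subr0 !addr0 !add0r; split=> //; first by rewrite mulVf.
split; apply/eqP; rewrite mulf_eq0; apply/orP; right.
- case: h1 => [->|[-> ->]]; rewrite ?form2_0l ?form2_0r // ?mulr0 ?subr0 ?addr0 //; apply/eqP; ring.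
- case: h1 => [h|[-> ->]]; rewrite ?form2_0l ?form2_0r // ?mulr0 ?subr0 ?addr0 // (N x1 y1) h;
  apply/eqP; ring.
- case: h2 => [->|[-> ->]]; rewrite ?form2_0l ?form2_0r // ?mulr0 ?subr0 ?addr0 //; apply/eqP; ring.
- case: h2 => [h|[-> ->]]; rewrite ?form2_0l ?form2_0r // ?mulr0 ?subr0 ?addr0 // (N x2 y2) h;
  apply/eqP; ring.
Qed.

Definition sympl (i j : nat) : R :=
  match i, j with
  | 0%N, 1%N | 2%N, 3%N | 4%N, 5%N => 1
  | 1%N, 0%N | 3%N, 2%N | 5%N, 4%N => -1
  | _, _ => 0
  end.

Lemma symplectic_basis : \dim {:V}%VS = 6%N ->
  exists2 e : 6.-tuple V, basis_of {:V} e &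
    forall i j : 'I_6, a [tuple e`_i; e`_j] = sympl i j.
Proof.
move=> d6; have d4 : (4 < \dim {:V}%VS)%N by rewrite d6.
have N u v : a [tuple v; u] = - a [tuple u; v] by exact: form2_anti.
have A0 u : a [tuple u; u] = 0 by exact: form2_alt.
have hz : hyperbolic_or_zero 0 0 by right.
have [x1 [y1 [h1 _ _]]] := symplectic_step d4 hz hz (A0 0) (A0 0) (A0 0) (A0 0).
have [x2 [y2 [h2 [xx xy _ _] [yx yy _ _]]]] := symplectic_step d4 (or_introl h1) hz
   (form2_0r _ fa) (form2_0r _ fa) (form2_0r _ fa) (form2_0r _ fa).
have [x3 [y3 [h3 [a1 a2 a3 a4] [b1 b2 b3 b4]]]] :=
   symplectic_step d4 (or_introl h1) (or_introl h2) xx yx xy yy.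
pose e := [tuple x1; y1; x2; y2; x3; y3].
have H := (h1, h2, h3, (xx, xy, yx, yy), (a1, a2, a3, a4), (b1, b2, b3, b4)).
have G (i j : 'I_6) : a [tuple e`_i; e`_j] = sympl i j.
  case: i j => [i hi] [j hj].
  do 6?[case: i hi => [|i] hi //]; do 6?[case: j hj => [|j] hj //]; rewrite /= ?A0 ?H //;
    by rewrite N ?H ?oppr0.
exists e => //.
(* The functional dual to e_i is, up to sign, the pairing with its symplectic partner: e_(i-1) for
   odd i, e_(i+1) for even i. *)
pose dual (i : nat) (z : V) : R :=
  if Nat.odd i then a [tuple e`_(i.-1); z] else - a [tuple e`_(i.+1); z].
have [//|i c u v|i j|] := @dual_basis 6 e dual.
- by rewrite /dual; case: ifP => _; rewrite form2_linr // opprD mulrN.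
- rewrite /dual /e; case: i j => [i hi] [j hj].
  do 6?[case: i hi => [|i] hi //]; do 6?[case: j hj => [|j] hj //];
    rewrite /= ?A0 ?H ?oppr0 ?opprK //; by rewrite N ?H ?oppr0 ?opprK.
- by [].
Qed.

End Symplectic.

Lemma orbit2 (a b : cochain V 2) : \dim {:V}%VS = 6%N -> is_form a -> is_form b ->
  (forall x, x != 0 -> exists y, a [tuple x; y] != 0) ->
  (forall x, x != 0 -> exists y, b [tuple x; y] != 0) -> GL_orbit a b.
Proof.
move=> d6 fa fb na nb.
have [e be ae] := symplectic_basis fa na d6; have [e' be' be'e] := symplectic_basis fb nb d6.
have [g kg ge] := basis_map be' be; exists g => //; apply: funext.
apply: (form_ext be' fb (pullback_form _ fa)) => f.
have -> : etuple e' f = [tuple e'`_(f ord0); e'`_(f ord_max)].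
  apply: eq_from_tnth => -[[|[|//]] h]; rewrite tnth_mktuple !(tnth_nth 0) /=;
    by congr nth; congr (nat_of_ord (f _)); apply: val_inj.
by rewrite pullback2 !ge ae be'e.
Qed.

(** The open set is given by a nonzero Gram determinant in one fixed basis. This is nondegeneracy,
    an invariant condition, and nondegenerate forms are a single orbit by the symplectic normal
    form. *)
Lemma stable_nondegenerate (omega : cochain V 2) :
  \dim {:V}%VS = 6%N -> is_form omega ->
  (forall x, x != 0 -> exists y, omega [tuple x; y] != 0) -> stable omega.
Proof.
move=> d6 fo no.
pose gram (e : 6.-tuple V) (b : cochain V 2) : 'M[R]_6 := \matrix_(i, j) b [tuple e`_i; e`_j].
have gram_nd (e : 6.-tuple V) (b : cochain V 2) : basis_of {:V} e -> is_form b ->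
    (\det (gram e b) != 0) <-> (forall x, x != 0 -> exists y, b [tuple x; y] != 0).
  move=> be fb.
  have E x (j : 'I_6) : ((\row_i coord e i x) *m gram e b) 0 j = b [tuple x; e`_j].
    rewrite mxE [x in RHS](coordE be).
    rewrite (scalar_sum (f := fun z => b [tuple z; e`_j])) => [|c u v]; last exact: form2_linl.
    by apply: eq_bigr => i _; rewrite !mxE.
  split=> [dg x x0|h].
    apply: contrapT => /forallNP bx; move: dg; rewrite -unitfE -unitmxE => ug.
    have : (\row_i coord e i x) *m gram e b = 0.
      apply/rowP => j; rewrite E mxE; apply/eqP; apply: contrapT => /negP; exact: bx.
    move=> /(congr1 (mulmx^~ (invmx (gram e b)))); rewrite mulmxK // mul0mx => /rowP r0.
    case/eqP: x0; rewrite (coordE be x) big1 // => i _.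
    by have := r0 i; rewrite !mxE => ->; rewrite scale0r.
  apply/negP => /det0P[v v0 vg].
  pose x := \sum_i v 0 i *: e`_i.
  have cx : \row_i coord e i x = v.
    by apply/rowP => i; rewrite mxE /x coord_sum_free ?(basis_free be).
  have x0 : x != 0.
    by apply: contraNneq v0 => x0; rewrite -cx x0; apply/eqP/rowP => i; rewrite !mxE linear0.
  have [y] := h x x0; case/eqP; rewrite (coordE be y).
  rewrite (scalar_sum (f := fun z => b [tuple x; z])) => [|c u w]; last exact: form2_linr.
  by rewrite big1 // => j _; rewrite -E cx vg mxE mulr0.
have e6 : {e : 6.-tuple V | basis_of {:V} e}.
  by rewrite -d6; exists (vbasis {:V}); exact: vbasisP.
case: e6 => e be.
have cg i j : continuous (fun b : {ptws 2.-tuple V -> R} => gram e b i j : R).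
  have -> : (fun b : {ptws 2.-tuple V -> R} => gram e b i j : R) =
            (fun b => b [tuple e`_i; e`_j]) by apply: funext => b; rewrite mxE.
  exact: eval_continuous.
have cdet : continuous (fun b : {ptws 2.-tuple V -> R} => \det (gram e b) : R).
  apply: continuous_sumr => s; apply: continuous_mulr; first exact: cst_continuous.
  by apply: continuous_prodr => i; exact: cg.
exists [set b | \det (gram e b) != 0]; split=> [|b fb].
  have : open ((fun b : {ptws 2.-tuple V -> R} => \det (gram e b) : R) @^-1` [set x | x != 0]).
    by apply: open_comp; [move=> b _; exact: cdet | exact: open_neq].
  by [].
split=> [/(gram_nd _ _ be fb) nb|[g kg ->]]; first exact: orbit2.
apply/(gram_nd _ _ be (pullback_form _ fo)) => x x0.
have gx0 : g x != 0.
  by apply: contraNneq x0 => gx; rewrite -memv0 -(eqP kg) memv_ker gx.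
have [y oy] := no _ gx0; exists ((g^-1)%VF y).
by rewrite pullback2 lker0_lfunVK.
Qed.

End Stability.

(** * Nilpotent Lie algebras *)

Section NilpotentLie.
Local Open Scope ring_scope.
Variables (R : realType) (V : vectType R) (L : lie_algebra V).

Lemma brDl x y z : L (x + y) z = L x z + L y z.
Proof. by have := lie_linearl L z 1 x y; rewrite /= !scale1r. Qed.

Lemma brDr x y z : L z (x + y) = L z x + L z y.
Proof. by have := lie_linearr L z 1 x y; rewrite !scale1r. Qed.

Lemma br0l z : L 0 z = 0.
Proof. by apply: (addrI (L 0 z)); rewrite -brDl !addr0. Qed.

Lemma br0r z : L z 0 = 0.
Proof. by apply: (addrI (L z 0)); rewrite -brDr !addr0. Qed.

Lemma brZl c x z : L (c *: x) z = c *: L x z.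
Proof. by have := lie_linearl L z c x 0; rewrite /= !addr0 br0l addr0. Qed.

Lemma brZr c x z : L z (c *: x) = c *: L z x.
Proof. by have := lie_linearr L z c x 0; rewrite !addr0 br0r addr0. Qed.

Lemma brC x y : L y x = - L x y.
Proof.
have := lie_alternating L (x + y); rewrite brDl !brDr !lie_alternating add0r addr0.
by move/eqP; rewrite addrC addr_eq0 => /eqP.
Qed.

Lemma br_suml (I : finType) (c : I -> R) (w : I -> V) z :
  L (\sum_i c i *: w i) z = \sum_i c i *: L (w i) z.
Proof.
by elim/big_rec2: _ => [|i y1 y2 _ <-]; rewrite ?br0l // brDl brZl.
Qed.

Lemma br_sumr (I : finType) (c : I -> R) (w : I -> V) z :
  L z (\sum_i c i *: w i) = \sum_i c i *: L z (w i).
Proof.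
by elim/big_rec2: _ => [|i y1 y2 _ <-]; rewrite ?br0r // brDr brZr.
Qed.

Lemma lcs_step m x y : y \in lie_lcs L m -> L x y \in lie_lcs L m.+1.
Proof.
move=> ym; rewrite (coord_vbasis (memvf x)) (coord_vbasis ym).
rewrite br_suml memv_suml // => i _; rewrite br_sumr memvZ // memv_suml // => j _.
by rewrite memvZ //= memv_span //; apply: allpairs_f; apply: mem_nth; rewrite size_tuple.
Qed.

(* Engel's theorem for the quotient of the adjoint representation by U. *)
Lemma nilpotent_escape (U : {vspace V}) : lie_nilpotent L -> ~~ (fullv <= U)%VS ->
  exists2 u, u \notin U & forall x, L x u \in U.
Proof.
move=> [n Ln] VU.
have : exists m, (lie_lcs L m <= U)%VS by exists n; rewrite Ln sub0v.
(* A vector outside U is taken from the last term of the lower central series that is not contained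
   in U; one more bracket enters U. *)
case/ex_minnP => -[|m] mU min; first by rewrite mU in VU.
have : ~~ (lie_lcs L m <= U)%VS by apply/negP => /min; rewrite ltnn.
case/subvPn => u um uU; exists u => // x.
by apply: (subvP mU); exact: lcs_step.
Qed.

Lemma ext_d2E (a : cochain V 2) x y z : is_form a ->
  ext_d L a [tuple x; y; z] =
    - a [tuple L x y; z] + a [tuple L x z; y] - a [tuple L y z; x].
Proof.
move=> fa; rewrite /ext_d.
pose F (i : 'I_2) (j : 'I_3) := a [tuple L (tnth [tuple x; y; z] (lift j i)) (tnth [tuple x; y; z] j);
  tnth [tuple x; y; z] (lift j (lift i ord0))].
transitivity (\sum_(j < 3) \sum_(i < 2 | (i < j)%N) (-1) ^+ (i + j) * F i j).
  apply: eq_bigr => j _; apply: eq_bigr => i _; congr (_ * a _).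
  by rewrite tuple_mk1; apply: val_inj.
rewrite !big_ord_recl !big_ord0 !(big_mkcond (fun i => leq _ _)) /= !big_ord_recl !big_ord0 /F.
rewrite !(tnth_nth 0); ord_norm; rewrite /= !addr0 !add0r.
by rewrite /= ?expr0 ?expr1; ring.
Qed.

End NilpotentLie.

(** * Coupled structures *)

(* Closes a goal equal, up to sign, to the equation on top of the goal. *)
Ltac by_equation := let H := fresh in let N := fresh in
  move=> /eqP; rewrite -subr_eq0 => /eqP H; have N := congr1 -%R H; rewrite oppr0 in N;
  apply/eqP; rewrite -subr_eq0; apply/eqP;
  first [rewrite -[RHS]H; ring | rewrite -[RHS]N; ring].

Section CoupledSU3.
Local Open Scope ring_scope.
Variables (R : realType) (V : vectType R).
Hypothesis d6 : \dim {:V}%VS = 6%N.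
Variables (nu : cochain V 6) (omega : cochain V 2) (sigma : cochain V 3).
Hypothesis su3 : SU3_structure nu omega sigma.

Let fo : is_form omega := SU3_form2 su3.
Let fs : is_form sigma := SU3_form3 su3.
Let J := J_end nu sigma.
Let h := assoc_metric nu omega sigma.

Lemma SU3_basis : exists2 e : 6.-tuple V, basis_of {:V} e & nu e != 0.
Proof.
have [fn [v nv]] := SU3_volume su3.
have [e be] : {e : 6.-tuple V | basis_of {:V} e}.
  by rewrite -d6; exists (vbasis {:V}); exact: vbasisP.
by exists e => //; exact: form_top_neq0 nv.
Qed.

Lemma SU3_JJ x : J (J x) = - x.
Proof.
have [fn _] := SU3_volume su3; have [e be ne] := SU3_basis.
exact: (J_endJ be fn ne fs (SU3_lambda su3)).
Qed.

Lemma SU3_Jsym : Jsym J sigma.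
Proof.
have [fn _] := SU3_volume su3; have [e be ne] := SU3_basis.
exact: (J_end_symm be fn ne fs).
Qed.

Lemma SU3_frame x : x != 0 ->
  exists y z, [/\ basis_of {:V} (frame J x y z), sigma [tuple x; y; z] = 1 &
    sigma [tuple J x; y; z] = 0].
Proof.
apply: (frame_exists SU3_JJ d6 fs SU3_Jsym).
apply: contrapT => /forallNP s0; have [e be ne] := SU3_basis.
have [fn _] := SU3_volume su3.
have := SU3_lambda su3; rewrite (lambdaE be fn ne fs) /kap_sq big1 ?mul0r ?ltxx // => j _.
have a0 i k l : alt_ext (coefs3 e sigma) i k l = 0.
  rewrite -coefs3E //; apply/eqP; apply: contrapT => /negP; exact: s0.
by rewrite /kap; case: (others j) => [[[[p0 p1] p2] p3] p4]; rewrite !a0 !(mul0r, subr0, addr0, mulr0).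
Qed.

(* The (2,0)-part of omega is detected by the 5-form omega /\ sigma. *)
Lemma SU3_omegaJ x y : omega [tuple J x; J y] = omega [tuple x; y].
Proof.
have [->|x0] := eqVneq x 0; first by rewrite linear0 !form2_0l.
have [p [q [be s1 s0]]] := SU3_frame x0.
have Js := SU3_Jsym.
have S2 u v w : sigma [tuple u; J v; w] = sigma [tuple J u; v; w] by rewrite Js.
have S3 u v w : sigma [tuple u; v; J w] = sigma [tuple J u; v; w] by rewrite Jsym13.
have P u w : sigma [tuple J u; u; w] = 0 by exact: Jsym_pair.
have s1' : sigma [tuple x; q; p] = -1 by rewrite form3_anti23 // s1.
have s0' : sigma [tuple J x; q; p] = 0 by rewrite form3_anti23 // s0 oppr0.
have W := SU3_compatible su3.
(* On x, Jx, one of the complex lines of p and q, and one vector of the other, the 5-form reduces to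
   a single instance of the claim: E1 to E4 give it for y = p, Jp, q, Jq. *)
have E1 := W [tuple x; J x; p; J p; q]; have E2 := W [tuple x; J x; p; J p; J q].
have E3 := W [tuple x; J x; q; J q; p]; have E4 := W [tuple x; J x; q; J q; J p].
rewrite wedge23E // in E1; rewrite wedge23E // in E2.
rewrite wedge23E // in E3; rewrite wedge23E // in E4.
rewrite !(S3, S2) !SU3_JJ !(form3_N1, P, form3_alt12, form3_alt23) // s1 s0 in E1.
rewrite !(S3, S2) !SU3_JJ !(form3_N1, P, form3_alt12, form3_alt23) // s1 s0 in E2.
rewrite !(S3, S2) !SU3_JJ !(form3_N1, P, form3_alt12, form3_alt23) // s1' s0' in E3.
rewrite !(S3, S2) !SU3_JJ !(form3_N1, P, form3_alt12, form3_alt23) // s1' s0' in E4.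
have lphi c u v : omega [tuple J x; J (c *: u + v)] - omega [tuple x; c *: u + v] =
    c * (omega [tuple J x; J u] - omega [tuple x; u]) + (omega [tuple J x; J v] - omega [tuple x; v]).
  by rewrite linearP !form2_linr //; ring.
apply/eqP; rewrite -subr_eq0 (coordE be y) (scalar_sum _ _ lphi) big1 // => i _.
apply/eqP; rewrite mulf_eq0; apply/orP; right; apply/eqP.
case: i => i hi; do 6?[case: i hi => [|i] hi //]; rewrite /= ?SU3_JJ ?form2_Nr ?form2_alt //.
- by rewrite subrr.
- by rewrite -form2_anti // subrr.
- by move: E1; by_equation.
- by move: E2; by_equation.
- by move: E3; by_equation.
- by move: E4; by_equation.
Qed.

Lemma SU3_h_linr x c y z : h x (c *: y + z) = c * h x y + h x z.
Proof. exact: form2_linr. Qed.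

Lemma SU3_h_linl x c y z : h (c *: y + z) x = c * h y x + h z x.
Proof. by rewrite /h /assoc_metric linearP form2_linl. Qed.

Lemma SU3_hC x y : h y x = h x y.
Proof. by rewrite /h /assoc_metric -SU3_omegaJ -/J SU3_JJ form2_Nl // -form2_anti. Qed.

Lemma SU3_hJ x y : h (J x) (J y) = h x y.
Proof. exact: SU3_omegaJ. Qed.

Lemma SU3_hxJx x : h x (J x) = 0.
Proof. exact: form2_alt. Qed.

Lemma SU3_h_gt0 x : x != 0 -> 0 < h x x.
Proof. exact: (SU3_positive su3). Qed.

End CoupledSU3.

(** * Central elements and the adapted unitary frame *)

Section CoupledStructure.
Local Open Scope ring_scope.
Variables (R : realType) (V : vectType R) (L : lie_algebra V).
Hypothesis d6 : \dim {:V}%VS = 6%N.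
Hypothesis nilL : lie_nilpotent L.
Variables (nu : cochain V 6) (omega : cochain V 2) (sigma : cochain V 3).
Hypothesis su3 : SU3_structure nu omega sigma.
Variable c : R.
Hypothesis c0 : c != 0.
Hypothesis cpl : forall v, ext_d L omega v = c * sigma v.

Let fo : is_form omega := SU3_form2 su3.
Let fs : is_form sigma := SU3_form3 su3.
Let J := J_end nu sigma.
Let h := assoc_metric nu omega sigma.
Let JJ := SU3_JJ d6 su3.
Let Js := SU3_Jsym d6 su3.

Lemma coupledE x y z : c * sigma [tuple x; y; z] =
  - omega [tuple L x y; z] + omega [tuple L x z; y] - omega [tuple L y z; x].
Proof. by rewrite -cpl ext_d2E. Qed.

Lemma h0l y : h 0 y = 0.
Proof. exact: (law0 (f := fun t => h t y) (fun c x z => SU3_h_linl su3 y c x z)). Qed.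

Lemma hZl a x y : h (a *: x) y = a * h x y.
Proof. exact: (lawZ (f := fun t => h t y) (fun c x z => SU3_h_linl su3 y c x z)). Qed.

Lemma hDl x z y : h (x + z) y = h x y + h z y.
Proof. exact: (lawD (f := fun t => h t y) (fun c x z => SU3_h_linl su3 y c x z)). Qed.

Lemma hNl x y : h (- x) y = - h x y.
Proof. exact: (lawN (f := fun t => h t y) (fun c x z => SU3_h_linl su3 y c x z)). Qed.

Lemma hC x y : h y x = h x y. Proof. exact: SU3_hC. Qed.
Lemma hJ x y : h (J x) (J y) = h x y. Proof. exact: SU3_hJ. Qed.
Lemma hxJ x : h x (J x) = 0. Proof. exact: (SU3_hxJx su3). Qed.
Lemma hJx x : h (J x) x = 0. Proof. by rewrite hC hxJ. Qed.
Lemma hZr a x y : h y (a *: x) = a * h y x. Proof. by rewrite hC hZl hC. Qed.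
Lemma hDr x z y : h y (x + z) = h y x + h y z. Proof. by rewrite hC hDl !(hC _ y). Qed.
Lemma hNr x y : h y (- x) = - h y x. Proof. by rewrite hC hNl hC. Qed.
Lemma hJl x y : h (J x) y = - h x (J y).
Proof. by rewrite -[LHS]hJ JJ hNl. Qed.

Lemma normalize x : x != 0 -> exists2 a, 0 < a & h (a *: x) (a *: x) = 1.
Proof.
move=> /(SU3_h_gt0 su3) hx; exists (Num.sqrt (h x x))^-1.
  by rewrite invr_gt0 sqrtr_gt0.
rewrite hZl hZr mulrA -invfM -expr2 sqr_sqrtr ?ltW // mulVf ?gt_eqF //.
Qed.

Lemma basis6E (e0 e1 e2 e3 e4 e5 : V) w :
  basis_of {:V} [tuple e0; e1; e2; e3; e4; e5] -> exists a0 a1 a2 a3 a4 a5,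
    w = a0 *: e0 + (a1 *: e1 + (a2 *: e2 + (a3 *: e3 + (a4 *: e4 + a5 *: e5)))).
Proof.
move=> be; have := coordE be w; rewrite !big_ord_recl big_ord0 addr0 /= => ->.
by do 6!eexists.
Qed.

(* If z is central and w is central modulo z, then c sigma(z, w, .) vanishes
   and hence w lies on the complex line of z. *)
Lemma sigma_kernel z w : z != 0 -> (forall y, sigma [tuple z; w; y] = 0) ->
  exists a b, w = a *: z + b *: J z.
Proof.
move=> z0 zw; have [p [q [be s1 s0]]] := SU3_frame d6 su3 z0.
have S2 u v w' : sigma [tuple u; J v; w'] = sigma [tuple J u; v; w'] by rewrite Js.
have S3 u v w' : sigma [tuple u; v; J w'] = sigma [tuple J u; v; w'] by exact: Jsym13.
have P u w' : sigma [tuple J u; u; w'] = 0 by exact: (Jsym_pair _ _ fs Js).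
have s1' : sigma [tuple z; q; p] = -1 by rewrite form3_anti23 // s1.
have s0' : sigma [tuple J z; q; p] = 0 by rewrite form3_anti23 // s0 oppr0.
have [a0 [a1 [a2 [a3 [a4 [a5 ew]]]]]] := basis6E w be.
(* On q, Jq, p, Jp, the functional sigma(z, w, .) takes the values a2, a3, a4, a5 up to sign. *)
have E1 := zw q; have E2 := zw (J q); have E3 := zw p; have E4 := zw (J p).
rewrite S3 in E2; rewrite S3 in E4.
rewrite ew !form3_D2 // !form3_Z2 // !S2 ?JJ ?form3_N1 // !(P, form3_alt12, form3_alt23) // s1 s0 in E1.
rewrite ew !form3_D2 // !form3_Z2 // !S2 ?JJ ?form3_N1 // !(P, form3_alt12, form3_alt23) // s1 s0 in E2.
rewrite ew !form3_D2 // !form3_Z2 // !S2 ?JJ ?form3_N1 // !(P, form3_alt12, form3_alt23)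
  // s1' s0' in E3.
rewrite ew !form3_D2 // !form3_Z2 // !S2 ?JJ ?form3_N1 // !(P, form3_alt12, form3_alt23)
  // s1' s0' in E4.
have a20 : a2 = 0 by lra.
have a30 : a3 = 0 by lra.
have a40 : a4 = 0 by lra.
have a50 : a5 = 0 by lra.
by exists a0, a1; rewrite ew a20 a30 a40 a50 !scale0r !addr0.
Qed.

(** Orthonormality for the Hermitian form with real part h; the remaining products within
    [frame J z u v] follow from the J-invariance of h. *)
Definition orthonormal_frame (z u v : V) : Prop :=
  [/\ h z z = 1, h u u = 1, h v v = 1, h z u = 0 /\ h z (J u) = 0 &
      (h z v = 0 /\ h z (J v) = 0) /\ (h u v = 0 /\ h u (J v) = 0)].

Lemma orthonormal_basis z u v : orthonormal_frame z u v ->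
  let e := frame J z u v in
  basis_of {:V} e /\ forall i x, coord e i x = h e`_i x.
Proof.
move=> [hz hu hv [a1 a2] [[b1 b2] [c1 c2]]] /=.
apply: (dual_basis (phi := fun i x => h (frame J z u v)`_i x) d6) => [i|i j].
  exact: SU3_h_linr.
have H := (hz, hu, hv, (a1, a2), (b1, b2), (c1, c2)).
case: i j => [i hi] [j hj].
do 6?[case: i hi => [|i] hi //]; do 6?[case: j hj => [|j] hj //]; rewrite /= ?hJ ?hxJ ?hJx ?H //;
  first [by rewrite hJl ?JJ ?hNr ?H ?oppr0 | by rewrite hC ?H | by rewrite hC hJ
    ?H | by rewrite hC hJl ?H ?oppr0].
Qed.

(** Engel's theorem is applied to 0, giving z, and then to <z>, giving some w central modulo z. As w
    lies in <z, Jz> but outside <z>, the property passes from w to Jz. *)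
Lemma coupled_central_line : exists z, [/\ h z z = 1, forall y, L z y = 0 &
  forall y, exists a, L (J z) y = a *: z].
Proof.
have V0 : ~~ ({:V} <= (0%VS : {vspace V}))%VS by rewrite subv0 -dimv_eq0 d6.
have [z1 z10 cz1] := nilpotent_escape nilL V0.
rewrite memv0 in z10; have [b b0 hz] := normalize z10.
pose z := b *: z1.
have z0 : z != 0 by rewrite scaler_eq0 negb_or (gt_eqF b0).
have cz y : L z y = 0.
  have := cz1 y; rewrite memv0 brC oppr_eq0 => /eqP zy.
  by rewrite /z brZl zy scaler0.
rewrite -/z in hz; clearbody z.
exists z; split=> // y.
have Vz : ~~ ({:V} <= <[z]>)%VS.
  apply/negP => /dimvS; rewrite d6 => /leq_trans - /(_ 1%N).
  by rewrite dim_vline z0 => /(_ isT).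
have [w wz cw] := nilpotent_escape nilL Vz.
have cw' t : exists a, L w t = a *: z.
  have /vlineP[a ea] := cw t; exists (- a).
  by rewrite brC ea scaleNr.
(* The brackets with z vanish, and [w, t] is a multiple of z, whose pairing with z is zero. *)
have [t|a [a' ew]] := @sigma_kernel z w z0.
  apply: (mulfI c0); rewrite coupledE !cz !form2_0l //.
  by have [a ->] := cw' t; rewrite form2_Zl // form2_alt //; ring.
have a'0 : a' != 0.
  by apply: contraNneq wz => a'0; rewrite ew a'0 scale0r addr0 memvZ ?memv_line.
have [d ed] := cw' y; exists (a'^-1 * d).
by rewrite -scalerA -ed ew brDl !brZl cz scaler0 add0r scalerA mulVf // scale1r.
Qed.

(** A third use of Engel's theorem, modulo <z, Jz>, gives u. The vector v spans the orthogonal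
    complex line, and its phase is then fixed by sigma. *)
Lemma coupled_frame : exists z u v k,
  [/\ orthonormal_frame z u v, forall y, L z y = 0, forall y, exists a, L (J z) y = a *: z,
      forall y, exists a b, L u y = a *: z + b *: J z &
      [/\ k != 0, sigma [tuple z; u; v] = k & sigma [tuple J z; u; v] = 0]].
Proof.
have [z [hz cz cJz]] := coupled_central_line.
have z0 : z != 0 by apply/eqP => z0; move: hz; rewrite z0 h0l => /eqP; rewrite eq_sym oner_eq0.
have hJz : h (J z) (J z) = 1 by rewrite hJ.
have VU : ~~ ({:V} <= <<[:: z; J z]>>)%VS.
  apply/negP => /dimvS; rewrite d6 => h6.
  by have := leq_trans h6 (dim_span _).
have [u1 u1U cu1] := nilpotent_escape nilL VU.
have zU : z \in <<[:: z; J z]>>%VS by apply: memv_span; rewrite inE eqxx.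
have JzU : J z \in <<[:: z; J z]>>%VS by apply: memv_span; rewrite !inE eqxx orbT.
(* The orthogonal projection changes u1 by a combination of z and Jz, whose brackets lie in <z>; u2
   is therefore still central modulo <z, Jz>. *)
pose u2 := u1 - (h u1 z *: z + h u1 (J z) *: J z).
have u20 : u2 != 0.
  by apply: contraNneq u1U => /eqP; rewrite subr_eq0 => /eqP ->; rewrite memvD ?memvZ.
have hu2 : h z u2 = 0 /\ h z (J u2) = 0.
  have e1 : h u2 z = 0 by rewrite /u2 hDl hNl hDl !hZl hz hJx; ring.
  have e2 : h u2 (J z) = 0 by rewrite /u2 hDl hNl hDl !hZl hJz hxJ; ring.
  by rewrite hC e1 -[h z _]opprK -hJl hC e2 oppr0.
have [b b0 hu] := normalize u20; pose u := b *: u2.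
have [hzu hzJu] : h z u = 0 /\ h z (J u) = 0.
  by case: hu2 => e1 e2; rewrite /u linearZ /= !hZr e1 e2 mulr0.
have cu y : exists a b, L u y = a *: z + b *: J z.
  have : L u y \in <<[:: z; J z]>>%VS.
    rewrite /u brZl memvZ // /u2 brDl memvD //.
      by rewrite brC memvN cu1.
    rewrite -scaleN1r brZl memvZ // brDl !brZl cz scaler0 add0r memvZ //.
    by have [d ->] := cJz y; rewrite memvZ.
  rewrite span_cons span_seq1 => /memv_addP[_ /vlineP[p ->] [_ /vlineP[q ->] ->]].
  by exists p, q.
rewrite -/u in hu; clearbody u.
pose t := [tuple z; J z; u; J u].
have d4 : (4 < \dim {:V}%VS)%N by rewrite d6.
have [v1 v10 hv1] := @common_kernel _ _ 4 (fun i x => h (tnth t i) x) d4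
  (fun i c x y => SU3_h_linr su3 (tnth t i) c x y).
have e0 : h z v1 = 0 := hv1 ord0.
have e1 : h (J z) v1 = 0 := hv1 (@Ordinal 4 1 isT).
have e2 : h u v1 = 0 := hv1 (@Ordinal 4 2 isT).
have e3 : h (J u) v1 = 0 := hv1 (@Ordinal 4 3 isT).
have e1' : h z (J v1) = 0 by rewrite -[h _ _]opprK -hJl e1 oppr0.
have e3' : h u (J v1) = 0 by rewrite -[h _ _]opprK -hJl e3 oppr0.
have [b' b'0 hv] := normalize v10; pose v := b' *: v1.
have [hzv hzJv] : h z v = 0 /\ h z (J v) = 0.
  by rewrite /v linearZ /= !hZr e0 e1' mulr0.
have [huv huJv] : h u v = 0 /\ h u (J v) = 0.
  by rewrite /v linearZ /= !hZr e2 e3' mulr0.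
rewrite -/v in hv; clearbody v.
have of1 : orthonormal_frame z u v by [].
pose p := sigma [tuple z; u; v]; pose q := sigma [tuple J z; u; v].
have pq : 0 < p ^+ 2 + q ^+ 2.
  rewrite lt_neqAle addr_ge0 ?sqr_ge0 // andbT eq_sym paddr_eq0 ?sqr_ge0 // !sqrf_eq0.
  apply/negP => /andP[/eqP p0 /eqP q0].
  have [be _] := orthonormal_basis of1.
  have [y [w [_ s1 _]]] := SU3_frame d6 su3 z0.
  by have /eqP := oner_neq0 R; rewrite -s1 (frame_zero JJ be fs Js p0 q0).
pose r := Num.sqrt (p ^+ 2 + q ^+ 2).
have r0 : r != 0 by rewrite gt_eqF // sqrtr_gt0.
have rr : r * r = p * p + q * q by rewrite -expr2 sqr_sqrtr ?ltW // !expr2.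
(* In complex terms sigma(z, u, v) is the real part of p - iq. Multiplying v by the unit number (p +
   iq) / r turns this value into its modulus r. *)
exists z, u, ((p / r) *: v + (q / r) *: J v), r; split=> //; last first.
  split=> //.
    rewrite form3_D3 // !form3_Z3 // (Jsym13 _ _ _ fs Js) -/p -/q.
    by apply: (mulIf r0); rewrite rr; field.
  rewrite form3_D3 // !form3_Z3 // (Jsym13 _ _ _ fs Js) JJ form3_N1 // -/p -/q.
  by field.
have JE : J ((p / r) *: v + (q / r) *: J v) = (p / r) *: J v - (q / r) *: v.
  by rewrite linearD !linearZ /= JJ scalerN.
rewrite /orthonormal_frame JE !hDr !hDl !hNr !hZr !hZl hJ hJx hxJ hzv hzJv huv huJv.
have -> : h v v = 1 by [].
split=> //; last by split; split; ring.
apply: (mulIf (mulf_neq0 r0 r0)); rewrite mul1r.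
transitivity (p * p + q * q); last by rewrite rr.
by field.
Qed.

End CoupledStructure.

(** * Structure equations in the adapted frame *)

Section CoupledBrackets.
Local Open Scope ring_scope.
Variables (R : realType) (V : vectType R) (L : lie_algebra V).

(* Structure equations of a coupled nilpotent Lie algebra in a basis adapted to
   the SU(3)-structure. *)
Definition coupled_brackets (e : 6.-tuple V) (k s t : R) : Prop :=
  let x i v := coord e (inord i) v in
  let x2 i j v w := x i v * x j w - x j v * x i w in
  forall v w,
  [/\ x 0%N (L v w) = - s * x2 1%N 3%N v w - t * x2 1%N 4%N v w
                      - k * (x2 2%N 5%N v w + x2 3%N 4%N v w),
      x 1%N (L v w) = - k * (x2 2%N 4%N v w - x2 3%N 5%N v w),
      x 2%N (L v w) = t * x2 3%N 4%N v w,
      x 3%N (L v w) = 0 /\ x 4%N (L v w) = 0 &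
      x 5%N (L v w) = s * x2 3%N 4%N v w].

Hypothesis d6 : \dim {:V}%VS = 6%N.
Hypothesis nilL : lie_nilpotent L.
Variables (nu : cochain V 6) (omega : cochain V 2) (sigma : cochain V 3).
Hypothesis su3 : SU3_structure nu omega sigma.
Variable c : R.
Hypothesis c0 : c != 0.
Hypothesis cpl : forall v, ext_d L omega v = c * sigma v.
Let h := assoc_metric nu omega sigma.
Let J := J_end nu sigma.

Lemma structure_constants (e : 6.-tuple V) : basis_of {:V} e ->
  exists C : nat -> nat -> nat -> R,
  [/\ forall i j k, C i j k = coord e (inord k) (L e`_i e`_j),
      forall i j k, C j i k = - C i j k,
      forall i j k n,
       \sum_(m < 6) (C j k m * C i m n + C k i m * C j m n + C i j m * C k m n) = 0 &
      forall v w n, coord e (inord n) (L v w) =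
        \sum_(i < 6) \sum_(j < 6) coord e (inord i) v * coord e (inord j) w * C i j n].
Proof.
move=> be; pose C (i j k : nat) : R := coord e (inord k) (L e`_i e`_j); exists C.
have E x y : L x y = \sum_(m < 6) coord e (inord m) (L x y) *: e`_m.
  by rewrite {1}(coordE be (L x y)); apply: eq_bigr => m _; rewrite inord_val.
split=> // [i j k|i j k n|v w n].
- by rewrite /C brC linearN.
- have := congr1 (coord e (inord n)) (lie_jacobi L e`_i e`_j e`_k).
  rewrite (E e`_j) (E e`_k e`_i) (E e`_i e`_j) !br_sumr linear0 !linearD !linear_sum /=.
  rewrite -!big_split /= => H; rewrite -[RHS]H; apply: eq_bigr => m _.
  by rewrite !linearZ.
rewrite {1}(coordE be v) br_suml linear_sum; apply: eq_bigr => i _.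
rewrite {1}(coordE be w) br_sumr linearZ /= linear_sum mulr_sumr; apply: eq_bigr => j _.
by rewrite linearZ /= mulrA !inord_val.
Qed.

(** With e = (z, Jz, u, Ju, v, Jv), the unknowns are the structure constants; the coupled equation
    is linear in them, and the Jacobi identity is used component by component. *)
Lemma coupled_structure : exists (e : 6.-tuple V) (k s t : R),
  [/\ basis_of {:V} e, forall i x, coord e i x = h e`_i x, k != 0 & coupled_brackets e k s t].
Proof.
have [z [u [v [r [of1 cz cJz cu [r0 s1 s0]]]]]] := coupled_frame d6 nilL su3 c0 cpl.
have [be ce] := orthonormal_basis d6 su3 of1.
set e := frame _ _ _ _ in be ce.
have [C [CD CA CJ CE]] := structure_constants be.
have JJ := SU3_JJ d6 su3; have Js := SU3_Jsym d6 su3.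
have fs := SU3_form3 su3; have fo := SU3_form2 su3.
pose X k y := coord e (inord k) y.
have ce' k y : (k < 6)%N -> X k y = h e`_k y by move=> hk; rewrite /X ce inordK.
(* Since h = omega(J ., .), pairing with a basis vector reads the coordinate along its J-partner,
   with a sign. *)
have w0 y : omega [tuple y; e`_0] = X 1%N y.
  by rewrite ce' // /h /assoc_metric /= JJ form2_Nl // -form2_anti.
have w1 y : omega [tuple y; e`_1] = - X 0%N y.
  by rewrite ce' // /h /assoc_metric /= -form2_anti.
have w2 y : omega [tuple y; e`_2] = X 3%N y.
  by rewrite ce' // /h /assoc_metric /= JJ form2_Nl // -form2_anti.
have w3 y : omega [tuple y; e`_3] = - X 2%N y.
  by rewrite ce' // /h /assoc_metric /= -form2_anti.
have w4 y : omega [tuple y; e`_4] = X 5%N y.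
  by rewrite ce' // /h /assoc_metric /= JJ form2_Nl // -form2_anti.
have w5 y : omega [tuple y; e`_5] = - X 4%N y.
  by rewrite ce' // /h /assoc_metric /= -form2_anti.
have cp i j k := coupledE su3 cpl e`_i e`_j e`_k.
have S2 x y w : sigma [tuple x; J y; w] = sigma [tuple J x; y; w] by rewrite Js.
have S3 x y w : sigma [tuple x; y; J w] = sigma [tuple J x; y; w] by exact: Jsym13.
have P x w : sigma [tuple J x; x; w] = 0 by exact: (Jsym_pair _ _ fs Js).
have EX i j k : X k (L e`_i e`_j) = C i j k by rewrite CD.
have e_dual i j : (i < 6)%N -> (j < 6)%N -> X i e`_j = (i == j)%:R.
  move=> hi hj; rewrite /X; have := coord_e be (inord i) (inord j).
  by rewrite -val_eqE /= !inordK.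
have C0 j k : C 0%N j k = 0 by rewrite CD cz linear0.
have C0' j k : C j 0%N k = 0 by rewrite CA C0 oppr0.
have Cd i k : C i i k = 0 by rewrite CD lie_alternating linear0.
have C1 j k : (0 < k < 6)%N -> C 1%N j k = 0.
  case/andP => k0 k6; rewrite CD; have [a ->] := cJz e`_j.
  by rewrite linearZ /= -[z]/(e`_0) -/(X k _) e_dual // gtn_eqF ?mulr0.
have C2 j k : (1 < k < 6)%N -> C 2%N j k = 0.
  case/andP => k0 k6; rewrite CD; have [a [b ->]] := cu e`_j.
  rewrite linearD !linearZ /= -[z]/(e`_0) -[J_end _ _ _]/(e`_1) -!/(X k _) !e_dual //.
  by rewrite !gtn_eqF ?mulr0 ?addr0 // ltnW.
have F i j k : (j < i)%N -> C i j k = - C j i k by move=> _; exact: CA.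
have C11 j := C1 j 1%N isT.
have C12 j := C1 j 2%N isT.
have C13 j := C1 j 3%N isT.
have C14 j := C1 j 4%N isT.
have C15 j := C1 j 5%N isT.
have C22 j := C2 j 2%N isT.
have C23 j := C2 j 3%N isT.
have C24 j := C2 j 4%N isT.
have C25 j := C2 j 5%N isT.
have F21 k := F 2%N 1%N k isT.
have F31 k := F 3%N 1%N k isT.
have F41 k := F 4%N 1%N k isT.
have F51 k := F 5%N 1%N k isT.
have F32 k := F 3%N 2%N k isT.
have F42 k := F 4%N 2%N k isT.
have F52 k := F 5%N 2%N k isT.
have F43 k := F 4%N 3%N k isT.
have F53 k := F 5%N 3%N k isT.
have F54 k := F 5%N 4%N k isT.
pose T0 := (C0, C0', Cd, (C11, C12, C13, C14, C15), (C22, C23, C24, C25),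
  (F21, F31, F41, F51, F32, F42, F52, F43, F53, F54)).
pose q := c * r.
have q0 : q != 0 by rewrite mulf_neq0.
(* The triples (0, i, j) and (1, i, j) with i, j > 1 give the components of [e_i, e_j] along e_1 and
   e_0: the other two brackets are multiples of e_0, which pairs to zero with e_2, ..., e_5. *)
have C231 : C 2%N 3%N 1%N = 0.
  by have := cp 0%N 2%N 3%N;
    rewrite !(w0, w1, w2, w3, w4, w5) !EX !T0 /e /= ?S3 ?S2 ?JJ ?form3_N1 ?P ?form3_alt12
    ?form3_alt23 ?s1 ?s0 //; rewrite /q; by_equation.
have C230 : C 2%N 3%N 0%N = 0.
  by have := cp 1%N 2%N 3%N;
    rewrite !(w0, w1, w2, w3, w4, w5) !EX !T0 /e /= ?S3 ?S2 ?JJ ?form3_N1 ?P ?form3_alt12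
    ?form3_alt23 ?s1 ?s0 //; rewrite /q; by_equation.
have C241 : C 2%N 4%N 1%N = - q.
  by have := cp 0%N 2%N 4%N;
    rewrite !(w0, w1, w2, w3, w4, w5) !EX !T0 /e /= ?S3 ?S2 ?JJ ?form3_N1 ?P ?form3_alt12
    ?form3_alt23 ?s1 ?s0 //; rewrite /q; by_equation.
have C240 : C 2%N 4%N 0%N = 0.
  by have := cp 1%N 2%N 4%N;
    rewrite !(w0, w1, w2, w3, w4, w5) !EX !T0 /e /= ?S3 ?S2 ?JJ ?form3_N1 ?P ?form3_alt12
    ?form3_alt23 ?s1 ?s0 //; rewrite /q; by_equation.
have C251 : C 2%N 5%N 1%N = 0.
  by have := cp 0%N 2%N 5%N;
    rewrite !(w0, w1, w2, w3, w4, w5) !EX !T0 /e /= ?S3 ?S2 ?JJ ?form3_N1 ?P ?form3_alt12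
    ?form3_alt23 ?s1 ?s0 //; rewrite /q; by_equation.
have C250 : C 2%N 5%N 0%N = - q.
  by have := cp 1%N 2%N 5%N;
    rewrite !(w0, w1, w2, w3, w4, w5) !EX !T0 /e /= ?S3 ?S2 ?JJ ?form3_N1 ?P ?form3_alt12
    ?form3_alt23 ?s1 ?s0 //; rewrite /q; by_equation.
have C341 : C 3%N 4%N 1%N = 0.
  by have := cp 0%N 3%N 4%N;
    rewrite !(w0, w1, w2, w3, w4, w5) !EX !T0 /e /= ?S3 ?S2 ?JJ ?form3_N1 ?P ?form3_alt12
    ?form3_alt23 ?s1 ?s0 //; rewrite /q; by_equation.
have C340 : C 3%N 4%N 0%N = - q.
  by have := cp 1%N 3%N 4%N;
    rewrite !(w0, w1, w2, w3, w4, w5) !EX !T0 /e /= ?S3 ?S2 ?JJ ?form3_N1 ?P ?form3_alt12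
    ?form3_alt23 ?s1 ?s0 //; rewrite /q; by_equation.
have C351 : C 3%N 5%N 1%N = q.
  by have := cp 0%N 3%N 5%N;
    rewrite !(w0, w1, w2, w3, w4, w5) !EX !T0 /e /= ?S3 ?S2 ?JJ ?form3_N1 ?P ?form3_alt12
    ?form3_alt23 ?s1 ?s0 //; rewrite /q; by_equation.
have C350 : C 3%N 5%N 0%N = 0.
  by have := cp 1%N 3%N 5%N;
    rewrite !(w0, w1, w2, w3, w4, w5) !EX !T0 /e /= ?S3 ?S2 ?JJ ?form3_N1 ?P ?form3_alt12
    ?form3_alt23 ?s1 ?s0 //; rewrite /q; by_equation.
have C451 : C 4%N 5%N 1%N = 0.
  by have := cp 0%N 4%N 5%N;
    rewrite !(w0, w1, w2, w3, w4, w5) !EX !T0 /e /= ?S3 ?S2 ?JJ ?form3_N1 ?P ?form3_alt12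
    ?form3_alt23 ?s1 ?s0 //; rewrite /q; by_equation.
have C450 : C 4%N 5%N 0%N = 0.
  by have := cp 1%N 4%N 5%N;
    rewrite !(w0, w1, w2, w3, w4, w5) !EX !T0 /e /= ?S3 ?S2 ?JJ ?form3_N1 ?P ?form3_alt12
    ?form3_alt23 ?s1 ?s0 //; rewrite /q; by_equation.
(* In a triple containing e_2, the brackets with e_2 lie in <e_0, e_1> and pair to zero with the
   others; what is left is the component along e_3. The triple (3, 4, 5) gives only the relation
   [K345]. *)
have C343 : C 3%N 4%N 3%N = 0.
  by have := cp 2%N 3%N 4%N;
    rewrite !(w0, w1, w2, w3, w4, w5) !EX !T0 /e /= ?S3 ?S2 ?JJ ?form3_N1 ?P ?form3_alt12
    ?form3_alt23 ?s1 ?s0 //; by_equation.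
have C353 : C 3%N 5%N 3%N = 0.
  by have := cp 2%N 3%N 5%N;
    rewrite !(w0, w1, w2, w3, w4, w5) !EX !T0 /e /= ?S3 ?S2 ?JJ ?form3_N1 ?P ?form3_alt12
    ?form3_alt23 ?s1 ?s0 //; by_equation.
have C453 : C 4%N 5%N 3%N = 0.
  by have := cp 2%N 4%N 5%N;
    rewrite !(w0, w1, w2, w3, w4, w5) !EX !T0 /e /= ?S3 ?S2 ?JJ ?form3_N1 ?P ?form3_alt12
    ?form3_alt23 ?s1 ?s0 //; by_equation.
have K345 : C 3%N 4%N 4%N + C 3%N 5%N 5%N + C 4%N 5%N 2%N = 0.
  by have := cp 3%N 4%N 5%N;
    rewrite !(w0, w1, w2, w3, w4, w5) !EX /e /= ?S3 ?S2 ?JJ ?form3_N1 ?P ?form3_alt12 ?form3_alt23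
    ?s1 ?s0 //; by_equation.
pose T1 := (T0, (C231, C241, C251, C341, C351, C451), (C230, C240, C250, C340, C350, C450),
  C343, C353, C453).
(* The bracket with e_2 turns the coordinates along e_4 and e_5 into components along e_1 and e_0
   with the factor -q. Dividing by q expresses these coordinates through the brackets of e_1. *)
have C344 : C 3%N 4%N 4%N = 0.
  by apply: (mulfI q0); have := CJ 2%N 3%N 4%N 1%N; rewrite !big_ord_recl big_ord0; ord_norm;
    rewrite !T1; by_equation.
have C130 : C 1%N 3%N 0%N = - C 3%N 4%N 5%N.
  by apply: (mulfI q0); have := CJ 2%N 3%N 4%N 0%N; rewrite !big_ord_recl big_ord0; ord_norm;
    rewrite !T1; by_equation.
have C354 : C 3%N 5%N 4%N = 0.
  by apply: (mulfI q0); have := CJ 2%N 3%N 5%N 1%N; rewrite !big_ord_recl big_ord0; ord_norm;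
    rewrite !T1; by_equation.
have C355 : C 3%N 5%N 5%N = - C 1%N 2%N 0%N.
  by apply: (mulfI q0); have := CJ 2%N 3%N 5%N 0%N; rewrite !big_ord_recl big_ord0; ord_norm;
    rewrite !T1; by_equation.
have C454 : C 4%N 5%N 4%N = 0.
  by apply: (mulfI q0); have := CJ 2%N 4%N 5%N 1%N; rewrite !big_ord_recl big_ord0; ord_norm;
    rewrite !T1; by_equation.
have C455 : C 4%N 5%N 5%N = C 1%N 5%N 0%N.
  by apply: (mulfI q0); have := CJ 2%N 4%N 5%N 0%N; rewrite !big_ord_recl big_ord0; ord_norm;
    rewrite !T1; by_equation.
have C452 : C 4%N 5%N 2%N = C 1%N 2%N 0%N by move: K345; rewrite C344 C355; by_equation.
(* Now [e_4, e_5] = C120 e_2 + C150 e_5, and its bracket with e_1 is (C120^2 + C150^2) e_0. The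
   other two Jacobi terms vanish, because [e_1, .] lies in the central line <e_0>. *)
have /eqP : C 1%N 2%N 0%N ^+ 2 + C 1%N 5%N 0%N ^+ 2 = 0.
  by have := CJ 1%N 4%N 5%N 0%N; rewrite !big_ord_recl big_ord0; ord_norm;
    rewrite !T1 C452 C455 C454; by_equation.
rewrite paddr_eq0 ?sqr_ge0 // !sqrf_eq0 => /andP[/eqP C120 /eqP C150].
rewrite C120 ?oppr0 in C355 C452; rewrite C150 in C455.
have C352 : C 3%N 5%N 2%N = 0.
  by apply: (mulfI q0); have := CJ 3%N 4%N 5%N 1%N; rewrite !big_ord_recl big_ord0; ord_norm;
    rewrite !T1 ?(C344, C354, C355, C454, C455, C452); by_equation.
have C140 : C 1%N 4%N 0%N = - C 3%N 4%N 2%N.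
  by apply: (mulfI q0); have := CJ 3%N 4%N 5%N 0%N; rewrite !big_ord_recl big_ord0; ord_norm;
    rewrite !T1 ?(C344, C354, C355, C454, C455, C452); by_equation.
(* The surviving parameters s and t are the components of [Ju, v] along Jv and u; k is q = c r. *)
exists e, q, (C 3%N 4%N 5%N), (C 3%N 4%N 2%N); split=> //.
pose T2 := (T1, (C344, C354, C355, C454, C455, C452, C352), (C120, C150, C130, C140)).
move=> v' w' /=.
pose d i j := X i v' * X j w' - X j v' * X i w'.
have CE' n : X n (L v' w') =
      d 1 2 * C 1%N 2%N n + d 1 3 * C 1%N 3%N n +
      d 1 4 * C 1%N 4%N n + d 1 5 * C 1%N 5%N n +
      d 2 3 * C 2%N 3%N n + d 2 4 * C 2%N 4%N n +
      d 2 5 * C 2%N 5%N n + d 3 4 * C 3%N 4%N n +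
      d 3 5 * C 3%N 5%N n + d 4 5 * C 4%N 5%N n.
  by rewrite /X CE !big_ord_recl !big_ord0; ord_norm;
    rewrite !(C0, C0', Cd) !(F21, F31, F41, F51, F32, F42, F52, F43, F53, F54) /d /X; ring.
rewrite -!/(X _ _) !CE' !T2 /d.
by split; first 3 last; first split; ring.
Qed.

End CoupledBrackets.

(** * Identification with n9 and n28 *)

Section Isomorphisms.
Local Open Scope ring_scope.
Variables (R : realType) (V : vectType R) (L : lie_algebra V).

Lemma lie_iso_can (W : vectType R) (M : lie_algebra W) (f : V -> W) (g : W -> V) :
  linear f -> cancel f g -> cancel g f -> (forall x y, f (L x y) = M (f x) (f y)) ->
  lie_iso L M.
Proof.
move=> lf fg gf fm; exists (linfun f) => [|x y]; last by rewrite !linfunE.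
by exists g => x; rewrite linfunE.
Qed.

Variables (e : 6.-tuple V) (k s t : R).
Hypotheses (be : basis_of {:V} e) (k0 : k != 0) (br : coupled_brackets L e k s t).

Let x i v := coord e (inord i) v.

Definition of_coords (c : seq R) : V := \sum_(i < 6) c`_i *: e`_i.

Lemma of_coordsK c i : (i < 6)%N -> x i (of_coords c) = c`_i.
Proof. by move=> hi; rewrite /x coord_sum_free ?(basis_free be) // inordK. Qed.

Lemma coordsK v : of_coords [:: x 0 v; x 1 v; x 2 v; x 3 v; x 4 v; x 5 v] = v.
Proof.
rewrite [RHS](coordE be); apply: eq_bigr => i _; congr (_ *: _).
by rewrite -[in RHS](inord_val i); case: i => i hi; do 6?[case: i hi => [|i] hi //].
Qed.

Definition row6 (c : seq R) : 'rV[R]_6 := \row_(i < 6) c`_i.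

Lemma row6E c i : (i < 6)%N -> row6 c ord0 (inord i) = c`_i.
Proof. by move=> hi; rewrite mxE inordK. Qed.

Lemma row6P (u v : 'rV[R]_6) : (forall i, (i < 6)%N -> u ord0 (inord i) = v ord0 (inord i)) -> u = v.
Proof. by move=> h; apply/rowP => i; rewrite -(inord_val i) h. Qed.

Lemma covE_row6 c i : (0 < i <= 6)%N -> cov i (row6 c) = c`_(i.-1).
Proof. by case: i => // i /andP[_ hi]; rewrite /cov row6E. Qed.

Ltac rows := apply: row6P => -[|[|[|[|[|[|//]]]]]] _.

Lemma iso_n28 : s = 0 -> t = 0 -> lie_iso L (n28 R).
Proof.
move=> s0 t0.
pose f v := row6 [:: x 2 v; x 3 v; x 4 v; x 5 v; x 1 v / k; x 0 v / k].
pose g (y : 'rV[R]_6) := let c i := y ord0 (inord i) in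
  of_coords [:: k * c 5%N; k * c 4%N; c 0%N; c 1%N; c 2%N; c 3%N].
apply: (@lie_iso_can _ _ f g).
- have xl i c u v : x i (c *: u + v) = c * x i u + x i v by rewrite /x linearP.
  by move=> c u v; rows; rewrite [RHS]mxE [X in _ = X + _]mxE !row6E //= xl //; ring.
- move=> v; rewrite -[RHS]coordsK /g !row6E //=; congr of_coords.
  by rewrite ![k * _]mulrC !mulfVK.
- by move=> y; rows; rewrite /f row6E //= !of_coordsK //= mulrC mulKf.
move=> v w; have [b0 b1 b2 [b3 b4] b5] := br v w.
rewrite s0 t0 in b0 b2 b5.
by rows; rewrite /f row6E //= [RHS]mxE (tnth_nth (fun _ _ => 0)) inordK //= /cov2 ?covE_row6 //=
  /x ?b0 ?b1 ?b2 ?b3 ?b4 ?b5; field.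
Qed.

Lemma iso_n9 : (s != 0) || (t != 0) -> lie_iso L (n9 R).
Proof.
move=> st; pose r := s * s + t * t.
have r0 : r != 0.
  rewrite /r -!expr2 paddr_eq0 ?sqr_ge0 // !sqrf_eq0 negb_and; exact: st.
(* The pairs (x_3, x_4) and (x_2, x_5) are rotated and rescaled by (s, t), up to sign, so that the
   third coordinate is closed and the fourth has differential e^{12}. Adding the fourth coordinate
   to the last one removes an e^{12} term from its differential. *)
pose f v := row6 [:: s * x 3 v + t * x 4 v; s * x 4 v - t * x 3 v; s * x 2 v - t * x 5 v;
  - (t * x 2 v + s * x 5 v); r / k * x 1 v; - (r / k) * x 0 v - (t * x 2 v + s * x 5 v)].
pose g (y : 'rV[R]_6) := let c i := y ord0 (inord i) in
  of_coords [:: k / r * (c 3%N - c 5%N); k / r * c 4%N;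
    (s * c 2%N - t * c 3%N) / r; (s * c 0%N - t * c 1%N) / r;
    (t * c 0%N + s * c 1%N) / r; - (t * c 2%N + s * c 3%N) / r].
apply: (@lie_iso_can _ _ f g).
- have xl i c u v : x i (c *: u + v) = c * x i u + x i v by rewrite /x linearP.
  by move=> c u v; rows; rewrite [RHS]mxE [X in _ = X + _]mxE !row6E //= !xl //; ring.
- move=> v; rewrite -[RHS]coordsK /g !row6E //=; congr of_coords.
  by congr [:: _; _; _; _; _; _]; rewrite /r; field; rewrite ?k0 -/r ?r0.
- by move=> y; rows; rewrite /f row6E //= !of_coordsK //= /r; field; rewrite ?k0 -/r ?r0.
move=> v w; have [b0 b1 b2 [b3 b4] b5] := br v w.
by rows; rewrite /f row6E //= [RHS]mxE (tnth_nth (fun _ _ => 0)) inordK //= /cov2 ?covE_row6 //=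
  /x ?b0 ?b1 ?b2 ?b3 ?b4 ?b5 /r; field.
Qed.

End Isomorphisms.

(** * Ricci curvature of central vectors *)

Section CentralRicci.
Local Open Scope ring_scope.
Variables (R : realType) (V : vectType R) (L : lie_algebra V).
Variables (h : V -> V -> R) (nabla : 'Hom(V, 'End(V))).
Hypothesis hl : forall y c x z, h (c *: x + z) y = c * h x y + h z y.
Hypothesis hC : forall x y, h y x = h x y.
Variables (n : nat) (e : n.-tuple V).
Hypothesis be : basis_of {:V} e.
Hypothesis ce : forall i x, coord e i x = h e`_i x.
Hypothesis lc : levi_civita L h nabla.
Hypothesis unimodular : forall v, \sum_(i < n) h e`_i (L e`_i v) = 0.

Let hDl x z y : h (x + z) y = h x y + h z y := lawD (f := fun t => h t y) (hl y) x z.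
Let hNl x y : h (- x) y = - h x y := lawN (f := fun t => h t y) (hl y) x.
Let hDr x z y : h y (x + z) = h y x + h y z.
Proof. by rewrite hC hDl !(hC _ y). Qed.
Let hNr x y : h y (- x) = - h y x.
Proof. by rewrite hC hNl hC. Qed.

Lemma h_expand u v : h u v = \sum_(j < n) h u e`_j * h v e`_j.
Proof.
rewrite {1}(coordE be v) hC (scalar_sum (f := fun t => h t u)) => [|c p q]; last exact: hl.
by apply: eq_bigr => j _; rewrite ce mulrC hC [h v _]hC.
Qed.

Lemma curvature_linear z y : linear (fun a => curvature L nabla a z y).
Proof.
move=> c a b; rewrite /curvature brDl brZl !linearP /=.
rewrite !(add_lfunE, opp_lfunE, scale_lfunE, comp_lfunE, linearP) /=.
by rewrite !scalerN [X in X + _]addrACA [LHS]addrACA !scalerBr.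
Qed.

(** For central z, derivatives along z and derivatives of z agree, and [half] expresses them by
    brackets. One part of the curvature contributes the trace of an adjoint map, which vanishes by
    unimodularity; in the other, antisymmetry leaves only differences fixed by torsion. *)
Lemma ricci_central z y : (forall x, L z x = 0) ->
  ricci L nabla z y = 4^-1 * \sum_(i < n) \sum_(j < n) h (L e`_i e`_j) y * h (L e`_i e`_j) z.
Proof.
have [tor met] := lc; move=> cz.
have zC x : nabla x z = nabla z x.
  by apply/eqP; rewrite -subr_eq0 tor brC cz oppr0.
have skew x u : h (nabla z x) u = - h x (nabla z u).
  by apply/eqP; rewrite -addr_eq0 met.
have half x u : h (nabla z x) u = - 2^-1 * h (L x u) z.
  have e1 : h (nabla z x) u = - h z (nabla x u).
    by apply/eqP; rewrite -zC -addr_eq0 met.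
  have e2 : h (nabla z x) u = h z (nabla u x).
    rewrite skew -(zC u); apply/eqP; rewrite eq_sym -addr_eq0 addrC.
    by rewrite (hC (nabla u z) x) met.
  have : h (L x u) z = h z (nabla x u) - h z (nabla u x).
    by rewrite -tor hC hDr hNr.
  by move=> ->; lra.
pose a i j := h (L e`_i e`_j) z; pose b i j := h (nabla e`_i y) e`_j.
have bE i j : b i j - b j i = - h (L e`_i e`_j) y.
  have e1 : b i j = - h y (nabla e`_i e`_j) by apply/eqP; rewrite -addr_eq0 met.
  have e2 : b j i = - h y (nabla e`_j e`_i) by apply/eqP; rewrite -addr_eq0 met.
  by rewrite e1 e2 -tor hDl hNl !(hC y); ring.
(* As [e_i, z] = 0, the curvature is a commutator. In its first part, nabla e_i w is [e_i, w] plus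
   nabla w e_i, and the latter is orthogonal to e_i. *)
have term i : h e`_i (curvature L nabla e`_i z y) =
    h e`_i (L e`_i (nabla z y)) + \sum_(j < n) (- 2^-1 * a i j) * b i j.
  have -> : curvature L nabla e`_i z y = nabla e`_i (nabla z y) - nabla z (nabla e`_i y).
    rewrite /curvature !(add_lfunE, opp_lfunE, comp_lfunE) brC cz oppr0 linear0.
    by rewrite zero_lfunE subr0.
  rewrite hDr hNr -skew [h (nabla z _) _]h_expand; congr (_ + _); last first.
    by apply: eq_bigr => j _; rewrite half.
  rewrite -tor hDr hNr; set w := nabla z y.
  have := met w e`_i e`_i; rewrite [h (nabla w _) _]hC => m.
  by rewrite (_ : h e`_i (nabla w e`_i) = 0) ?subr0 //; lra.
rewrite /ricci (trace_basis _ be).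
under eq_bigr => i _ do rewrite (linfunE (curvature_linear z y)) ce term.
rewrite big_split /= unimodular add0r.
set S := \sum_(i < n) _.
(* The coefficients [a i j] are antisymmetric, so S is also minus the sum with [b j i]; averaging
   leaves b i j - b j i, which [bE] evaluates. *)
have S' : S = - \sum_(i < n) \sum_(j < n) (- 2^-1 * a i j) * b j i.
  rewrite /S exchange_big -sumrN /=; apply: eq_bigr => i _; rewrite -sumrN.
  by apply: eq_bigr => j _; rewrite /a brC hNl; ring.
have : S + S = 2^-1 * \sum_(i < n) \sum_(j < n) h (L e`_i e`_j) y * h (L e`_i e`_j) z.
  rewrite {2}S' /S -sumrN -big_split /= big_distrr /=; apply: eq_bigr => i _.
  rewrite -sumrN -big_split /= big_distrr /=; apply: eq_bigr => j _.
  transitivity (- 2^-1 * a i j * (b i j - b j i)); first by ring.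
  by rewrite bE /a; ring.
by set T := \sum_(i < n) _ => h2; lra.
Qed.

End CentralRicci.

(** * Nilsoliton metrics of coupled structures *)

Section CoupledNilsoliton.
Local Open Scope ring_scope.
Variables (R : realType) (V : vectType R) (L : lie_algebra V).
Variables (h : V -> V -> R) (e : 6.-tuple V) (k s t : R).
Hypothesis hl : forall y c x z, h (c *: x + z) y = c * h x y + h z y.
Hypothesis hC : forall x y, h y x = h x y.
Hypotheses (be : basis_of {:V} e) (ce : forall i x, coord e i x = h e`_i x).
Hypotheses (k0 : k != 0) (br : coupled_brackets L e k s t).
Let x i v := coord e (inord i) v.

(* A derivation D preserves the center, which is contained in the span of e_0
   and e_1, whereas Ric e_0 has components - k t / 2 and - k s / 2 along e_2
   and e_5. *)
Lemma nilsoliton_flat : nilsoliton L h -> s = 0 /\ t = 0.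
Proof.
case=> Ric [[nabla lc RicE] [mu [D [derD RicD]]]].
have xe a b : (a < 6)%N -> (b < 6)%N -> x a e`_b = (a == b)%:R.
  by move=> ha hb; have := coord_e be (inord a) (inord b); rewrite -val_eqE /= !inordK.
have ce' a y : (a < 6)%N -> h e`_a y = x a y by move=> ha; rewrite /x ce inordK.
have cz y : L e`_0 y = 0.
  rewrite -(coordsK be (L e`_0 y)); have [b0 b1 b2 [b3 b4] b5] := br e`_0 y.
  rewrite b0 b1 b2 b3 b4 b5 -!/(x _ _) !xe //= !(mul0r, mulr0, subr0, addr0).
  by rewrite /of_coords big1 // => i _; case: i => i hi; do 6?[case: i hi => [|i] hi //];
    rewrite /= scale0r.
pose w := D e`_0.
have cw y : L w y = 0.
  by have := derD e`_0 y; rewrite !cz linear0 addr0.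
(* The brackets of w with e_4 and e_3 have components - k x_2(w) and - k x_5(w) along e_1. *)
have w2 : x 2 w = 0.
  have [_ + _ _ _] := br w e`_4; rewrite cw linear0 -!/(x _ _) !xe //= => e1.
  by apply: (mulfI k0); lra.
have w5 : x 5 w = 0.
  have [_ + _ _ _] := br w e`_3; rewrite cw linear0 -!/(x _ _) !xe //= => e1.
  by apply: (mulfI k0); lra.
(* Unimodularity, read off from the structure equations: no bracket with e_i has a component along
   e_i. *)
have uni v : \sum_(i < 6) h e`_i (L e`_i v) = 0.
  rewrite !big_ord_recl big_ord0; ord_norm; rewrite !ce' //.
  have H i := br e`_i v.
  have [b0 _ _ _ _] := H 0%N; have [_ b1 _ _ _] := H 1%N; have [_ _ b2 _ _] := H 2%N.
  have [_ _ _ [b3 _] _] := H 3%N; have [_ _ _ [_ b4] _] := H 4%N; have [_ _ _ _ b5] := H 5%N.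
  rewrite /x b0 b1 b2 b3 b4 b5 -!/(x _ _) !xe //=; ring.
have Rz j : (0 < j < 6)%N -> ricci L nabla e`_0 e`_j = x j w.
  case/andP => j0 j6; rewrite -RicE RicD hC ce' // add_lfunE scale_lfunE id_lfunE /x linearD linearZ /=.
  by rewrite -!/(x _ _) xe // gtn_eqF // mulr0 add0r.
pose d (a b : nat) i j := x a e`_i * x b e`_j - x b e`_i * x a e`_j.
pose d0 i j := - s * d 1%N 3%N i j - t * d 1%N 4%N i j - k * (d 2%N 5%N i j + d 3%N 4%N i j).
have T2 i j : h (L e`_i e`_j) e`_2 * h (L e`_i e`_j) e`_0 = t * d 3%N 4%N i j * d0 i j.
  by rewrite (hC e`_2) (hC e`_0) !ce' // /x; have [-> _ -> _ _] := br e`_i e`_j.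
have T5 i j : h (L e`_i e`_j) e`_5 * h (L e`_i e`_j) e`_0 = s * d 3%N 4%N i j * d0 i j.
  by rewrite (hC e`_5) (hC e`_0) !ce' // /x; have [-> _ _ _ ->] := br e`_i e`_j.
(* Only the index pairs (3, 4) and (4, 3) contribute, each with - k. *)
have E : \sum_(i < 6) \sum_(j < 6) d 3%N 4%N i j * d0 i j = - 2 * k.
  rewrite !big_ord_recl !big_ord0 /d0 /d; ord_norm; rewrite !xe //=; ring.
have pull (c : R) : \sum_(i < 6) \sum_(j < 6) c * d 3%N 4%N i j * d0 i j = c * (- 2 * k).
  rewrite -E big_distrr; apply: eq_bigr => i _; rewrite big_distrr.
  by apply: eq_bigr => j _; rewrite /= mulrA.
have solve (c : R) : 4^-1 * (c * (- 2 * k)) = 0 -> c = 0.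
  by move=> ck; apply: (mulfI k0); rewrite mulr0; lra.
split; apply: solve; rewrite -pull.
  under eq_bigr => i _ do under eq_bigr => j _ do rewrite -T5.
  by rewrite -(ricci_central hl hC be ce lc uni _ cz) Rz.
under eq_bigr => i _ do under eq_bigr => j _ do rewrite -T2.
by rewrite -(ricci_central hl hC be ce lc uni _ cz) Rz.
Qed.

End CoupledNilsoliton.

(** * The nilsoliton on n28 *)

Section N28.
Local Open Scope ring_scope.
Variable R : realType.
Notation V := 'rV[R]_6.

Definition evec (i : nat) : V := delta_mx 0 (inord i).
Definition ebasis : 6.-tuple V := [tuple evec 0; evec 1; evec 2; evec 3; evec 4; evec 5].

Lemma ebasisE (i : 'I_6) : ebasis`_i = delta_mx 0 i.
Proof.
rewrite -[in RHS](inord_val i); case: i => i hi.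
by do 6?[case: i hi => [|i] hi //].
Qed.

Lemma dim_row6 : \dim {:V}%VS = 6%N.
Proof. by rewrite dimvf /dim /= mul1n. Qed.

Lemma ebasis_basis : basis_of {:V} ebasis /\ forall i x, coord ebasis i x = x 0 i.
Proof.
apply: (dual_basis (phi := fun i (x : V) => x 0 i) dim_row6) => [i c x y|i j].
  by rewrite !mxE.
by rewrite ebasisE mxE eqxx /=.
Qed.

Lemma cov_evec i j : (0 < i <= 6)%N -> (j < 6)%N -> cov i (evec j) = (i.-1 == j)%:R :> R.
Proof.
case: i => // i /andP[_ hi] hj; rewrite /cov mxE eqxx /= -val_eqE /= !inordK //.
Qed.

(** With phi^1 = e^1 + i e^2, phi^2 = e^3 + i e^4, phi^3 = e^5 + i e^6, the algebra satisfies d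
    phi^3 = phi^1 /\ phi^2. The differential of this form is the imaginary part of phi^1 /\ phi^2 /\
    conj(phi^3); the minus sign before e^{56} reflects the conjugation of the third coordinate. *)
Definition omega28 : cochain V 2 := fun v =>
  let x := tnth v ord0 in let y := tnth v ord_max in
  cov2 1 2 x y + cov2 3 4 x y - cov2 5 6 x y.

Definition sigma28 : cochain V 3 := ext_d (n28 R) omega28.

Definition nu28 (o : R) : cochain V 6 := fun v => o * \det (\matrix_(i, j) tnth v i 0 j).

Lemma omega28E x y : omega28 [tuple x; y] = cov2 1 2 x y + cov2 3 4 x y - cov2 5 6 x y.
Proof. by []. Qed.

Lemma omega28_form : is_form omega28.
Proof.
split=> [v i c x y|v i j nij eij].
  rewrite /omega28 !tnth_subst; case: i => -[|[|//]] hi /=; rewrite /cov2 !(covD, covZ); ring.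
have h : tnth v ord0 = tnth v ord_max.
  case: i j nij eij => -[|[|//]] hi [[|[|//]] hj] // _;
    rewrite !(tnth_nth 0) //=.
rewrite /omega28 /= h /cov2; ring.
Qed.

Lemma n28_cov (x y : V) : [/\ cov 1 (n28 R x y) = 0, cov 2 (n28 R x y) = 0,
  cov 3 (n28 R x y) = 0, cov 4 (n28 R x y) = 0 &
  cov 5 (n28 R x y) = - (cov2 1 3 x y - cov2 2 4 x y) /\
  cov 6 (n28 R x y) = - (cov2 1 4 x y + cov2 2 3 x y)].
Proof.
by split; [| | | |split]; rewrite cov_br (tnth_nth (fun _ _ => 0)) inordK //= ?oppr0.
Qed.

Definition poly28 (x y z : V) : R :=
  let d i j k := cov i x * cov2 j k y z - cov i y * cov2 j k x z + cov i z * cov2 j k x y in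
  - d 1%N 3%N 6%N + d 2%N 4%N 6%N + d 1%N 4%N 5%N + d 2%N 3%N 5%N.

Lemma sigma28E x y z : sigma28 [tuple x; y; z] = poly28 x y z.
Proof.
rewrite /sigma28 ext_d2E; last exact: omega28_form.
rewrite !omega28E /cov2.
have [a1 a2 a3 a4 [a5 a6]] := n28_cov x y; have [b1 b2 b3 b4 [b5 b6]] := n28_cov x z.
have [c1 c2 c3 c4 [c5 c6]] := n28_cov y z.
rewrite a1 a2 a3 a4 a5 a6 b1 b2 b3 b4 b5 b6 c1 c2 c3 c4 c5 c6 /poly28 /cov2; ring.
Qed.

Lemma tuple3E (v : 3.-tuple V) : v = [tuple tnth v ord0; tnth v (lift ord0 ord0); tnth v ord_max].
Proof. by apply: eq_from_tnth => -[[|[|[|//]]] h]; rewrite [RHS](tnth_nth 0) /= !(tnth_nth 0). Qed.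

Lemma sigma28_form : is_form sigma28.
Proof.
split=> [v i c x y|v i j nij eij].
  rewrite [subst_tuple _ _ _ in LHS]tuple3E (tuple3E (subst_tuple v i x)) (tuple3E (subst_tuple v i y)).
  rewrite !sigma28E !tnth_subst; case: i => -[|[|[|//]]] hi /=;
    rewrite /poly28 /cov2 !(covD, covZ); ring.
rewrite (tuple3E v) sigma28E /poly28 /cov2.
have [h|[h|h]] : tnth v ord0 = tnth v (lift ord0 ord0) \/ tnth v ord0 = tnth v ord_max \/
    tnth v (lift ord0 ord0) = tnth v ord_max.
  move: eij nij; case: i => -[|[|[|//]]] hi; case: j => -[|[|[|//]]] hj //;
    rewrite !(tnth_nth 0) /= => -> _; by [left | right; left | right; right].
- rewrite h; ring.
- rewrite h; ring.
- rewrite h; ring.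
Qed.

Lemma nu28_form o : is_form (nu28 o).
Proof.
split=> [v i c x y|v i j nij eij]; rewrite /nu28.
  rewrite mulrCA -mulrDr; congr (_ * _).
  rewrite (@determinant_multilinear _ _ _ (\matrix_(a, b) tnth (subst_tuple v i x) a 0 b)
    (\matrix_(a, b) tnth (subst_tuple v i y) a 0 b) i c 1) ?mul1r //.
  - by apply/rowP => b; rewrite !mxE !tnth_subst eqxx !mxE mul1r.
  - by apply/matrixP => a b; rewrite !mxE !tnth_subst eq_sym (negbTE (neq_lift _ _)).
  - by apply/matrixP => a b; rewrite !mxE !tnth_subst eq_sym (negbTE (neq_lift _ _)).
by rewrite (determinant_alternate nij) ?mulr0 // => b; rewrite !mxE eij.
Qed.

Lemma nu28_ebasis o : nu28 o ebasis = o.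
Proof.
rewrite /nu28 (_ : \matrix_(i, j) _ = 1%:M) ?det1 ?mulr1 //.
by apply/matrixP => i j; rewrite !mxE (tnth_nth 0) ebasisE mxE eqxx /= eq_sym.
Qed.

Lemma coefs28 i j k : (i < 6)%N -> (j < 6)%N -> (k < 6)%N ->
  coefs3 ebasis sigma28 i j k = poly28 (evec i) (evec j) (evec k).
Proof.
move=> hi hj hk; rewrite /coefs3 sigma28E.
have E l : (l < 6)%N -> ebasis`_l = evec l by move=> hl; do 6?[case: l hl => [|l] hl //].
by rewrite !E.
Qed.

(* Values of sigma28 on the basis vectors numbered i < j < k. *)
Definition num28 (i j k : nat) : R :=
  match i, j, k with
  | 0%N, 2%N, 5%N => -1
  | 1%N, 3%N, 5%N | 0%N, 3%N, 4%N | 1%N, 2%N, 4%N => 1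
  | _, _, _ => 0
  end.

Lemma sigma28_basis a b c : (a < 6)%N -> (b < 6)%N -> (c < 6)%N ->
  alt_ext (coefs3 ebasis sigma28) a b c = alt_ext num28 a b c.
Proof.
move=> ha hb hc.
have F p q r : (p < q)%N -> (q < r)%N -> (r < 6)%N -> coefs3 ebasis sigma28 p q r = num28 p q r.
  move=> pq qr r6; have q6 := ltn_trans qr r6; have p6 := ltn_trans pq q6.
  rewrite coefs28 // /poly28 /cov2 !cov_evec //.
  do 6?[case: p p6 pq => [|p] p6 pq //]; do 6?[case: q q6 pq qr => [|q] q6 pq qr //];
    do 6?[case: r r6 qr => [|r] r6 qr //]; rewrite /=; ring.
rewrite /alt_ext !ltbE; do 6?[case: ifP => [/andP[? ?]|_]; first by rewrite F].
by [].
Qed.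

Lemma kap28 (i j : 'I_6) : kap (coefs3 ebasis sigma28) i j = kap num28 i j.
Proof.
rewrite /kap; case: i => i hi; case: j => j hj.
by do 6?[case: j hj => [|j] hj //]; rewrite /= !sigma28_basis.
Qed.

Lemma nu28_volume o : o != 0 -> volume_form (nu28 o).
Proof. by move=> o0; split; [exact: nu28_form | exists ebasis; rewrite nu28_ebasis]. Qed.

(** Reversing the orientation reverses J and hence h; this choice makes h positive. *)
Let nu := nu28 (-1).
Let fn : is_form nu := nu28_form (-1).
Let be := ebasis_basis.1.
Let ce := ebasis_basis.2.

Lemma nu0 : nu ebasis != 0.
Proof. by rewrite /nu nu28_ebasis oppr_eq0 oner_neq0. Qed.

Lemma lambda28 : lambda nu sigma28 = - 4.
Proof.
rewrite (lambdaE be fn nu0 sigma28_form) /nu nu28_ebasis /kap_sq.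
under eq_bigr => j _ do rewrite (kap28 ord0 j) (kap28 j ord0).
rewrite !big_ord_recl !big_ord0; ord_norm.
cbv [kap others alt_ext Nat.ltb Nat.leb andb Nat.odd Nat.even negb num28].
by rewrite /= ?expr0 ?expr1; field.
Qed.

Definition J28 (x : V) : V :=
  row6 [:: cov 2 x; - cov 1 x; cov 4 x; - cov 3 x; - cov 6 x; cov 5 x].

Lemma row6_cov (x : V) : x = row6 [:: cov 1 x; cov 2 x; cov 3 x; cov 4 x; cov 5 x; cov 6 x].
Proof. by apply: row6P => -[|[|[|[|[|[|//]]]]]] _; rewrite row6E. Qed.

Lemma J_end28 x : J_end nu sigma28 x = J28 x.
Proof.
have s4 : Num.sqrt `|lambda nu sigma28| = 2.
  rewrite lambda28 normrN ger0_norm ?ler0n // (_ : 4 = 2 ^+ 2); last by ring.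
  by rewrite sqrtr_sqr ger0_norm ?ler0n.
(* The factor - 1/2 combines the volume -1 of the basis with the square root 2 of |lambda|. *)
have E i (j : 'I_6) : (i < 6)%N ->
    coord ebasis j (J_end nu sigma28 ebasis`_i) = - 2^-1 * kap num28 i j.
  move=> hi; rewrite /J_end scale_lfunE linearZ /= s4.
  rewrite (K_coord be fn nu0 sigma28_form (Ordinal hi) j) kap28 /nu nu28_ebasis.
  by rewrite invrN1 mulrN1 mulrN mulNr.
have lin : linear J28.
  move=> c u v; apply: row6P => -[|[|[|[|[|[|//]]]]]] _;
    by rewrite [RHS]mxE [X in _ = X + _]mxE !row6E //= !(covD, covZ); ring.
rewrite (coordE be x) linear_sum -(linfunE lin) linear_sum; apply: eq_bigr => i _.
rewrite !linearZ /= linfunE //; congr (_ *: _).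
apply: row6P => j hj; rewrite -[LHS](ce (inord j)) E // row6E //.
rewrite ebasisE -[i]inord_val -/(evec i) !cov_evec //.
case: i => i hi; do 6?[case: i hi => [|i] hi //]; do 6?[case: j hj => [|j] hj //];
  rewrite !inordK //; cbv [kap others alt_ext Nat.ltb Nat.leb andb Nat.odd Nat.even negb num28];
  by rewrite /= ?expr0 ?expr1; field.
Qed.

Definition dot (x y : V) : R := cov 1 x * cov 1 y + cov 2 x * cov 2 y + cov 3 x * cov 3 y
  + cov 4 x * cov 4 y + cov 5 x * cov 5 y + cov 6 x * cov 6 y.

Lemma metric28 x y : assoc_metric nu omega28 sigma28 x y = dot x y.
Proof.
by rewrite /assoc_metric J_end28 omega28E /cov2 /J28 !covE_row6 //= /dot; ring.
Qed.

Lemma dot_gt0 x : x != 0 -> 0 < dot x x.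
Proof.
move=> x0; rewrite lt_neqAle /dot -!expr2 !addr_ge0 ?sqr_ge0 // andbT eq_sym.
apply: contra x0; rewrite !paddr_eq0 ?addr_ge0 ?sqr_ge0 // !sqrf_eq0.
case/andP => /andP[/andP[/andP[/andP[/eqP h1 /eqP h2] /eqP h3] /eqP h4] /eqP h5] /eqP h6.
apply/eqP; rewrite (row6_cov x) h1 h2 h3 h4 h5 h6.
by apply: row6P => -[|[|[|[|[|[|//]]]]]] _; rewrite row6E //= mxE.
Qed.

Lemma omega28_nondegenerate x : x != 0 -> exists y, omega28 [tuple x; y] != 0.
Proof.
move=> /dot_gt0 h; exists (J28 x); apply: contraTneq h.
rewrite form2_anti; last exact: omega28_form.
by rewrite -J_end28 -[X in - X]/(assoc_metric nu omega28 sigma28 x x) metric28 => /eqP;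
  rewrite oppr_eq0 => /eqP ->; rewrite ltxx.
Qed.

(** All brackets lie in the kernel of the projection p to the first four coordinates, and this
    kernel is central. *)
Lemma n28_nilpotent : lie_nilpotent (n28 R).
Proof.
exists 2.
have Z x y : [/\ cov 1 y = 0, cov 2 y = 0, cov 3 y = 0 & cov 4 y = 0] -> n28 R x y = 0.
  move=> [y1 y2 y3 y4]; have [a1 a2 a3 a4 [a5 a6]] := n28_cov x y.
  rewrite (row6_cov (n28 R x y)) a1 a2 a3 a4 a5 a6 /cov2 y1 y2 y3 y4.
  by apply: row6P => -[|[|[|[|[|[|//]]]]]] _; rewrite row6E //= mxE //; ring.
pose p (x : V) : V := row6 [:: cov 1 x; cov 2 x; cov 3 x; cov 4 x].
have lp : linear p.
  move=> c u v; apply: row6P => -[|[|[|[|[|[|//]]]]]] _;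
    by rewrite [RHS]mxE [X in _ = X + _]mxE !row6E //= ?(covD, covZ); ring.
have W y : y \in lker (linfun p) -> [/\ cov 1 y = 0, cov 2 y = 0, cov 3 y = 0 & cov 4 y = 0].
  rewrite memv_ker linfunE // => /eqP py.
  have H i : (0 < i <= 6)%N -> cov i (p y) = 0 by rewrite py cov0.
  by split; [have := H 1%N isT|have := H 2%N isT|have := H 3%N isT|have := H 4%N isT]; rewrite covE_row6.
have L1 : (lie_lcs (n28 R) 1 <= lker (linfun p))%VS.
  apply/span_subvP => _ /allpairsP[[x y] /= [_ _ ->]].
  rewrite memv_ker linfunE //; have [a1 a2 a3 a4 _] := n28_cov x y.
  apply/eqP; rewrite /p a1 a2 a3 a4.
  by apply: row6P => -[|[|[|[|[|[|//]]]]]] _; rewrite row6E //= mxE.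
apply/eqP; rewrite -subv0; apply/span_subvP => _ /allpairsP[[x y] /= [_ yl ->]].
have -> : br_n28 x y = 0.
  by apply: (Z x y); apply: W; apply: (subvP L1); exact: vbasis_mem.
exact: mem0v.
Qed.

Lemma scale_form k c (a : cochain V k) : is_form a -> is_form (fun v => c * a v).
Proof.
move=> [fa alt]; split=> [v i d x y|v i j nij eij]; last by rewrite (alt _ _ _ nij eij) mulr0.
by rewrite fa; ring.
Qed.

Lemma ebasis_evec i : (i < 6)%N -> ebasis`_i = evec i.
Proof. by move=> hi; do 6?[case: i hi => [|i] hi //]. Qed.

(** J permutes the basis up to sign; [Jidx] and [Jsgn] tabulate the permutation and the signs. *)
Definition Jidx (a : nat) : nat :=
  match a with 0 => 1 | 1 => 0 | 2 => 3 | 3 => 2 | 4 => 5 | _ => 4 end%N.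
Definition Jsgn (a : nat) : R :=
  match a with 0%N | 2%N | 5%N => -1 | _ => 1 end.

Lemma J28_basis a : (a < 6)%N -> J_end nu sigma28 ebasis`_a = Jsgn a *: ebasis`_(Jidx a).
Proof.
move=> ha; rewrite J_end28 !ebasis_evec //; last by do 6?[case: a ha => [|a] ha //].
apply: row6P => j hj; rewrite row6E // !cov_evec // mxE -[evec _ ord0 _]/(cov j.+1 _) cov_evec //;
  last by do 6?[case: a ha => [|a] ha //].
do 6?[case: a ha => [|a] ha //]; do 6?[case: j hj => [|j] hj //]; rewrite /=; ring.
Qed.

Definition Jnum28 (a b c : nat) : R :=
  Jsgn a * (Jsgn b * (Jsgn c * alt_ext num28 (Jidx a) (Jidx b) (Jidx c))).

Lemma pullback28_basis a b c : (a < 6)%N -> (b < 6)%N -> (c < 6)%N ->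
  pullback (J_end nu sigma28) sigma28 [tuple ebasis`_a; ebasis`_b; ebasis`_c] = Jnum28 a b c.
Proof.
have hJ p : (Jidx p < 6)%N by do 6?[case: p => [|p] //].
move=> ha hb hc; rewrite pullback3 !J28_basis //.
rewrite (form3_Z1 _ _ _ _ sigma28_form) (form3_Z2 _ _ _ _ sigma28_form) (form3_Z3 _ _ _ _ sigma28_form).
by rewrite (coefs3E ebasis sigma28_form) sigma28_basis.
Qed.

Definition onum28 (a b : nat) : R :=
  match a, b with
  | 0%N, 1%N | 2%N, 3%N | 5%N, 4%N => 1
  | 1%N, 0%N | 3%N, 2%N | 4%N, 5%N => -1
  | _, _ => 0
  end.

Lemma omega28_basis a b : (a < 6)%N -> (b < 6)%N ->
  omega28 [tuple ebasis`_a; ebasis`_b] = onum28 a b.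
Proof.
move=> ha hb; rewrite !ebasis_evec // omega28E /cov2 !cov_evec //.
do 6?[case: a ha => [|a] ha //]; do 6?[case: b hb => [|b] hb //]; rewrite /=; ring.
Qed.

Lemma compatible28 v : wedge omega28 sigma28 v = 0.
Proof.
have fw : is_form (wedge omega28 sigma28) := wedge_form omega28_form sigma28_form.
apply: (form_ext_succ be fw (@zero_form R V 5)) => i.
have E (p : nat * nat * nat * nat * nat) : p = others i ->
    etuple ebasis (lift i) = let: (p0, p1, p2, p3, p4) := p in
      [tuple ebasis`_p0; ebasis`_p1; ebasis`_p2; ebasis`_p3; ebasis`_p4].
  by move=> ->; case: i => i hi; do 6?[case: i hi => [|i] hi //];
    apply: eq_from_tnth => -[[|[|[|[|[|//]]]]] h]; rewrite tnth_mktuple !(tnth_nth 0).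
have := E _ erefl; case: i {E} => i hi.
do 6?[case: i hi => [|i] hi //] => ->;
  rewrite (wedge23E _ _ _ _ _ omega28_form sigma28_form) !omega28_basis //;
  rewrite !(coefs3E ebasis sigma28_form) !sigma28_basis //;
  cbv [onum28 num28 alt_ext Nat.ltb Nat.leb andb]; rewrite /=; ring.
Qed.

Lemma bump_lt n i j : (i < n.+1)%N -> (j < n)%N -> (bump i j < n.+1)%N.
Proof. by rewrite /bump; case: leqP; lia. Qed.

(** A form of finite sums that [cbv] evaluates, used for the wedge products of top degree. *)
Definition nsum (n : nat) (F : nat -> R) : R := foldr (fun i r => F i + r) 0 (iota 0 n).

Lemma sum_nsum n (F : nat -> R) : \sum_(i < n) F i = nsum n F.
Proof. by rewrite -(big_mkord xpredT) /index_iota subn0 unlock. Qed.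

Lemma wedge_Jsigma28 : wedge (pullback (J_end nu sigma28) sigma28) sigma28 ebasis = - 4.
Proof.
rewrite (wedge3E _ _ sigma28_form).
pose f i j k := Jnum28 i (bump i j) (bump i (bump j k)) *
  alt_ext num28 (bump i (bump j (bump k 0))) (bump i (bump j (bump k 1))) (bump i (bump j (bump k 2))).
transitivity (6^-1 * \sum_(i < 6) \sum_(j < 5) \sum_(k < 4) (-1) ^+ (i + j + k) * f i j k).
  congr (_ * _); apply: eq_bigr => i _; apply: eq_bigr => j _; apply: eq_bigr => k _.
  congr (_ * _); rewrite /f; congr (_ * _).
    by rewrite !(tnth_nth 0) pullback28_basis ?bump_lt.
  rewrite -sigma28_basis ?bump_lt // -(coefs3E ebasis sigma28_form); congr sigma28.
  by apply: eq_from_tnth => -[[|[|[|//]]] h]; rewrite tnth_mktuple !(tnth_nth 0).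
transitivity (6^-1 * nsum 6 (fun i => nsum 5 (fun j => nsum 4 (fun k => (-1) ^+
  (i + j + k) * f i j k)))).
  rewrite -sum_nsum; congr (_ * _); apply: eq_bigr => i _; rewrite -sum_nsum.
  by apply: eq_bigr => j _; rewrite -sum_nsum.
cbv [nsum foldr iota f Jnum28 Jsgn Jidx num28 alt_ext bump leq subn Nat.sub addn Nat.add nat_of_bool
  eqn eq_op Equality.sort Nat.ltb Nat.leb andb].
rewrite /= ?(mulr0, mul0r, oppr0, addr0, add0r).
by field.
Qed.

Lemma wedge_omega28 : wedge omega28 (wedge omega28 omega28) ebasis = - 6.
Proof.
have fw : is_form (wedge omega28 omega28) := wedge_form omega28_form omega28_form.
rewrite (wedge2E _ _ fw).
pose f i j p q := let g m := bump i (bump j m) in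
  onum28 (g p) (g (bump p q)) * onum28 (g (bump p (bump q 0))) (g (bump p (bump q 1))).
transitivity (2^-1 * \sum_(i < 6) \sum_(j < 5) (-1) ^+ (i + j) * (onum28 i (bump i j) *
   (2^-1 * \sum_(p < 4) \sum_(q < 3) (-1) ^+ (p + q) * f i j p q))).
  congr (_ * _); apply: eq_bigr => i _; apply: eq_bigr => j _; congr (_ * _).
  congr (_ * _); first by rewrite !(tnth_nth 0) omega28_basis ?bump_lt.
  rewrite (wedge2E _ _ omega28_form); congr (_ * _).
  apply: eq_bigr => p _; apply: eq_bigr => q _; congr (_ * _); rewrite /f; congr (_ * _).
    by rewrite !tnth_mktuple !(tnth_nth 0) omega28_basis ?bump_lt.
  rewrite -omega28_basis ?bump_lt //; congr omega28.
  by apply: eq_from_tnth => -[[|[|//]] h]; rewrite tnth_mktuple tnth_mktuple !(tnth_nth 0).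
transitivity (2^-1 * nsum 6 (fun i => nsum 5 (fun j => (-1) ^+ (i + j) * (onum28 i (bump i j) *
   (2^-1 * nsum 4 (fun p => nsum 3 (fun q => (-1) ^+ (p + q) * f i j p q))))))).
  rewrite -sum_nsum; congr (_ * _); apply: eq_bigr => i _; rewrite -sum_nsum.
  apply: eq_bigr => j _; rewrite -sum_nsum; do 3!congr (_ * _); apply: eq_bigr => p _.
  by rewrite -sum_nsum.
cbv [nsum foldr iota f onum28 bump leq subn Nat.sub addn Nat.add nat_of_bool eqn eq_op Equality.sort].
rewrite /= ?(mulr0, mul0r, oppr0, addr0, add0r).
by field.
Qed.

Lemma SU3_28 : SU3_structure nu omega28 sigma28.
Proof.
have l0 : lambda nu sigma28 < 0 by rewrite lambda28 oppr_lt0 ltr0n.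
have vol : volume_form nu by apply: nu28_volume; rewrite oppr_eq0 oner_neq0.
split=> //.
- exact: omega28_form.
- exact: sigma28_form.
- apply: (stable_nondegenerate dim_row6 omega28_form); exact: omega28_nondegenerate.
- exact: (stable_lambda_lt0 dim_row6 vol sigma28_form l0).
- exact: compatible28.
- apply: (form_ext_top be).
  + exact: (wedge_form (pullback_form _ sigma28_form) sigma28_form).
  + apply: scale_form; exact: (wedge_form omega28_form (wedge_form omega28_form omega28_form)).
  (* Forms of top degree are compared on one basis, where the normalization reads -4 = 2/3 times
     -6. *)
  + by rewrite wedge_Jsigma28 wedge_omega28; field.
- by move=> x x0; rewrite metric28 dot_gt0.
Qed.

Lemma coupled28 : coupled (n28 R) omega28 sigma28.
Proof. by exists 1 => [|v]; rewrite ?oner_neq0 ?mul1r. Qed.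

(* The Levi-Civita connection given by the Koszul formula. *)
Definition nab (x y : V) : V :=
  let a i := cov i x in let b i := cov i y in
  row6 [:: - 2^-1 * (b 5%N * a 3%N + b 6%N * a 4%N + a 5%N * b 3%N + a 6%N * b 4%N);
           - 2^-1 * (- b 5%N * a 4%N + b 6%N * a 3%N - a 5%N * b 4%N + a 6%N * b 3%N);
           - 2^-1 * (- b 5%N * a 1%N - b 6%N * a 2%N - a 5%N * b 1%N - a 6%N * b 2%N);
           - 2^-1 * (b 5%N * a 2%N - b 6%N * a 1%N + a 5%N * b 2%N - a 6%N * b 1%N);
           - 2^-1 * (cov2 1 3 x y - cov2 2 4 x y);
           - 2^-1 * (cov2 1 4 x y + cov2 2 3 x y)].

Lemma nab_cov x y :
  ((cov 1 (nab x y) = - 2^-1 * (cov 5 y * cov 3 x + cov 6 y * cov 4 x + cov 5 x * cov 3 y + cov 6 x * cov 4 y)) *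
   (cov 2 (nab x y) = - 2^-1 * (- cov 5 y * cov 4 x + cov 6 y * cov 3 x - cov 5 x * cov 4 y + cov 6 x * cov 3 y)) *
   (cov 3 (nab x y) = - 2^-1 * (- cov 5 y * cov 1 x - cov 6 y * cov 2 x - cov 5 x * cov 1 y - cov 6 x * cov 2 y))) *
  ((cov 4 (nab x y) = - 2^-1 * (cov 5 y * cov 2 x - cov 6 y * cov 1 x + cov 5 x * cov 2 y - cov 6 x * cov 1 y)) *
   (cov 5 (nab x y) = - 2^-1 * (cov2 1 3 x y - cov2 2 4 x y)) *
   (cov 6 (nab x y) = - 2^-1 * (cov2 1 4 x y + cov2 2 3 x y))).
Proof. by rewrite /nab !covE_row6. Qed.

Lemma nab_linr x : linear (nab x).
Proof.
move=> c u v; apply: row6P => -[|[|[|[|[|[|//]]]]]] _;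
  by rewrite [RHS]mxE [X in _ = X + _]mxE !row6E //= /cov2 !(covD, covZ); ring.
Qed.

Lemma nab_linl : linear (fun x => linfun (nab x) : 'End(V)).
Proof.
move=> c u v; apply/lfunP => y; rewrite add_lfunE scale_lfunE !(linfunE (nab_linr _)).
apply: row6P => -[|[|[|[|[|[|//]]]]]] _;
  by rewrite [RHS]mxE [X in _ = X + _]mxE !row6E //= /cov2 !(covD, covZ); ring.
Qed.

Definition nabla28 : 'Hom(V, 'End(V)) := linfun (fun x => linfun (nab x) : 'End(V)).

Lemma nabla28E x y : nabla28 x y = nab x y.
Proof. by rewrite /nabla28 (linfunE nab_linl) (linfunE (nab_linr x)). Qed.

Lemma cov_row6P (x y : V) : (forall i, (i < 6)%N -> cov i.+1 x = cov i.+1 y) -> x = y.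
Proof. exact: row6P. Qed.

Lemma covN i (x : V) : cov i (- x) = - cov i x.
Proof. by rewrite /cov mxE. Qed.

Lemma levi_civita28 : levi_civita (n28 R) dot nabla28.
Proof.
split=> [x y|x y z]; rewrite !nabla28E.
  have [a1 a2 a3 a4 [a5 a6]] := n28_cov x y.
  by apply: cov_row6P => -[|[|[|[|[|[|//]]]]]] _;
    rewrite ?a1 ?a2 ?a3 ?a4 ?a5 ?a6 covD covN !covE_row6 //= /cov2; field.
by rewrite /dot /nab !covE_row6 //= /cov2; field.
Qed.

Definition diag28 (p q : R) (x : V) : V :=
  row6 [:: p * cov 1 x; p * cov 2 x; p * cov 3 x; p * cov 4 x; q * cov 5 x; q * cov 6 x].

Lemma diag28_linear p q : linear (diag28 p q).
Proof.
move=> c u v; apply: row6P => -[|[|[|[|[|[|//]]]]]] _;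
  by rewrite [RHS]mxE [X in _ = X + _]mxE !row6E //= /cov2 !(covD, covZ); ring.
Qed.

Lemma ricci28 x y : ricci (n28 R) nabla28 x y = dot (diag28 (-1) 1 x) y.
Proof.
rewrite /ricci (trace_basis _ be).
under eq_bigr => i _ do rewrite (linfunE (curvature_linear _ _ _ _)) ce.
have E i : (i < 6)%N -> curvature (n28 R) nabla28 ebasis`_i x y ord0 (inord i) =
    cov i.+1 (nab (evec i) (nab x y)) - cov i.+1 (nab x (nab (evec i) y))
    - cov i.+1 (nab (n28 R (evec i) x) y).
  move=> hi; rewrite ebasis_evec // /curvature !(add_lfunE, opp_lfunE, comp_lfunE) !nabla28E.
  by rewrite -[LHS]/(cov i.+1 _) !(covD, covN).
under eq_bigr => i _ do rewrite -[i in X in _ 0 X]inord_val E //.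
rewrite !big_ord_recl !big_ord0; ord_norm.
have N1 u v := (nab_cov u v).1.
have N2 u v := (nab_cov u v).2.
have B u v i : (0 < i <= 4)%N -> cov i (n28 R u v) = 0.
  by have [a1 a2 a3 a4 _] := n28_cov u v; case: i => [|[|[|[|[|i]]]]].
have B5 u v : cov 5 (n28 R u v) = - (cov2 1 3 u v - cov2 2 4 u v).
  by have [_ _ _ _ []] := n28_cov u v.
have B6 u v : cov 6 (n28 R u v) = - (cov2 1 4 u v + cov2 2 3 u v).
  by have [_ _ _ _ []] := n28_cov u v.
rewrite !(N1, N2) !(B5, B6) !(B _ _ 1%N isT, B _ _ 2%N isT, B _ _ 3%N isT, B _ _ 4%N isT).
rewrite /cov2 ?(N1, N2) ?(B5, B6) ?(B _ _ 1%N isT, B _ _ 2%N isT, B _ _ 3%N isT, B _ _ 4%N isT)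
  /cov2 !cov_evec //.
rewrite /dot /diag28 !covE_row6 //=.
by field.
Qed.

Lemma nilsoliton28 : nilsoliton (n28 R) dot.
Proof.
exists (linfun (diag28 (-1) 1)); split.
  exists nabla28; first exact: levi_civita28.
  by move=> x y; rewrite (linfunE (diag28_linear _ _)) ricci28.
(* The Ricci operator is -1 on the first four coordinates and 1 on the last two. The weights 2 and 4
   define a derivation because 4 = 2 + 2, and -1 = -3 + 2, 1 = -3 + 4. *)
exists (-3), (linfun (diag28 2 4)); split=> [x y|].
  rewrite !(linfunE (diag28_linear _ _)).
  have [a1 a2 a3 a4 [a5 a6]] := n28_cov x y.
  have [b1 b2 b3 b4 [b5 b6]] := n28_cov (diag28 2 4 x) y.
  have [c1 c2 c3 c4 [c5 c6]] := n28_cov x (diag28 2 4 y).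
  apply: cov_row6P => -[|[|[|[|[|[|//]]]]]] _; rewrite covD covE_row6 //=
    ?a1 ?a2 ?a3 ?a4 ?a5 ?a6 ?b1 ?b2 ?b3 ?b4 ?b5 ?b6 ?c1 ?c2 ?c3 ?c4 ?c5 ?c6 /cov2 ?covE_row6 //=; ring.
apply/lfunP => x; rewrite add_lfunE scale_lfunE id_lfunE !(linfunE (diag28_linear _ _)).
apply: cov_row6P => -[|[|[|[|[|[|//]]]]]] _; rewrite covD covZ !covE_row6 //=; ring.
Qed.

Lemma admits_coupled_nilsoliton28 : admits_coupled_nilsoliton (n28 R).
Proof.
exists nu, omega28, sigma28; split; [exact: SU3_28 | exact: coupled28 |].
by rewrite (_ : assoc_metric _ _ _ = dot);
  [exact: nilsoliton28 | apply: funext => x; apply: funext => y; exact: metric28].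
Qed.

End N28.

(** * The classification and the uniqueness of the nilsoliton case *)

Theorem theorem4p1 (R : realType) :
  (forall (V : vectType R) (L : lie_algebra V),
      \dim {:V}%VS = 6 -> ~ lie_abelian L -> lie_nilpotent L ->
      admits_coupled L ->
      lie_iso L (n9 R) \/ lie_iso L (n28 R)) /\
  ((lie_nilpotent (n28 R) /\ admits_coupled_nilsoliton (n28 R)) /\
   (forall (V : vectType R) (L : lie_algebra V),
      \dim {:V}%VS = 6 -> lie_nilpotent L ->
      admits_coupled_nilsoliton L ->
      lie_iso L (n28 R))).
Proof.
split=> [V L d6 _ nilL [nu [omega [sigma [su3 [c c0 cpl]]]]]|].
  have [e [k [s [t [be ce k0 br]]]]] := coupled_structure d6 nilL su3 c0 cpl.
  case: (eqVneq s 0%R) => [s0|s0]; last by left; apply: (iso_n9 be k0 br); rewrite s0.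
  case: (eqVneq t 0%R) => [t0|t0]; last by left; apply: (iso_n9 be k0 br); rewrite t0 orbT.
  by right; exact: (iso_n28 be k0 br s0 t0).
split; first by split; [exact: n28_nilpotent | exact: admits_coupled_nilsoliton28].
move=> V L d6 nilL [nu [omega [sigma [su3 [c c0 cpl] soliton]]]].
have [e [k [s [t [be ce k0 br]]]]] := coupled_structure d6 nilL su3 c0 cpl.
have [s0 t0] := nilsoliton_flat (fun y c x z => SU3_h_linl su3 y c x z)
  (SU3_hC d6 su3) be ce k0 br soliton.
exact: (iso_n28 be k0 br s0 t0).
Qed.
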